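(* Let $s<-1/2$. Then there does not exist a time $T>0$ such that the KPBI Cauchy problem $$(\partial_t u+u_{xxx}-u_{xx}+uu_x)_x-u_{yy}=0,\qquad u(0,x,y)=\phi(x,y),$$ admits a unique solution $u$ in $C([0,T];H^{s,0}(\mathbb R^2))$ for every initial datum $\phi$ in some ball of $H^{s,0}(\mathbb R^2)$ centered at the origin and such that the map $\phi\longmapsto u$ is $C^2$-differentiable at the origin from $H^{s,0}(\mathbb R^2)$ to $C([0,T];H^{s,0}(\mathbb R^2))$.
   Context: Here $(x,y)\in\mathbb R^2$, $t\ge0$, and $u$ is real-valued. Write $\langle\cdot\rangle=(1+|\cdot|^2)^{1/2}$ and let $\hat{\ }$ be the Fourier transform in $(x,y)$ with kernel $e^{-i\langle\cdot,\cdot\rangle}$ and frequency variables $(\xi,\eta)$. The space $H^{s_1,s_2}(\mathbb R^2)$ consists of the tempered distributions $\phi$ with $\|\phi\|_{H^{s_1,s_2}}^2=\int_{\mathbb R^2}\langle\xi\rangle^{2s_1}\langle\eta\rangle^{2s_2}|\hat\phi(\xi,\eta)|^2\,d\xi d\eta<\infty$. With $P(\xi,\eta)=\xi^3+\eta^2/\xi$ and, for $t\ge0$, $\widehat{W(t)\phi}(\xi,\eta)=e^{itP(\xi,\eta)-\xi^2t}\hat\phi(\xi,\eta)$, a solution of the Cauchy problem on $[0,T]$ is understood as a solution of the Duhamel equation $u(t)=W(t)\phi-\frac12\int_0^tW(t-t')\partial_x(u^2(t'))\,dt'$, $t\in[0,T]$. *)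

(* Defs.v *)
From HB Require Import structures.
From mathcomp Require Import all_boot all_order all_algebra.
From mathcomp Require Import all_classical all_reals all_analysis.
From mathcomp Require Import complex.
Import Order.TTheory GRing.Theory Num.Theory numFieldNormedType.Exports.

Set Implicit Arguments.
Unset Strict Implicit.
Unset Printing Implicit Defensive.

Local Open Scope classical_set_scope.
Local Open Scope ring_scope.
Local Open Scope complex_scope.

Definition plane (R : realType) : Type := (measurableTypeR R * measurableTypeR R)%type.

(* Real functionals on real functions of (x, y); the real-valued tempered
   distributions are singled out below by [tempered]. *)
Definition functional (R : realType) : lmodType R := ((R * R -> R) -> R)%type.

Section Distributions.
Variable R : realType.
Implicit Types (f g psi : R * R -> R) (F : R * R -> R[i]) (v w : functional R).

Definition mu2 : {measure set (plane R) -> \bar R} :=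
  (lebesgue_measure \x lebesgue_measure)%E.

Definition d_x f : R * R -> R := fun z => 'D_(1, 0) f z.
Definition d_y f : R * R -> R := fun z => 'D_(0, 1) f z.
Definition partial (a b : nat) f : R * R -> R := iter b d_y (iter a d_x f).

(* Fréchet differentiability of every [partial a b psi] makes all of them
   continuous, so psi is smooth and the order of the derivatives is irrelevant. *)
Definition schwartz : set (R * R -> R) := [set psi |
  forall a b, (forall z, differentiable (partial a b psi) z) /\
    forall k, exists C, forall z,
      (1 + z.1 ^+ 2 + z.2 ^+ 2) ^+ k * `|partial a b psi z| <= C].

(* Real-valued tempered distributions: R-linear functionals on the real Schwartz
   functions, bounded by finitely many of the Schwartz seminorms.  They are
   extended by 0 to all other functions, so that two distributions agreeing on
   [schwartz] are equal. *)
Definition tempered : set (functional R) := [set v |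
  [/\ v \_ schwartz = v,
      forall c psi1 psi2, schwartz psi1 -> schwartz psi2 ->
        v (c *: psi1 + psi2) = c * v psi1 + v psi2
    & exists C k, forall psi M, schwartz psi ->
        (forall a b z, (a + b <= k)%N ->
          (1 + z.1 ^+ 2 + z.2 ^+ 2) ^+ k * `|partial a b psi z| <= M) ->
        `|v psi| <= C * M ]].

Definition dist_dx v : functional R := (fun psi => - v (d_x psi)) \_ schwartz.

Definition Cintegrable F : Prop :=
  mu2.-integrable setT (fun z => (complex.Re (F z))%:E) /\
  mu2.-integrable setT (fun z => (complex.Im (F z))%:E).

Definition Cintegral F : R[i] :=
  (\int[mu2]_z complex.Re (F z)) +i* (\int[mu2]_z complex.Im (F z)).

Definition expi (x : R) : R[i] := cos x +i* sin x.

Definition fourier_fun psi : R * R -> R[i] := fun zeta =>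
  Cintegral (fun z => (psi z)%:C * expi (- (z.1 * zeta.1 + z.2 * zeta.2))).

(* "The Fourier transform of v is the function F": <v, psi^> = \int F psi.
   Since v is real, it acts on psi^ through its real and imaginary parts, and
   by complex linearity it is enough to test against real psi. *)
Definition has_fourier v F : Prop :=
  [/\ tempered v,
      measurable_fun [set: plane R] (fun z => complex.Re (F z)),
      measurable_fun [set: plane R] (fun z => complex.Im (F z))
    & forall psi, schwartz psi ->
        Cintegrable (fun z => F z * (psi z)%:C) /\
        v (fun z => complex.Re (fourier_fun psi z))
          +i* v (fun z => complex.Im (fourier_fun psi z)) =
        Cintegral (fun z => F z * (psi z)%:C) ].

(* Almost everywhere unique; junk when the Fourier transform is not a function. *)
Definition fourier v : R * R -> R[i] := xget (fun=> 0) [set F | has_fourier v F].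

Definition japanese (x : R) : R := Num.sqrt (1 + x ^+ 2).

Definition sobolev_sqnorm (s1 s2 : R) F : \bar R :=
  (\int[mu2]_z (japanese z.1 `^ (2 * s1) * japanese z.2 `^ (2 * s2) *
    (complex.Re (F z) ^+ 2 + complex.Im (F z) ^+ 2))%:E)%E.

Definition sobolev (s1 s2 : R) : set (functional R) := [set v |
  (exists F, has_fourier v F) /\ (sobolev_sqnorm s1 s2 (fourier v) < +oo)%E].

(* Meaningful on [sobolev s1 s2] only. *)
Definition sobolev_norm (s1 s2 : R) v : R :=
  Num.sqrt (fine (sobolev_sqnorm s1 s2 (fourier v))).

(* C([0,T]; H^{s1,s2}), each curve being extended by 0 outside of [0,T] so that
   curves agreeing on [0,T] are equal. *)
Definition sobolev_curve (T s1 s2 : R) : set (R -> functional R) := [set u |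
  [/\ u \_ `[0, T] = u,
      forall t, 0 <= t <= T -> sobolev s1 s2 (u t)
    & forall t, 0 <= t <= T ->
        sobolev_norm s1 s2 (u t' - u t) @[t' --> within `[0, T] (nbhs t)] --> (0 : R)]].

Definition curve_norm (T s1 s2 : R) (u : R -> functional R) : R :=
  sup [set sobolev_norm s1 s2 (u t) | t in `[0, T]].

Definition KP_symbol (z : R * R) : R := z.1 ^+ 3 + z.2 ^+ 2 / z.1.

(* w = W(t) v *)
Definition evolves (t : R) v w : Prop := exists2 F, has_fourier v F &
  has_fourier w
    (fun z => (expR (- (z.1 ^+ 2 * t)))%:C * expi (t * KP_symbol z) * F z).

Definition is_function v g : Prop :=
  [/\ tempered v, measurable_fun [set: plane R] g
    & forall psi, schwartz psi ->
        mu2.-integrable setT (fun z => (g z * psi z)%:E) /\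
        v psi = \int[mu2]_z (g z * psi z)].

(* w = v^2, the pointwise square of a distribution v that is a function *)
Definition is_square v w : Prop :=
  exists2 g, is_function v g & is_function w (fun z => g z ^+ 2).

(* u(t) = W(t) phi - 1/2 \int_0^t W(t-t') d_x(u(t')^2) dt', the time integral of
   distributions being taken weakly, against each test function.  A rough u(t')
   has no square in general; u(t')^2 is required to exist for almost every t'
   only, because u(0) = phi is an arbitrary element of the Sobolev space. *)
Definition duhamel (phi : functional R) (u : R -> functional R) (t : R) : Prop :=
  exists (l : functional R) (N : R -> functional R),
  [/\ evolves t phi l,
      {ae lebesgue_measure, forall t' : R, 0 <= t' <= t ->
         exists2 q, is_square (u t') q & evolves (t - t') (dist_dx q) (N t')}
    & forall psi, schwartz psi ->
        lebesgue_measure.-integrable `[0, t] (fun t' => (N t' psi)%:E) /\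
        u t psi = l psi - 2^-1 * \int[lebesgue_measure]_(t' in `[0, t]) N t' psi].

Definition KPBI_solution (T s1 s2 : R) (phi : functional R)
    (u : R -> functional R) : Prop :=
  sobolev_curve T s1 s2 u /\ forall t, 0 <= t <= T -> duhamel phi u t.

End Distributions.

(* Normed spaces are given as a linear subspace of an ambient space with a norm
   function that is meaningful on this subspace only. *)
Section SecondOrderDifferentiability.
Variables (R : realType) (E F : lmodType R).
Variables (X : set E) (normX : E -> R) (Y : set F) (normY : F -> R).

Definition bounded_linear (L : E -> F) : Prop :=
  (forall c h k, X h -> X k -> L (c *: h + k) = c *: L h + L k) /\
  exists C, forall h, X h -> Y (L h) /\ normY (L h) <= C * normX h.

Definition bounded_bilinear (B : E -> E -> F) : Prop :=
  [/\ forall c h k l, X h -> X k -> X l ->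
        B (c *: h + k) l = c *: B h l + B k l,
      forall c h k l, X h -> X k -> X l ->
        B l (c *: h + k) = c *: B l h + B l k
    & exists C, forall h k, X h -> X k ->
        Y (B h k) /\ normY (B h k) <= C * normX h * normX k].

Definition frechet_derivative (f : E -> F) (x : E) (L : E -> F) : Prop :=
  bounded_linear L /\
  forall e, 0 < e -> exists2 d, 0 < d & forall h, X h -> normX h < d ->
    normY (f (x + h) - f x - L h) <= e * normX h.

(* B is the Fréchet derivative at x of D : X -> L(X, Y), the operator norm on
   L(X, Y) being spelled out and L(X, L(X, Y)) identified with bilinear maps. *)
Definition frechet_derivative2 (D : E -> E -> F) (x : E) (B : E -> E -> F) : Prop :=
  bounded_bilinear B /\
  forall e, 0 < e -> exists2 d, 0 < d & forall h, X h -> normX h < d ->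
    forall k, X k ->
      normY (D (x + h) k - D x k - B h k) <= e * normX h * normX k.

(* f is twice Fréchet differentiable in a neighbourhood of 0, with a second
   derivative continuous at 0. *)
Definition C2_at_origin (f : E -> F) : Prop :=
  exists (r : R) (D1 : E -> E -> F) (D2 : E -> E -> E -> F),
  [/\ 0 < r,
      forall x, X x -> normX x < r -> frechet_derivative f x (D1 x),
      forall x, X x -> normX x < r -> frechet_derivative2 D1 x (D2 x)
    & forall e, 0 < e -> exists2 d, 0 < d & forall x, X x -> normX x < d ->
        forall h k, X h -> X k ->
          normY (D2 x h k - D2 0 h k) <= e * normX h * normX k].

End SecondOrderDifferentiability.

(* Main.v *)
Require Import Defs.
From HB Require Import structures.
From mathcomp Require Import all_boot all_order all_algebra.
From mathcomp Require Import all_classical all_reals all_analysis.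
From mathcomp Require Import measurable_realfun complex ring lra.
Import Order.TTheory GRing.Theory Num.Theory numFieldNormedType.Exports.
Set Implicit Arguments.
Unset Strict Implicit.
Unset Printing Implicit Defensive.

Local Open Scope classical_set_scope.
Local Open Scope ring_scope.

(** If the flow were twice differentiable at the origin, its second derivative in
    a direction [phi] would be bounded in [C([0,T]; H^{s,0})] by a multiple of the
    square of the norm of [phi] ([second_flow_quadratic]).  Along [e phi] the flow
    is [e a1 + e^2 a2 + O(e^3)], where [a1 = W(t) phi] and
    [a2 = - 1/2 \int_0^t W(t-t') d_x (a1(t')^2) dt'] is the second Picard iterate,
    so this second derivative is [2 a2], and [2 |a2(t)| <= C |phi|^2] would follow
    for every [t] in [0,T].

    For [s < -1/2] this inequality fails on resonant packets.  Let the Fourier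
    transform of [phi] be the indicator of the four boxes in which [|xi|] is within
    [1] of [N] and [|eta|] within [N] of [sqrt 3 N^2].  Two frequencies of sum
    [(xi, eta)] interact through the phase
    [P1 + P2 - P = (xi1 xi2 / xi) ((eta1/xi1 - eta2/xi2)^2 - 3 xi^2)], which
    vanishes for [xi1 = xi2 = N] and [eta1 = - eta2 = sqrt 3 N^2], and is only
    [O(N^2)] on two boxes of the same sign in [xi] and of opposite signs in [eta]
    ([KP_symbol_interaction_le]), although each symbol is of size [N^3].  Up to a
    time of order [N^-2] neither the phase nor the dissipation [exp(- xi^2 t)] is
    felt.  On a set of measure of order [N] around [(2N, 0)] the iterate is then of
    the order of the derivative [N], times the time [N^-2], times the measure [N] of
    the interacting pairs, that is of order [1] ([second_flow_ge]).  Hence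
    [|a2(t)|^2] is at least, and [|phi|^2] at most, a multiple of [N^(2s+1)], and
    the inequality would bound [N^(-2s-1)] from above.

    For these data the flow is identified by constructing one solution and using
    uniqueness.  On Fourier transforms bounded by a multiple of the weight
    [(1 + xi^2 + eta^2)^-2] the Duhamel equation is a fixed point equation: the
    weight is stable under convolution ([RI_wt_conv]), and the dissipation pays for
    the derivative, [|xi| \int_0^t exp(- xi^2 t') dt' <= 1 + t] ([kernel_mass]).
    The Picard iteration ([picard_fixpoint]) gives the solution, and its expansion
    in the size of the datum ([picard_expansion]).  Comparing quadratic terms
    with the derivatives of the flow goes through the scalar function
    [e |-> <flow(e phi)(t), a2(t)>] ([second_order_coefficient]).

    A real distribution whose Fourier transform [F] is a function is described by
    the single real function [h = Re F - Im F], of which [Re F] and [Im F] are the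
    even part and minus the odd part: [h] is, up to normalisation, the Hartley
    transform, with kernel [cas = cos + sin].  The distribution [hdist h] so encoded
    is dealt with by Hartley inversion on Schwartz functions ([hartK], by Abel
    summation), and [schwartz_separates] shows that a Fourier transform is determined
    almost everywhere by the distribution. *)

(** * Integrals of real-valued functions *)

(** Real-valued integrands keep the extended reals out of the computations; the
    names starting with RI are about the real-valued integral. *)
Definition integ d (T : measurableType d) (R : realType)
  (m : {measure set T -> \bar R}) (f : T -> R) : Prop :=
  m.-integrable setT (EFin \o f).

Section RealIntegrals.
Context d (T : measurableType d) (R : realType) (m : {measure set T -> \bar R}).
Implicit Types f g : T -> R.

Lemma integ_meas f : integ m f -> measurable_fun setT f.
Proof. by move=> /measurable_int /measurable_EFinP. Qed.

Lemma integ_le f g : measurable_fun setT f -> (forall x, `|f x| <= g x) ->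
  integ m g -> integ m f.
Proof.
move=> mf fg ig; apply: (le_integrable measurableT _ _ ig).
- exact/measurable_EFinP.
- by move=> x _ /=; rewrite lee_fin (le_trans (fg x))// ler_norm.
Qed.

Lemma integ0 : integ m (fun=> 0).
Proof. exact: integrable0. Qed.

Lemma integD f g : integ m f -> integ m g -> integ m (fun x => f x + g x).
Proof. exact: integrableD. Qed.

Lemma integB f g : integ m f -> integ m g -> integ m (fun x => f x - g x).
Proof. exact: integrableB. Qed.

Lemma integZ c f : integ m f -> integ m (fun x => c * f x).
Proof. exact: (@integrableZl _ _ _ m _ measurableT c). Qed.

Lemma integN f : integ m f -> integ m (fun x => - f x).
Proof. exact: integrableN. Qed.

Lemma integ_norm f : integ m f -> integ m (fun x => `|f x|).
Proof. exact: integrable_norm. Qed.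

Lemma integ_ext f g : f =1 g -> integ m f -> integ m g.
Proof. by move=> /funext ->. Qed.

Lemma integ_mulb f g C : measurable_fun setT f -> (forall x, `|f x| <= C) ->
  integ m g -> integ m (fun x => f x * g x).
Proof.
move=> mf fC ig; apply: (@integ_le _ (fun x => C * `|g x|)).
- by apply: measurable_funM => //; exact: integ_meas ig.
- by move=> x; rewrite normrM ler_wpM2r.
- exact/integZ/integ_norm.
Qed.

Lemma RID f g : integ m f -> integ m g ->
  \int[m]_x (f x + g x) = \int[m]_x f x + \int[m]_x g x.
Proof. by move=> *; rewrite RintegralD. Qed.

Lemma RIB f g : integ m f -> integ m g ->
  \int[m]_x (f x - g x) = \int[m]_x f x - \int[m]_x g x.
Proof. by move=> *; rewrite RintegralB. Qed.

Lemma RIZ c f : integ m f -> \int[m]_x (c * f x) = c * \int[m]_x f x.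
Proof. by move=> *; rewrite RintegralZl. Qed.

Lemma RIZr c f : integ m f -> \int[m]_x (f x * c) = (\int[m]_x f x) * c.
Proof. by move=> *; rewrite RintegralZr. Qed.

Lemma RIN f : integ m f -> \int[m]_x (- f x) = - \int[m]_x f x.
Proof.
move=> fi; rewrite -mulN1r -RIZ//; congr Rintegral.
by apply/funext => x; rewrite mulN1r.
Qed.

Lemma RI0 : \int[m]_x (0 : R) = 0.
Proof. by rewrite /Rintegral integral0. Qed.

Lemma RI_ext f g : f =1 g -> \int[m]_x f x = \int[m]_x g x.
Proof. by move=> /funext ->. Qed.

Lemma RI_ge0 f : (forall x, 0 <= f x) -> 0 <= \int[m]_x f x.
Proof. by move=> f0; apply: Rintegral_ge0. Qed.

Lemma RI_le f g : integ m f -> integ m g -> (forall x, f x <= g x) ->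
  \int[m]_x f x <= \int[m]_x g x.
Proof. by move=> fi gi fg; apply: le_Rintegral. Qed.

Lemma RI_norm f g : measurable_fun setT f -> (forall x, `|f x| <= g x) ->
  integ m g -> `|\int[m]_x f x| <= \int[m]_x g x.
Proof.
move=> mf fg ig; have fi := integ_le mf fg ig.
apply: (le_trans (le_normr_Rintegral measurableT fi)).
by apply: RI_le => //; exact: integ_norm.
Qed.

Lemma EFin_RI f : integ m f -> ((\int[m]_x f x)%:E = \int[m]_x (f x)%:E)%E.
Proof. by move=> fi; rewrite /Rintegral fineK//; exact: integrable_fin_num. Qed.

Lemma integ_ge0P f : measurable_fun setT f -> (forall x, 0 <= f x) ->
  (\int[m]_x (f x)%:E < +oo)%E -> integ m f.
Proof.
move=> mf f0 foo; apply/integrableP; split; first exact/measurable_EFinP.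
by under eq_integral do rewrite /= ger0_norm//.
Qed.

Lemma RI_ae f g : measurable_fun setT f -> measurable_fun setT g ->
  {ae m, forall x, f x = g x} -> \int[m]_x f x = \int[m]_x g x.
Proof.
move=> mf mg fg; rewrite /Rintegral; congr fine.
apply: ae_eq_integral => //; [exact/measurable_EFinP|exact/measurable_EFinP|].
by apply: filterS fg => x /= -> _.
Qed.

Lemma RI_dominated (f_ : nat -> T -> R) f g :
  (forall n, measurable_fun setT (f_ n)) -> measurable_fun setT f ->
  integ m g -> {ae m, forall x, f_ ^~ x @ \oo --> f x} ->
  (forall n x, `|f_ n x| <= g x) ->
  (\int[m]_x f_ n x) @[n --> \oo] --> \int[m]_x f x.
Proof.
move=> mf_ mf ig cf fg.
have mE n : measurable_fun setT (EFin \o f_ n) by exact/measurable_EFinP.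
have mEf : measurable_fun setT (EFin \o f) by exact/measurable_EFinP.
have cE : {ae m, forall x, setT x -> (EFin \o f_ n) x @[n --> \oo] --> (EFin \o f) x}.
  by apply: filterS cf => x /= fx _; apply: cvg_EFin => //; exact: nearW.
have bE : {ae m, forall x n, setT x -> (`|(EFin \o f_ n) x| <= (EFin \o g) x)%E}.
  by apply: aeW => x n _ /=; rewrite lee_fin.
have [fi _ h] := dominated_convergence measurableT mE mEf cE ig bE.
by apply: fine_cvg; rewrite fineK//; exact: integrable_fin_num.
Qed.

End RealIntegrals.

Section RealFubini.
Context d1 d2 (T1 : measurableType d1) (T2 : measurableType d2) (R : realType).
Variables (m1 : {sigma_finite_measure set T1 -> \bar R})
  (m2 : {sigma_finite_measure set T2 -> \bar R}).
Implicit Types f : T1 -> T2 -> R.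

Lemma measurable_paramr f : measurable_fun setT (fun p : T1 * T2 => f p.1 p.2) ->
  measurable_fun setT (fun x => \int[m2]_y f x y).
Proof.
move=> mf; pose F (p : T1 * T2) : \bar R := (f p.1 p.2)%:E.
have mF : measurable_fun setT F by exact/measurable_EFinP.
apply: (measurableT_comp (fine_measurable (@measurableT _ _))).
rewrite [X in measurable_fun _ X](_ : _ =
  (fun x => \int[m2]_y (F^\+ (x, y)) - \int[m2]_y (F^\- (x, y)))%E); last first.
  apply/funext => x; rewrite [LHS]integralE.
  congr (_ - _)%E; apply: eq_integral => y _.
    by rewrite !funeposE.
  by rewrite !funenegE.
apply: emeasurable_funB.
- apply: (measurable_fun_fubini_tonelli_F (F^\+)%E) => //.
  exact: measurable_funepos.
- apply: (measurable_fun_fubini_tonelli_F (F^\-)%E) => //.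
  exact: measurable_funeneg.
Qed.

Section Swap.
Variables (f : T1 -> T2 -> R) (M : T1 -> R).
Hypotheses (mf : measurable_fun setT (fun p : T1 * T2 => f p.1 p.2))
  (fx : forall x, integ m2 (f x)) (iM : integ m1 M)
  (fM : forall x, \int[m2]_y `|f x y| <= M x).

Lemma integ_prod : integ (m1 \x m2)%E (fun p => f p.1 p.2).
Proof.
apply/integrable12ltyP => /=; first exact/measurable_EFinP.
apply: (@le_lt_trans _ _ (\int[m1]_x (M x)%:E)%E); last first.
  by rewrite -EFin_RI// ltry.
apply: ge0_le_integral => //.
- by move=> x _; apply: integral_ge0.
- apply: (measurable_fun_fubini_tonelli_F (fun p => `|(f p.1 p.2)%:E|)%E) => //.
  by apply: measurableT_comp => //; exact/measurable_EFinP.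
- by apply/measurable_EFinP; exact: integ_meas iM.
- by move=> x _; rewrite -(EFin_RI (integ_norm (fx x))) lee_fin.
Qed.

Lemma integ_paramr : integ m1 (fun x => \int[m2]_y f x y).
Proof.
apply: (integ_le _ _ iM); first exact: measurable_paramr.
move=> x; apply: le_trans (fM x); apply: RI_norm => //.
  exact: integ_meas (fx x).
exact: integ_norm.
Qed.

Lemma RI_prod : \int[m1]_x \int[m2]_y f x y = \int[(m1 \x m2)%E]_p f p.1 p.2.
Proof.
rewrite {1 3}/Rintegral; congr fine.
rewrite -(integral12_prod_meas1 integ_prod) /fubini_F/=.
by apply: eq_integral => x _ /=; rewrite EFin_RI.
Qed.

Hypothesis fy : forall y, integ m1 (f ^~ y).

Lemma RI_swap : \int[m1]_x \int[m2]_y f x y = \int[m2]_y \int[m1]_x f x y.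
Proof.
rewrite RI_prod [RHS]/Rintegral [LHS]/Rintegral; congr fine.
rewrite -(integral21_prod_meas1 integ_prod) /fubini_G/=.
by apply: eq_integral => x _ /=; rewrite EFin_RI.
Qed.

End Swap.

(** A product majorant gives all the integrability that Fubini asks for. *)
Section Dominated.
Variables (f : T1 -> T2 -> R) (g : T1 -> R) (k : T2 -> R).
Hypotheses (mf : measurable_fun setT (fun p : T1 * T2 => f p.1 p.2))
  (ig : integ m1 g) (ik : integ m2 k)
  (fgk : forall x y, `|f x y| <= g x * k y).

Let fx x : integ m2 (f x).
Proof.
apply: (integ_le _ (fgk x)); last exact: integZ.
exact: (measurable_fun_pair2 (f := fun p => f p.1 p.2)).
Qed.

Let fy y : integ m1 (f ^~ y).
Proof.
apply: (@integ_le _ _ _ _ _ (fun x => k y * g x)); last exact: integZ.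
  exact: (measurable_fun_pair1 (f := fun p => f p.1 p.2)).
by move=> x; rewrite mulrC.
Qed.

Let fM x : \int[m2]_y `|f x y| <= (\int[m2]_y k y) * g x.
Proof.
rewrite mulrC -RIZ//; apply: RI_le => //; first exact: integ_norm.
exact: integZ.
Qed.

Lemma integ_prod_dom : integ (m1 \x m2)%E (fun p => f p.1 p.2).
Proof. by apply: (@integ_prod f (fun x => (\int[m2]_y k y) * g x)) => //; exact: integZ. Qed.

Lemma integ_paramr_dom : integ m1 (fun x => \int[m2]_y f x y).
Proof. by apply: (@integ_paramr f (fun x => (\int[m2]_y k y) * g x)) => //; exact: integZ. Qed.

Lemma RI_prod_dom : \int[m1]_x \int[m2]_y f x y = \int[(m1 \x m2)%E]_p f p.1 p.2.
Proof. by apply: (@RI_prod f (fun x => (\int[m2]_y k y) * g x)) => //; exact: integZ. Qed.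

Lemma RI_swap_dom : \int[m1]_x \int[m2]_y f x y = \int[m2]_y \int[m1]_x f x y.
Proof. by apply: (@RI_swap f (fun x => (\int[m2]_y k y) * g x)) => //; exact: integZ. Qed.

End Dominated.
End RealFubini.

(** * Measurability of explicit real functions *)

Section MeasurableTools.
Context d (T : measurableType d) (R : realType).
Implicit Types f g : T -> R.

Lemma mD f g : measurable_fun setT f -> measurable_fun setT g ->
  measurable_fun setT (fun x => f x + g x).
Proof. exact: measurable_funD. Qed.

Lemma mB f g : measurable_fun setT f -> measurable_fun setT g ->
  measurable_fun setT (fun x => f x - g x).
Proof. exact: measurable_funB. Qed.

Lemma mM f g : measurable_fun setT f -> measurable_fun setT g ->
  measurable_fun setT (fun x => f x * g x).
Proof. exact: measurable_funM. Qed.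

Lemma mN f : measurable_fun setT f -> measurable_fun setT (fun x => - f x).
Proof. by move=> mf; exact: (measurableT_comp (@oppr_measurable _ _)). Qed.

Lemma mX f n : measurable_fun setT f -> measurable_fun setT (fun x => f x ^+ n).
Proof. exact: measurable_funX. Qed.

Lemma mnorm f : measurable_fun setT f -> measurable_fun setT (fun x => `|f x|).
Proof. by move=> mf; exact: (measurableT_comp (@normr_measurable _ _)). Qed.

Lemma mcomp (h : R -> R) f : measurable_fun setT h -> measurable_fun setT f ->
  measurable_fun setT (fun x => h (f x)).
Proof. exact: measurableT_comp. Qed.

Lemma mexp f : measurable_fun setT f -> measurable_fun setT (fun x => expR (f x)).
Proof. by move=> mf; exact: (measurableT_comp (@measurable_expR _)). Qed.

Lemma mcos f : measurable_fun setT f -> measurable_fun setT (fun x => cos (f x)).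
Proof.
apply: mcomp; apply: continuous_measurable_fun; exact: continuous_cos.
Qed.

Lemma msin f : measurable_fun setT f -> measurable_fun setT (fun x => sin (f x)).
Proof.
apply: mcomp; apply: continuous_measurable_fun; exact: continuous_sin.
Qed.

Lemma measurable_inv : measurable_fun setT (@GRing.inv R).
Proof.
have -> : (@GRing.inv R) = (fun x => if (x == 0) then (cst 0 x) else x^-1).
  by apply/funext => x; case: eqP => // ->; rewrite invr0.
have -> : [set: R] = [set 0] `|` [set~ 0] by rewrite setUv.
apply/measurable_funU => //; first exact: measurableC.
split; first exact: measurable_fun_set1.
apply: (@eq_measurable_fun _ _ _ _ _ (@GRing.inv R)).
  by move=> x; rewrite inE /= => /eqP/negPf ->.
apply: (@subspace_continuous_measurable_fun _ _ (@GRing.inv R)).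
  exact: measurableC.
rewrite continuous_open_subspace.
  by move=> x; rewrite inE => /eqP x0; exact: inv_continuous.
by apply: closed_openC; exact: closed_eq.
Qed.

Lemma mV f : measurable_fun setT f -> measurable_fun setT (fun x => (f x)^-1).
Proof. exact: mcomp measurable_inv. Qed.

Lemma mle f g : measurable_fun setT f -> measurable_fun setT g ->
  measurable_fun setT (fun x => ((f x <= g x)%R)%:R : R).
Proof.
move=> mf mg; have := @measurable_fun_ler _ _ _ setT f g mf mg.
move=> h; rewrite (_ : (fun _ => _) = (fun x => if f x <= g x then 1 else 0)).
  exact: measurable_fun_ifT.
by apply/funext => x; case: ifP.
Qed.

Lemma mpow (p : R) f : measurable_fun setT f ->
  measurable_fun setT (fun x => f x `^ p).
Proof. exact: mcomp (@measurable_powR _ p). Qed.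

End MeasurableTools.

Lemma mpair1 d1 d2 d3 (X : measurableType d1) (Y : measurableType d2)
  (Z : measurableType d3) (f : X -> Y * Z) : measurable_fun setT f ->
  measurable_fun setT (fun x => (f x).1).
Proof. by move=> mf; exact: (measurableT_comp measurable_fst). Qed.

Lemma mpair2 d1 d2 d3 (X : measurableType d1) (Y : measurableType d2)
  (Z : measurableType d3) (f : X -> Y * Z) : measurable_fun setT f ->
  measurable_fun setT (fun x => (f x).2).
Proof. by move=> mf; exact: (measurableT_comp measurable_snd). Qed.

Lemma mpair d1 d2 d3 (X : measurableType d1) (Y : measurableType d2)
  (Z : measurableType d3) (f : X -> Y) (g : X -> Z) : measurable_fun setT f ->
  measurable_fun setT g -> measurable_fun setT (fun x => (f x, g x)).
Proof. exact: measurable_fun_pair. Qed.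

Lemma mcompT d1 d2 d3 (X : measurableType d1) (Y : measurableType d2)
  (Z : measurableType d3) (h : Y -> Z) (f : X -> Y) : measurable_fun setT h ->
  measurable_fun setT f -> measurable_fun setT (fun x => h (f x)).
Proof. exact: measurableT_comp. Qed.

(** Follows the syntax of the function; hypotheses on its parts are applied
    where the syntax stops. *)
Ltac meas1 :=
  match goal with
  | H : measurable_fun setT ?f |- measurable_fun setT ?f => exact H
  | |- measurable_fun _ (fun=> ?c) => exact: measurable_cst
  | |- measurable_fun _ (fun x => x) => exact: measurable_id
  | |- measurable_fun _ fst => exact: measurable_fst
  | |- measurable_fun _ snd => exact: measurable_snd
  | |- measurable_fun _ (fun x => @?f x + @?g x) => apply: (@mD _ _ _ f g)
  | |- measurable_fun _ (fun x => @?f x * @?g x) => apply: (@mM _ _ _ f g)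
  | |- measurable_fun _ (fun x => - @?f x) => apply: (@mN _ _ _ f)
  | |- measurable_fun _ (fun x => @?f x ^+ ?n) => apply: (@mX _ _ _ f n)
  | |- measurable_fun _ (fun x => `| @?f x |) => apply: (@mnorm _ _ _ f)
  | |- measurable_fun _ (fun x => (@?f x)^-1) => apply: (@mV _ _ _ f)
  | |- measurable_fun _ (fun x => expR (@?f x)) => apply: (@mexp _ _ _ f)
  | |- measurable_fun _ (fun x => cos (@?f x)) => apply: (@mcos _ _ _ f)
  | |- measurable_fun _ (fun x => sin (@?f x)) => apply: (@msin _ _ _ f)
  | |- measurable_fun _ (fun x => (@?f x) `^ ?p) => apply: (@mpow _ _ _ p f)
  | |- measurable_fun _ (fun x => (@?f x, @?g x)) => apply: (mpair (f := f) (g := g))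
  | |- measurable_fun _ (fun x => (@?f x).1) => apply: (mpair1 (f := f))
  | |- measurable_fun _ (fun x => (@?f x).2) => apply: (mpair2 (f := f))
  | H : measurable_fun setT ?h |- measurable_fun _ (fun x => ?h (@?f x)) =>
      apply: (mcompT (h := h) (f := f) H)
  end.
Ltac meas := repeat meas1.

(** * Lebesgue measure on the line and on the plane *)

(** [phi] multiplies the measure by [k]; this is stated on integrals of non-negative
    functions, in which form it passes to products by Tonelli. *)
Definition transports d (T : measurableType d) (R : realType)
  (m : {measure set T -> \bar R}) (phi : T -> T) (k : R) : Prop :=
  forall f : T -> \bar R, measurable_fun setT f -> (forall x, 0 <= f x)%E ->
    (\int[m]_x f (phi x) = k%:E * \int[m]_x f x)%E.

Section Transport.
Context d (T : measurableType d) (R : realType) (m : {measure set T -> \bar R}).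
Variables (phi : T -> T) (k : R).
Hypotheses (mphi : measurable_fun setT phi) (k0 : 0 <= k)
  (tphi : transports m phi k).

Lemma integ_transport (f : T -> R) : integ m f -> integ m (fun x => f (phi x)).
Proof.
move=> fi; have mf := integ_meas fi.
apply/integrableP; split; first by apply/measurable_EFinP; meas.
rewrite (tphi (f := fun x => `|(f x)%:E|%E))//; last first.
  by apply: measurableT_comp => //; exact/measurable_EFinP.
by case/integrableP : fi => _ foo; rewrite lte_mul_pinfty.
Qed.

Lemma RI_transport (f : T -> R) : integ m f ->
  \int[m]_x f (phi x) = k * \int[m]_x f x.
Proof.
move=> fi; have mf := integ_meas fi.
have mF : measurable_fun setT (EFin \o f) by exact/measurable_EFinP.
have fpi := integ_transport fi.
apply: EFin_inj; rewrite EFinM !EFin_RI//.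
rewrite integralE [in RHS]integralE muleBr//; last first.
  by rewrite fin_num_adde_defr//; exact: integrable_pos_fin_num.
rewrite -!(tphi (f := ((EFin \o f)^\+)%E)) -?(tphi (f := ((EFin \o f)^\-)%E))//.
- congr (_ - _)%E; apply: eq_integral => x _.
    by rewrite !funeposE.
  by rewrite !funenegE.
- exact: measurable_funeneg.
- exact: measurable_funepos.
Qed.

End Transport.

Section TransportR.
Variable R : realType.
Notation leb := (@lebesgue_measure R).

Lemma transports_of_measure d (T : measurableType d)
  (m m' : {measure set T -> \bar R}) (phi : T -> T) (k : {nonneg R}) :
  measurable_fun setT phi ->
  (forall A, measurable A -> pushforward m phi A = mscale k m A) ->
  transports m phi k%:num.
Proof.
move=> mphi eqm f mf f0.
transitivity (\int[pushforward m phi]_x f x)%E.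
  by rewrite ge0_integral_pushforward.
rewrite -(ge0_integral_mscale _ measurableT)//.
by apply: eq_measure_integral => A mA _; exact: eqm.
Qed.

Lemma transports_affine (c d : R) : 0 < c ->
  transports leb (fun x => c * x + d) c^-1.
Proof.
move=> c0; have c1 : 0 <= c by exact: ltW.
have ci0 : 0 <= c^-1 by rewrite invr_ge0.
have mphi : measurable_fun setT (fun x : measurableTypeR R => c * x + d : measurableTypeR R).
  by meas.
apply: (@transports_of_measure _ _ leb leb (fun x => c * x + d) (NngNum ci0)) => // A mA.
pose m' : {measure set (measurableTypeR R) -> \bar R} :=
  mscale (NngNum c1) (pushforward leb (fun x : measurableTypeR R => c * x + d : measurableTypeR R)).
have E : forall X, measurable X -> leb X = m' mphi X.
  apply: lebesgue_measure_unique => X [[a b] _ <-].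
  have P : (fun x => c * x + d) @^-1` `]a, b]%classic =
      `](a - d) / c, (b - d) / c]%classic.
    apply/seteqP; split => x; rewrite /= !in_itv/=.
      by rewrite ltr_pdivrMr// ler_pdivlMr// ltrBlDr lerBrDr mulrC.
    by rewrite ltr_pdivrMr// ler_pdivlMr// ltrBlDr lerBrDr mulrC.
  rewrite -[RHS]/(c%:E * leb ((fun x => c * x + d)%R @^-1` `]a, b]%classic))%E P.
  rewrite !lebesgue_measure_itv/= !lte_fin ltr_pM2r ?invr_gt0// ltrD2r.
  case: ifPn => _; last by rewrite mule0.
  by rewrite -!EFinB -EFinM; congr EFin; field; rewrite gt_eqF.
rewrite /mscale/= (E A mA) /m'/= /mscale/= muleA -EFinM.
by rewrite mulVf ?gt_eqF// mul1e.
Qed.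

Lemma transports_opp : transports leb (fun x => - x) 1.
Proof.
have mphi : measurable_fun setT (fun x : measurableTypeR R => - x : measurableTypeR R).
  by meas.
apply: (@transports_of_measure _ _ leb leb (fun x => - x) (NngNum ler01)) => // A mA.
rewrite /mscale/= mul1e; apply/esym.
pose m' : {measure set (measurableTypeR R) -> \bar R} :=
  pushforward leb (fun x : measurableTypeR R => - x : measurableTypeR R).
apply: (@lebesgue_measure_unique _ (m' mphi)) => // X [[a b] _ <-].
have P : (fun x => - x) @^-1` `]a, b]%classic = `[- b, - a[%classic.
  apply/seteqP; split => x; rewrite /= !in_itv/= => /andP[h1 h2]; apply/andP; lra.
rewrite -[RHS]/(leb ((fun x => - x) @^-1` `]a, b]%classic)) P.
rewrite !lebesgue_measure_itv/= !lte_fin ltrN2.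
by case: ifPn => // _; rewrite -!EFinB; congr EFin; ring.
Qed.

End TransportR.

(** Fubini for products with the plane needs the plane measure as a sigma-finite
    one. *)
Section PlaneSigmaFinite.
Variable R : realType.
Notation leb := (@lebesgue_measure R).

Definition leb2_fun : set (plane R) -> \bar R := mu2 R.

HB.instance Definition _ := Measure.on leb2_fun.

Lemma leb2_sigma_finite : sigma_finite setT leb2_fun.
Proof.
pose A (n : nat) : set (measurableTypeR R) := `[- n%:R, n%:R]%classic.
have mA n : measurable (A n) by exact: measurable_itv.
exists (fun n => A n `*` A n).
  apply/seteqP; split => // -[x y] _.
  have [n xn] : exists n : nat, `|x| + `|y| <= n%:R.
    by exists (Num.Def.archi_bound (`|x| + `|y|)); exact/ltW/archi_boundP/addr_ge0.
  exists n => //=; rewrite /A /= !in_itv/= -!ler_norml.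
  by split; apply: le_trans xn; rewrite ?lerDl ?lerDr.
move=> n; split; first exact: measurableX.
have [r rE] : exists r : R, leb (A n) = r%:E.
  rewrite /A lebesgue_measure_itv/=; case: ifP => _; last by exists 0.
  by exists (n%:R - - n%:R); rewrite EFinB.
rewrite /leb2_fun /= product_measure1E//.
by rewrite -[X in (X < _)%E]/(leb (A n) * leb (A n))%E rE -EFinM ltry.
Qed.

HB.instance Definition _ := Measure_isSigmaFinite.Build _ _ _ leb2_fun leb2_sigma_finite.

Definition leb2 : {sigma_finite_measure set (plane R) -> \bar R} := leb2_fun.
End PlaneSigmaFinite.

Section PlaneOps.
Variable R : realType.
Implicit Types z a : plane R.

Definition popp z : plane R := (- z.1, - z.2).
Definition psub z a : plane R := (z.1 - a.1, z.2 - a.2).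
Definition padd z a : plane R := (z.1 + a.1, z.2 + a.2).
Definition pdot z a : R := z.1 * a.1 + z.2 * a.2.

Lemma poppK : involutive popp.
Proof. by case=> x y; rewrite /popp/= !opprK. Qed.

End PlaneOps.

Section PlaneMeasurable.
Context d (T : measurableType d) (R : realType).
Implicit Types f g : T -> plane R.

Lemma m_popp f : measurable_fun setT f -> measurable_fun setT (fun x => popp (f x)).
Proof. by move=> mf; rewrite /popp; meas. Qed.

Lemma m_psub f g : measurable_fun setT f -> measurable_fun setT g ->
  measurable_fun setT (fun x => psub (f x) (g x)).
Proof. by move=> mf mg; rewrite /psub; meas. Qed.

Lemma m_padd f g : measurable_fun setT f -> measurable_fun setT g ->
  measurable_fun setT (fun x => padd (f x) (g x)).
Proof. by move=> mf mg; rewrite /padd; meas. Qed.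

Lemma m_pdot f g : measurable_fun setT f -> measurable_fun setT g ->
  measurable_fun setT (fun x => pdot (f x) (g x)).
Proof. by move=> mf mg; rewrite /pdot; meas. Qed.

End PlaneMeasurable.

Ltac meas2 :=
  match goal with
  | |- measurable_fun _ (@popp _) => apply: (@m_popp _ _ _ id)
  | |- measurable_fun _ (pdot ?a) => apply: (@m_pdot _ _ _ (fun=> a) id)
  | |- measurable_fun _ (psub ?a) => apply: (@m_psub _ _ _ (fun=> a) id)
  | |- measurable_fun _ (fun x => popp (@?f x)) => apply: (@m_popp _ _ _ f)
  | |- measurable_fun _ (fun x => psub (@?f x) (@?g x)) => apply: (@m_psub _ _ _ f g)
  | |- measurable_fun _ (fun x => padd (@?f x) (@?g x)) => apply: (@m_padd _ _ _ f g)
  | |- measurable_fun _ (fun x => pdot (@?f x) (@?g x)) => apply: (@m_pdot _ _ _ f g)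
  | _ => meas1
  end.
Ltac meas ::= repeat meas2.

Section PlaneMeasure.
Variable R : realType.
Notation leb := (@lebesgue_measure R).
Implicit Types f g : plane R -> R.

Lemma transports_prod (p1 p2 : measurableTypeR R -> measurableTypeR R) (k1 k2 : R) :
  measurable_fun setT p1 -> measurable_fun setT p2 -> 0 <= k1 -> 0 <= k2 ->
  transports leb p1 k1 -> transports leb p2 k2 ->
  transports (mu2 R) (fun z : plane R => (p1 z.1, p2 z.2)) (k1 * k2).
Proof.
move=> mp1 mp2 k10 k20 t1 t2 f mf f0.
rewrite (fubini_tonelli1 (m1 := leb) (m2 := leb) (fun z : plane R => f (p1 z.1, p2 z.2)))//;
  last by meas.
rewrite [in RHS](fubini_tonelli1 (m1 := leb) (m2 := leb) f)//.
rewrite /fubini_F /=.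
pose F x := (\int[leb]_y f (x, y))%E.
have mF : measurable_fun setT F by exact: measurable_fun_fubini_tonelli_F.
have F0 x : (0 <= F x)%E by apply: integral_ge0.
transitivity (\int[leb]_x (k2%:E * F (p1 x)))%E.
  apply: eq_integral => x _ /=; rewrite (t2 (fun y => f (p1 x, y)))//.
  exact: (measurable_fun_pair2 (f := f)).
have mFp : measurable_fun setT (fun x => F (p1 x)) by exact: (measurableT_comp mF).
rewrite (ge0_integralZl _ measurableT mFp (fun x _ => F0 (p1 x)))//.
by rewrite (t1 F)// muleA -EFinM [k2 * k1]mulrC.
Qed.

Lemma transports_popp : transports (mu2 R) (@popp R) 1.
Proof.
rewrite -[X in transports _ _ X]mulr1; apply: transports_prod => //; try exact: transports_opp; meas.
Qed.

Lemma transports_shift c : transports (mu2 R) (fun z => psub z c) 1.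
Proof.
rewrite -[X in transports _ _ X]mulr1.
apply: (@transports_prod (fun x => x - c.1) (fun x => x - c.2)) => //; meas.
- move=> f mf f0; have := @transports_affine R 1 (- c.1) ltr01 f mf f0.
  by rewrite invr1; under eq_integral do rewrite mul1r.
- move=> f mf f0; have := @transports_affine R 1 (- c.2) ltr01 f mf f0.
  by rewrite invr1; under eq_integral do rewrite mul1r.
Qed.

Lemma integ_popp f : integ (mu2 R) f -> integ (mu2 R) (fun z => f (popp z)).
Proof. by apply: (integ_transport (phi := @popp R) (k := 1)) => //; [meas|exact: transports_popp]. Qed.

Lemma RI_popp f : integ (mu2 R) f -> \int[mu2 R]_z f (popp z) = \int[mu2 R]_z f z.
Proof.
move=> fi; rewrite (RI_transport (k := 1)) ?mul1r//; [meas|exact: transports_popp].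
Qed.

Lemma integ_shift c f : integ (mu2 R) f -> integ (mu2 R) (fun z => f (psub z c)).
Proof. by apply: (integ_transport (k := 1)) => //; [meas|exact: transports_shift]. Qed.

Lemma RI_shift c f : integ (mu2 R) f -> \int[mu2 R]_z f (psub z c) = \int[mu2 R]_z f z.
Proof.
move=> fi; rewrite (RI_transport (phi := fun z => psub z c) (k := 1)) ?mul1r//; [meas|exact: transports_shift].
Qed.

Lemma integ_refl c f : integ (mu2 R) f -> integ (mu2 R) (fun z => f (psub c z)).
Proof.
move=> fi; have := integ_popp (integ_shift (popp c) fi); apply: integ_ext => z.
by congr f; rewrite /psub /popp/= !opprK ![- _ + _]addrC.
Qed.

Lemma RI_refl c f : integ (mu2 R) f -> \int[mu2 R]_z f (psub c z) = \int[mu2 R]_z f z.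
Proof.
move=> fi; rewrite -[RHS](RI_shift (popp c))// -[RHS]RI_popp; last exact: integ_shift.
by apply: RI_ext => z; congr f; rewrite /psub /popp/= !opprK ![- _ + _]addrC.
Qed.

Definition w1 (x : R) : R := (1 + x ^+ 2)^-1.

Lemma w1_gt0 x : 0 < w1 x.
Proof. by rewrite invr_gt0 ltr_pwDl// sqr_ge0. Qed.

Lemma integ_w1 : integ leb w1.
Proof.
have mw : measurable_fun setT w1 by rewrite /w1; meas.
apply: integ_ge0P => //; first by move=> x; exact/ltW/w1_gt0.
rewrite (ge0_symfun_integralT (f := w1)).
- rewrite (_ : [set x | _] = `[0%R, +oo[%classic); last first.
    by apply/seteqP; split => x /=; rewrite in_itv/= andbT.
  by rewrite (@integral0y_oneDsqr R) -EFinM ltry.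
- by move=> x; exact/ltW/w1_gt0.
- exact: continuous_oneDsqrV.
- by move=> x; rewrite /w1/= sqrrN.
Qed.

Definition cauchy_mass : R := \int[leb]_x w1 x.

(** The Markov inequality, read as a lower bound for the integral. *)
Lemma RI_lower d (T : measurableType d) (m : {measure set T -> \bar R}) (f : T -> R)
  (A : set T) c : measurable A -> 0 <= c -> integ m f ->
  (forall x, 0 <= f x) -> (forall x, A x -> c <= f x) ->
  (c%:E * m A <= (\int[m]_x f x)%:E)%E.
Proof.
move=> mA c0 fi f0 cf; rewrite EFin_RI// -integral_cst//.
have mf : measurable_fun setT (EFin \o f) by apply/measurable_EFinP; exact: integ_meas fi.
apply: (@le_trans _ _ (\int[m]_(x in A) (f x)%:E)%E).
  apply: ge0_le_integral => //; try by move=> x Ax; rewrite lee_fin ?cf.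
  exact: measurable_funTS.
apply: ge0_subset_integral => //.
by move=> x _; rewrite lee_fin.
Qed.

Lemma cauchy_mass_gt0 : 0 < cauchy_mass.
Proof.
rewrite -lte_fin.
have h : ((2^-1)%:E * leb (`[0%R, 1%R]%classic : set R) <= cauchy_mass%:E)%E.
  apply: RI_lower => //; first exact: integ_w1.
  - by move=> x; exact/ltW/w1_gt0.
  - move=> x; rewrite /= in_itv/= => /andP[x0 x1]; rewrite /w1 lef_pV2 ?posrE//; last first.
      by rewrite ltr_pwDl// sqr_ge0.
    by nra.
apply: lt_le_trans h; rewrite lebesgue_measure_itv/= lte_fin ltr01 oppr0 adde0 mule1.
by rewrite lte_fin.
Qed.

Lemma integ_plane_prod (g k : R -> R) : integ leb g -> integ leb k ->
  integ (mu2 R) (fun z => g z.1 * k z.2).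
Proof.
move=> ig ik; have mg := integ_meas ig; have mk := integ_meas ik.
apply: (@integ_prod_dom _ _ _ _ _ leb leb (fun x y => g x * k y)
  (fun x => `|g x|) (fun y => `|k y|)).
- by meas.
- exact: integ_norm.
- exact: integ_norm.
- by move=> x y; rewrite normrM.
Qed.

Lemma RI_plane (f : plane R -> R) (g k : R -> R) : measurable_fun setT f ->
  integ leb g -> integ leb k -> (forall x y, `|f (x, y)| <= g x * k y) ->
  \int[mu2 R]_z f z = \int[leb]_x \int[leb]_y f (x, y).
Proof.
move=> mf ig ik fgk.
rewrite (@RI_prod_dom _ _ _ _ _ leb leb (fun x y => f (x, y)) g k)//.
  by apply: RI_ext => -[].
by rewrite (_ : (fun _ => _) = f)//; apply/funext => -[].
Qed.

Lemma RI_plane_prod (g k : R -> R) : integ leb g -> integ leb k ->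
  \int[mu2 R]_z (g z.1 * k z.2) = (\int[leb]_x g x) * \int[leb]_y k y.
Proof.
move=> ig ik; have mg := integ_meas ig; have mk := integ_meas ik.
rewrite (@RI_plane _ (fun x => `|g x|) (fun y => `|k y|)).
- rewrite -RIZr//; apply: RI_ext => x /=; by rewrite RIZ.
- by meas.
- exact: integ_norm.
- exact: integ_norm.
- by move=> x y; rewrite normrM.
Qed.

(** The weight is a power of the Schwartz weight, so that it dominates Schwartz
    functions, and the square makes it integrable and submultiplicative under
    convolution. *)
Definition wt (z : plane R) : R := ((1 + z.1 ^+ 2 + z.2 ^+ 2) ^+ 2)^-1.

Lemma bracket_ge1 (z : plane R) : 1 <= 1 + z.1 ^+ 2 + z.2 ^+ 2.
Proof. by have := sqr_ge0 z.1; have := sqr_ge0 z.2; lra. Qed.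

Lemma bracket_gt0 (z : plane R) : 0 < 1 + z.1 ^+ 2 + z.2 ^+ 2.
Proof. exact: lt_le_trans (bracket_ge1 z). Qed.

Lemma wt_gt0 z : 0 < wt z.
Proof. by rewrite invr_gt0 exprn_gt0// bracket_gt0. Qed.

Lemma wt_ge0 z : 0 <= wt z. Proof. exact/ltW/wt_gt0. Qed.

Lemma wt_le1 z : wt z <= 1.
Proof. by rewrite invf_le1 ?exprn_gt0 ?bracket_gt0// exprn_ege1// bracket_ge1. Qed.

Lemma wt_popp z : wt (popp z) = wt z.
Proof. by rewrite /wt/= !sqrrN. Qed.

Lemma m_wt : measurable_fun setT wt.
Proof. by rewrite /wt; meas. Qed.

Lemma wt_le_prod z : wt z <= w1 z.1 * w1 z.2.
Proof.
rewrite /wt /w1 -invfM lef_pV2 ?posrE ?exprn_gt0 ?bracket_gt0//; last first.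
  by rewrite mulr_gt0// ltr_pwDl// sqr_ge0.
by have := sqr_ge0 z.1; have := sqr_ge0 z.2; nra.
Qed.

Lemma integ_wt : integ (mu2 R) wt.
Proof.
apply: (@integ_le _ _ _ (mu2 R) _ (fun z : plane R => w1 z.1 * w1 z.2)) => //; first exact: m_wt.
  by move=> z; rewrite ger0_norm ?wt_ge0// wt_le_prod.
by apply: integ_plane_prod; exact: integ_w1.
Qed.

Definition wt_mass : R := \int[mu2 R]_z wt z.

Lemma wt_mass_ge0 : 0 <= wt_mass.
Proof. by apply: RI_ge0 => z; exact: wt_ge0. Qed.

(** One of [a], [z - a] is at least half as large as [z]. *)
Lemma wt_conv z a : wt a * wt (psub z a) <= 8 * wt z * (wt a + wt (psub z a)).
Proof.
pose B (u : plane R) := 1 + u.1 ^+ 2 + u.2 ^+ 2.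
have B0 u : 0 < B u by exact: bracket_gt0.
have B00 u : B u != 0 by rewrite gt_eqF.
have Bz : B z <= 2 * B a + 2 * B (psub z a).
  rewrite /B /psub/=; have := sqr_ge0 (z.1 - 2 * a.1); have := sqr_ge0 (z.2 - 2 * a.2); nra.
have -> : wt a * wt (psub z a) = (B a ^+ 2 * B (psub z a) ^+ 2)^-1 by rewrite invfM.
have -> : 8 * wt z * (wt a + wt (psub z a)) =
   (8 * (B a ^+ 2 + B (psub z a) ^+ 2)) / (B z ^+ 2 * (B a ^+ 2 * B (psub z a) ^+ 2)).
  by rewrite /wt -!/(B _); field; rewrite !B00.
rewrite ler_pdivlMr; last by rewrite !mulr_gt0// exprn_gt0.
rewrite mulrCA mulVf ?mulr1; last by rewrite mulf_neq0// expf_neq0.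
have := B0 z; have := B0 a; have := B0 (psub z a); move: Bz.
move: (B z) (B a) (B (psub z a)) => x y t h t0 y0 x0.
have : x ^+ 2 <= (2 * y + 2 * t) ^+ 2 by rewrite lerXn2r// nnegrE; lra.
by have := sqr_ge0 (y - t); nra.
Qed.

Lemma integ_wt_conv z : integ (mu2 R) (fun a => wt a * wt (psub z a)).
Proof.
apply: (@integ_mulb _ _ _ _ _ _ 1).
- exact: m_wt.
- by move=> a; rewrite ger0_norm ?wt_ge0// wt_le1.
- exact: integ_refl integ_wt.
Qed.

(** The weighted sup norm is an algebra norm for convolution. *)
Lemma RI_wt_conv z : \int[mu2 R]_a (wt a * wt (psub z a)) <= 16 * wt_mass * wt z.
Proof.
have i1 := integ_wt; have i2 := integ_refl z i1.
apply: le_trans (RI_le (integ_wt_conv z) (integZ (8 * wt z) (integD i1 i2)) (wt_conv z)) _.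
rewrite RIZ; last exact: integD.
by rewrite RID// RI_refl// -/wt_mass; lra.
Qed.

End PlaneMeasure.

(** * Calculus on the line *)

Section LineCalculus.
Variable R : realType.
Notation leb := (@lebesgue_measure R).
Implicit Types (F f : R -> R).

Lemma is_derive_continuous F f : (forall x : R, is_derive x 1 F (f x)) -> continuous F.
Proof.
by move=> dF x; apply/differentiable_continuous/derivable1_diffP; case: (dF x).
Qed.

Lemma mean_value F f x y : (forall t : R, is_derive t 1 F (f t)) ->
  exists2 c, `|c - x| <= `|y - x| & F y - F x = f c * (y - x).
Proof.
move=> dF; have cF := is_derive_continuous dF.
have [xy|yx|<-] := ltgtP x y.
- have [c] := MVT xy (fun t _ => dF t) (continuous_subspaceT cF).
  rewrite in_itv/= => /andP[xc cy] E; exists c => //.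
  by rewrite !gtr0_norm ?subr_gt0// lerB// ltW.
- have [c] := MVT yx (fun t _ => dF t) (continuous_subspaceT cF).
  rewrite in_itv/= => /andP[xc cy] E; exists c; last by rewrite -opprB E; ring.
  by rewrite !ltr0_norm ?subr_lt0// lerN2 lerB// ltW.
- by exists x; rewrite ?subrr// mulr0.
Qed.

Lemma mean_value_le F f K x y : (forall t : R, is_derive t 1 F (f t)) ->
  (forall t, `|f t| <= K) -> `|F y - F x| <= K * `|y - x|.
Proof.
by move=> dF fK; have [c _ ->] := mean_value x y dF; rewrite normrM ler_wpM2r.
Qed.

Lemma sin_lip (x y : R) : `|sin y - sin x| <= `|y - x|.
Proof.
rewrite -[leRHS]mul1r; apply: (@mean_value_le _ cos) => t.
by rewrite ler_norml cos_geN1 cos_le1.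
Qed.

Lemma norm_cos_le1 (x : R) : `|cos x| <= 1.
Proof. by rewrite ler_norml cos_geN1 cos_le1. Qed.

Lemma norm_sin_le1 (x : R) : `|sin x| <= 1.
Proof. by rewrite ler_norml sin_geN1 sin_le1. Qed.

(** The quadratic remainder turns differentiation under the integral sign into an
    estimate, with no limit theorem. *)
Lemma cos_taylor (a h : R) : `|cos (a + h) - cos a + h * sin a| <= h ^+ 2.
Proof.
have [c ch E] := @mean_value _ (fun t => - sin t) a (a + h) (fun t : R => is_derive_cos t).
rewrite E [a + h - a]addrAC subrr add0r in ch *.
rewrite (_ : _ + _ = h * (sin a - sin c)); last by ring.
rewrite normrM -[h ^+ 2]real_normK ?num_real// expr2 ler_wpM2l//.
by apply: le_trans (sin_lip _ _) _; rewrite distrC.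
Qed.

Lemma RI_itv_indic f a b : \int[leb]_(x in `[a, b]) f x =
  \int[leb]_x (\1_(`[a, b]%classic) x * f x).
Proof.
rewrite Rintegral_mkcond; apply: RI_ext => x.
by rewrite patchE indicE; case: ifP => _; rewrite ?mul1r ?mul0r.
Qed.

Lemma FTC_itv F f a b : a <= b -> (forall x : R, is_derive x 1 F (f x)) ->
  continuous f -> \int[leb]_(x in `[a, b]) f x = F b - F a.
Proof.
move=> ab dF cf; have cF := is_derive_continuous dF.
have [<-|nab] := eqVneq a b; first by rewrite set_itv1 Rintegral_set1 subrr.
have {}ab : a < b by rewrite lt_neqAle nab.
rewrite /Rintegral (@continuous_FTC2 _ f F)// ?EFinB//.
- exact: continuous_subspaceT.
- split.
  + by move=> x _; case: (dF x).
  + by apply: cvg_at_right_filter; exact: cF.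
  + by apply: cvg_at_left_filter; exact: cF.
- by move=> x _; rewrite derive1E; have [_ ->] := dF x.
Qed.

Lemma indic_itv_cvg (x : R) :
  (\1_(`[- n%:R, n%:R]%classic) x : R) @[n --> \oo] --> (1 : R).
Proof.
apply: cvg_near_cst; near=> n; rewrite indicE mem_set//= in_itv/= -ler_norml.
by near: n; exact: nbhs_infty_ger.
Unshelve. all: by end_near. Qed.

Lemma measurable_indic_itv (a b : R) :
  measurable_fun setT (\1_(`[a, b]%classic) : R -> R).
Proof. exact: measurable_indic. Qed.

Lemma FTC_line F f l l' : (forall x : R, is_derive x 1 F (f x)) ->
  continuous f -> integ leb f -> F n%:R @[n --> \oo] --> l ->
  F (- n%:R) @[n --> \oo] --> l' -> \int[leb]_x f x = l - l'.
Proof.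
move=> dF cf fi Fl Fl'; have mf := integ_meas fi.
have h1 : (\int[leb]_(x in `[- n%:R, n%:R]) f x) @[n --> \oo] --> l - l'.
  under eq_fun do rewrite (FTC_itv _ dF cf) ?ge0_cp//.
  exact: cvgB.
apply: cvg_unique h1; first exact: Rhausdorff.
have -> : (fun n : nat => \int[leb]_(x in `[- n%:R, n%:R]) f x) =
    (fun n : nat => \int[leb]_x (\1_(`[- n%:R, n%:R]%classic) x * f x)).
  by apply/funext => n; exact: RI_itv_indic.
apply: (@RI_dominated _ _ _ leb (fun (n : nat) x => \1_(`[- n%:R, n%:R]%classic) x * f x) f (fun x => `|f x|)) => //.
- by move=> n; apply: measurable_funM => //; exact: measurable_indic_itv.
- exact: integ_norm.
- apply: aeW => x; rewrite -[X in _ --> X]mul1r.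
  by apply: cvgM; [exact: indic_itv_cvg|exact: cvg_cst].
- move=> n x; rewrite normrM indicE ler_piMl//.
  by case: (_ \in _); rewrite ?normr1 ?normr0.
Qed.

End LineCalculus.

(** * Continuous functions on the plane are measurable *)

Section PlaneContinuous.
Variable R : realType.

(** [f (floor (n x) / n, y)] is measurable in each strip where the floor is
    constant, and converges to [f (x, y)]. *)
Lemma continuous_plane_measurable (f : R * R -> R) : continuous f ->
  measurable_fun [set: plane R] f.
Proof.
move=> cf.
pose q (n : nat) (x : R) : R := (Num.floor (n.+1%:R * x))%:~R / n.+1%:R.
have q_near n x : `|q n x - x| <= n.+1%:R^-1.
  have n0 : 0 < n.+1%:R :> R by rewrite ltr0n.
  have h1 := floor_le_tmp (n.+1%:R * x); have h2 := floorD1_gt (n.+1%:R * x).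
  rewrite intrD in h2; rewrite /q.
  rewrite -(ler_pM2l n0) -[X in X * _]gtr0_norm// -normrM mulrBr mulrCA divff ?gt_eqF// mulr1.
  by rewrite ler_norml; apply/andP; split; lra.
apply: (measurable_fun_cvg (h := fun n (z : plane R) => f (q n z.1, z.2))).
- move=> n _ B mB; rewrite setTI.
  pose S (k : int) : set (plane R) :=
    [set x : R | Num.floor (n.+1%:R * x) = k] `*`
    [set y : R | B (f (k%:~R / n.+1%:R, y))].
  rewrite (_ : _ @^-1` B = \bigcup_(k in [set: int]) S k); last first.
    apply/seteqP; split => [[x y] /= h|[x y] [k _ [/= h1 h2]]].
      by exists (Num.floor (n.+1%:R * x)).
    by rewrite /q h1.
  apply: countable_bigcupT_measurable => // k; apply: measurableX.
  + have mfl : measurable_fun setT (fun x : R => n.+1%:R * x) by meas.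
    have -> : [set x : R | Num.floor (n.+1%:R * x) = k] =
        (fun x => n.+1%:R * x) @^-1` `[k%:~R, (k + 1)%:~R[%classic.
      apply/seteqP; split => x /=; rewrite in_itv/=.
        by move=> <-; rewrite floor_le_tmp floorD1_gt.
      by move=> h; exact: floor_def.
    by rewrite -[X in measurable X]setTI; apply: mfl => //; exact: measurable_itv.
  + have ck : continuous (fun y : R => f (k%:~R / n.+1%:R, y)).
      move=> y; have h : (k%:~R / n.+1%:R, u) @[u --> y] --> (k%:~R / n.+1%:R : R, y).
        by apply: (@cvg_pair _ _ _ _ (nbhs _) (nbhs y)) => /=; [exact: cvg_cst|exact: cvg_id].
      exact: (cvg_comp _ _ h (cf _)).
    have := continuous_measurable_fun ck.
    by move=> h; rewrite -[X in measurable X]setTI; exact: h.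
- move=> [x y] _ /=.
  have : (q n x, y) @[n --> \oo] --> (x, y).
    apply: (@cvg_pair _ _ _ _ (nbhs x) (nbhs y)) => /=; last exact: cvg_cst.
    apply/cvgrPdist_le => e e0; near=> n.
    rewrite distrC (le_trans (q_near n x))//.
    by near: n; have := near_infty_natSinv_lt (PosNum e0); apply: filterS => n /ltW.
  by move=> h; apply: (cvg_comp _ _ h); exact: cf.
Unshelve. all: by end_near. Qed.

End PlaneContinuous.

(** * Calculus on the plane and Schwartz functions *)

Section PlaneCalculus.
Variable R : realType.
Implicit Types (f g psi : R * R -> R) (z h : R * R).

Definition lin2 (a b : R) (h : R * R) : R := a * h.1 + b * h.2.

Lemma lin2_is_linear a b : linear (lin2 a b).
Proof. by move=> k [x1 y1] [x2 y2]; rewrite /lin2/= /GRing.scale/=; ring. Qed.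

HB.instance Definition _ a b :=
  GRing.isLinear.Build R (R * R)%type R _ (lin2 a b) (lin2_is_linear a b).

Lemma continuous_lin2 a b : continuous (lin2 a b).
Proof.
move=> z; apply: cvgD.
- by apply: cvgM; [exact: cvg_cst|exact: cvg_fst].
- by apply: cvgM; [exact: cvg_cst|exact: cvg_snd].
Qed.

(** Differentiability of oscillatory integrals is proved by this criterion. *)
Lemma quadratic_diff f z a b C :
  (forall h, `|f (z + h) - f z - lin2 a b h| <= C * (`|h.1| + `|h.2|) ^+ 2) ->
  [/\ differentiable f z, d_x f z = a & d_y f z = b].
Proof.
move=> fC.
have E : (f : R * R -> R^o) \o shift z = cst (f z) + (lin2 a b : R * R -> R^o) +o_ (0 : R * R) id.
  apply/eqaddoP => e e0.
  have e'0 : 0 < e / (`|C| * 4 + 1) by rewrite divr_gt0// ltr_wpDl// mulr_ge0.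
  have H := @nbhs0_le R (R * R)%type _ e'0.
  apply: filterS H => h; rewrite ler_pdivlMr; last by rewrite ltr_wpDl// mulr_ge0.
  move=> he; rewrite /= -[_ h]/(f (h + z) - (f z + lin2 a b h)) opprD addrA [h + z]addrC.
  apply: le_trans (fC h) _.
  have n1 : `|h.1| <= `|h| by rewrite prod_normE le_max lexx.
  have n2 : `|h.2| <= `|h| by rewrite prod_normE le_max lexx orbT.
  have C0 : 0 <= `|C| by [].
  apply: (@le_trans _ _ (`|C| * (2 * `|h|) ^+ 2)).
    apply: (@le_trans _ _ (`|C| * (`|h.1| + `|h.2|) ^+ 2)).
      by rewrite ler_wpM2r ?sqr_ge0// ler_norm.
    rewrite ler_wpM2l// lerXn2r// ?nnegrE ?addr_ge0 ?mulr_ge0//.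
    by lra.
  rewrite exprMn expr2 [`|h| ^+ 2]expr2 !mulrA ler_wpM2r//.
  have : 0 <= `|h| by []. 
  by move: C0 he; move: `|C| `|h| => c n; nra.
have D := diff_unique (@continuous_lin2 a b) E.
have df : differentiable f z.
  apply/diff_locallyP; rewrite D; split => //; exact: continuous_lin2.
split => //.
- by rewrite /d_x deriveE// D -[LHS]/(lin2 a b (1, 0)) /lin2/= mulr1 mulr0 addr0.
- by rewrite /d_y deriveE// D -[LHS]/(lin2 a b (0, 1)) /lin2/= mulr1 mulr0 add0r.
Qed.

Lemma diff_fst z : [/\ differentiable (fst : R * R -> R) z,
  d_x fst z = 1 & d_y fst z = 0].
Proof.
apply: (@quadratic_diff _ _ _ _ 0) => h; rewrite mul0r /lin2/=.
by rewrite normr_le0; apply/eqP; ring.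
Qed.

Lemma diff_snd z : [/\ differentiable (snd : R * R -> R) z,
  d_x snd z = 0 & d_y snd z = 1].
Proof.
apply: (@quadratic_diff _ _ _ _ 0) => h; rewrite mul0r /lin2/=.
by rewrite normr_le0; apply/eqP; ring.
Qed.

Section Directional.
Variables (f g : R * R -> R) (z : R * R).
Hypotheses (df : differentiable f z) (dg : differentiable g z).

Lemma differentiable_lc c : differentiable (fun z => c * f z + g z) z.
Proof. by apply: differentiableD => //; exact: differentiableZ. Qed.

Lemma d_x_lc c : d_x (fun z => c * f z + g z) z = c * d_x f z + d_x g z.
Proof.
rewrite /d_x (@deriveD _ _ _ (c \*: f) g); first by rewrite deriveZ//; exact: diff_derivable.
- by apply: derivableZ; exact: diff_derivable.
- exact: diff_derivable.
Qed.

Lemma d_y_lc c : d_y (fun z => c * f z + g z) z = c * d_y f z + d_y g z.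
Proof.
rewrite /d_y (@deriveD _ _ _ (c \*: f) g); first by rewrite deriveZ//; exact: diff_derivable.
- by apply: derivableZ; exact: diff_derivable.
- exact: diff_derivable.
Qed.

Lemma differentiable_mul : differentiable (fun z => f z * g z) z.
Proof. exact: differentiableM. Qed.

Lemma d_x_mul : d_x (fun z => f z * g z) z = f z * d_x g z + g z * d_x f z.
Proof. by rewrite /d_x (@deriveM _ _ f g)//; exact: diff_derivable. Qed.

Lemma d_y_mul : d_y (fun z => f z * g z) z = f z * d_y g z + g z * d_y f z.
Proof. by rewrite /d_y (@deriveM _ _ f g)//; exact: diff_derivable. Qed.

End Directional.

Lemma line_derive_x f (x y : R) : differentiable f (x, y) ->
  is_derive x 1 (fun t => f (t, y)) (d_x f (x, y)).
Proof.
move=> df; have D : derivable f (x, y) (1, 0) by exact: diff_derivable.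
have E : (fun h : R => h^-1 *: (((fun t => f (t, y)) \o shift x) (h *: 1) - f (x, y))) =
    (fun h : R => h^-1 *: ((f \o shift (x, y)) (h *: (1, 0)) - f (x, y))).
  apply/funext => h /=; congr (_ *: (f _ - _)).
  by congr pair; rewrite /= scaler0 add0r.
split; first by rewrite /derivable E.
by rewrite /derive E.
Qed.

Lemma line_derive_y f (x y : R) : differentiable f (x, y) ->
  is_derive y 1 (fun t => f (x, t)) (d_y f (x, y)).
Proof.
move=> df; have D : derivable f (x, y) (0, 1) by exact: diff_derivable.
have E : (fun h : R => h^-1 *: (((fun t => f (x, t)) \o shift y) (h *: 1) - f (x, y))) =
    (fun h : R => h^-1 *: ((f \o shift (x, y)) (h *: (0, 1)) - f (x, y))).
  apply/funext => h /=; congr (_ *: (f _ - _)).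
  by congr pair; rewrite /= scaler0 add0r.
split; first by rewrite /derivable E.
by rewrite /derive E.
Qed.

Definition rapid f := forall k, exists C, forall z,
  (1 + z.1 ^+ 2 + z.2 ^+ 2) ^+ k * `|f z| <= C.

Lemma rapid_lc c f g : rapid f -> rapid g -> rapid (fun z => c * f z + g z).
Proof.
move=> rf rg k; have [C fC] := rf k; have [D gD] := rg k.
exists (`|c| * C + D) => z; set B := _ ^+ k.
have B0 : 0 <= B by apply: exprn_ge0; exact/ltW/(bracket_gt0 z).
apply: (@le_trans _ _ (B * (`|c| * `|f z| + `|g z|))).
  by rewrite ler_wpM2l// (le_trans (ler_normD _ _))// normrM.
by rewrite mulrDr mulrCA; apply: lerD; [apply: ler_wpM2l => //; exact: fC|exact: gD].
Qed.

Lemma rapid_mul (p : R * R -> R) f : (forall z, `|p z| <= 1 + z.1 ^+ 2 + z.2 ^+ 2) ->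
  rapid f -> rapid (fun z => p z * f z).
Proof.
move=> pb rf k; have [C fC] := rf k.+1; exists C => z; apply: le_trans (fC z).
rewrite [_ ^+ k.+1]exprSr -mulrA.
apply: ler_wpM2l; first by apply: exprn_ge0; exact/ltW/(bracket_gt0 z).
by rewrite normrM ler_wpM2r.
Qed.

Lemma rapid_fst f : rapid f -> rapid (fun z => z.1 * f z).
Proof.
apply: rapid_mul => z; have := sqr_ge0 (`|z.1| - 1); have := sqr_ge0 z.2.
rewrite -[z.1 ^+ 2]real_normK ?num_real//; have := normr_ge0 z.1; nra.
Qed.

Lemma rapid_snd f : rapid f -> rapid (fun z => z.2 * f z).
Proof.
apply: rapid_mul => z; have := sqr_ge0 (`|z.2| - 1); have := sqr_ge0 z.1.
rewrite -[z.2 ^+ 2]real_normK ?num_real//; have := normr_ge0 z.2; nra.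
Qed.

Lemma rapid_wt f : rapid f -> exists C, 0 <= C /\ forall z, `|f z| <= C * wt z.
Proof.
move=> /(_ 2%N) [C fC]; exists C; split.
  apply: le_trans (fC (0, 0)); rewrite mulr_ge0// exprn_ge0//.
  by rewrite ltW// (bracket_gt0 (0, 0)).
by move=> z; rewrite /wt ler_pdivlMr ?exprn_gt0 ?(bracket_gt0 z)// mulrC.
Qed.

(** Only the order x then y of [partial] matters, which is why two classes
    are used. *)
Lemma schwartz_of_classes (K0 K : set (R * R -> R)) : K0 `<=` K ->
  (forall f, K0 f -> K0 (d_x f)) -> (forall f, K f -> K (d_y f)) ->
  (forall f, K f -> (forall z, differentiable f z) /\ rapid f) -> K0 `<=` @schwartz R.
Proof.
move=> sub cx cy good f K0f a b.
have ha : forall n, K0 (iter n (@d_x R) f) by elim=> //= n; exact: cx.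
have hb : forall n, K (iter n (@d_y R) (iter a (@d_x R) f)).
  by elim=> [|n IH] /=; [exact: sub|exact: cy].
by have [h1 h2] := good _ (hb b).
Qed.

Lemma schwartz_diff psi a b z : schwartz psi -> differentiable (partial a b psi) z.
Proof. by move=> /(_ a b)[]. Qed.

Lemma schwartz_rapid psi a b : schwartz psi -> rapid (partial a b psi).
Proof. by move=> /(_ a b)[]. Qed.

Lemma schwartz_d_x psi : schwartz psi -> schwartz (d_x psi).
Proof.
by move=> h a b; have := h a.+1 b; rewrite /partial iterSr.
Qed.

Lemma schwartz_lc c psi1 psi2 : schwartz psi1 -> schwartz psi2 ->
  schwartz (fun z => c * psi1 z + psi2 z).
Proof.
move=> s1 s2.
pose K := [set f | exists a b, f = fun z => c * partial a b psi1 z + partial a b psi2 z].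
pose K0 := [set f | exists a, f = fun z => c * partial a 0 psi1 z + partial a 0 psi2 z].
apply: (@schwartz_of_classes K0 K); last by exists 0%N.
- by move=> f [a ->]; exists a, 0%N.
- move=> f [a ->]; exists a.+1; apply/funext => z.
  by rewrite d_x_lc//; exact: schwartz_diff.
- move=> f [a [b ->]]; exists a, b.+1; apply/funext => z.
  by rewrite d_y_lc//; exact: schwartz_diff.
- move=> f [a [b ->]]; split.
    by move=> z; apply: differentiable_lc; exact: schwartz_diff.
  by apply: rapid_lc; exact: schwartz_rapid.
Qed.

Lemma schwartz0 : schwartz (fun _ : R * R => 0 : R).
Proof.
apply: (@schwartz_of_classes [set f | f = fun=> 0] [set f | f = fun=> 0]) => //.
- by move=> f ->; apply/funext => z; rewrite /d_x (derive_cst (0 : R)).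
- by move=> f ->; apply/funext => z; rewrite /d_y (derive_cst (0 : R)).
- move=> f ->; split=> [z|k]; first exact: differentiable_cst.
  by exists 0 => z; rewrite normr0 mulr0.
Qed.

Lemma schwartz_scale c psi : schwartz psi -> schwartz (fun z => c * psi z).
Proof.
move=> s; have := schwartz_lc c s schwartz0.
by rewrite (_ : (fun z => _ + _) = (fun z => c * psi z))//; apply/funext => z; rewrite addr0.
Qed.

Lemma schwartz_fst psi : schwartz psi -> schwartz (fun z => z.1 * psi z).
Proof.
move=> s.
pose H a b := fun z : R * R => a%:R * partial a.-1 b psi z + z.1 * partial a b psi z.
have dH a b z : differentiable (fun z : R * R => z.1 * partial a b psi z) z.
  by apply: differentiable_mul; [have [] := diff_fst z|exact: schwartz_diff].
apply: (@schwartz_of_classes [set f | exists a, f = H a 0%N]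
  [set f | exists a b, f = H a b]).
- by move=> f [a ->]; exists a, 0%N.
- move=> f [a ->]; exists a.+1; apply/funext => z.
  rewrite /H d_x_lc//; last exact: schwartz_diff.
  rewrite d_x_mul; [|by have [] := diff_fst z|exact: schwartz_diff].
  have [_ -> _] := diff_fst z; rewrite mulr1 [in RHS]mulrSr mulrDl mul1r -addrA [_ * d_x _ z + partial _ _ _ z]addrC.
  congr (_ + _); case: a => [|a]; first by rewrite !mul0r.
  by rewrite succnK.
- move=> f [a [b ->]]; exists a, b.+1; apply/funext => z.
  rewrite /H d_y_lc//; last exact: schwartz_diff.
  rewrite d_y_mul; [|by have [] := diff_fst z|exact: schwartz_diff].
  by have [_ _ ->] := diff_fst z; rewrite mulr0 addr0.
- move=> f [a [b ->]]; split.
    by move=> z; apply: differentiable_lc => //; exact: schwartz_diff.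
  by apply: rapid_lc; [exact: schwartz_rapid|apply: rapid_fst; exact: schwartz_rapid].
- by exists 0%N; apply/funext => z; rewrite /H mul0r add0r.
Qed.

Lemma schwartz_snd psi : schwartz psi -> schwartz (fun z => z.2 * psi z).
Proof.
move=> s.
pose H a b := fun z : R * R => b%:R * partial a b.-1 psi z + z.2 * partial a b psi z.
have dH a b z : differentiable (fun z : R * R => z.2 * partial a b psi z) z.
  by apply: differentiable_mul; [have [] := diff_snd z|exact: schwartz_diff].
apply: (@schwartz_of_classes [set f | exists a, f = H a 0%N]
  [set f | exists a b, f = H a b]).
- by move=> f [a ->]; exists a, 0%N.
- move=> f [a ->]; exists a.+1; apply/funext => z.
  rewrite /H d_x_lc//; last exact: schwartz_diff.
  rewrite d_x_mul; [|by have [] := diff_snd z|exact: schwartz_diff].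
  by have [_ -> _] := diff_snd z; rewrite mulr0 addr0 !mul0r.
- move=> f [a [b ->]]; exists a, b.+1; apply/funext => z.
  rewrite /H d_y_lc//; last exact: schwartz_diff.
  rewrite d_y_mul; [|by have [] := diff_snd z|exact: schwartz_diff].
  have [_ _ ->] := diff_snd z; rewrite mulr1 [in RHS]mulrSr mulrDl mul1r -addrA [_ * d_y _ z + partial _ _ _ z]addrC.
  congr (_ + _); case: b => [|b]; first by rewrite !mul0r.
  by rewrite succnK.
- move=> f [a [b ->]]; split.
    by move=> z; apply: differentiable_lc => //; exact: schwartz_diff.
  by apply: rapid_lc; [exact: schwartz_rapid|apply: rapid_snd; exact: schwartz_rapid].
- by exists 0%N; apply/funext => z; rewrite /H mul0r add0r.
Qed.

Lemma diff_measurable f : (forall z, differentiable f z) -> measurable_fun [set: plane R] f.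
Proof.
by move=> df; apply: continuous_plane_measurable => z; exact: differentiable_continuous.
Qed.

Lemma schwartz_measurable psi : schwartz psi -> measurable_fun [set: plane R] psi.
Proof. by move=> s; apply: diff_measurable => z; exact: (schwartz_diff 0 0). Qed.

Lemma schwartz_wt psi : schwartz psi -> exists C, 0 <= C /\ forall z, `|psi z| <= C * wt z.
Proof. by move=> s; apply: rapid_wt; exact: (schwartz_rapid 0 0). Qed.

Lemma schwartz_integ psi : schwartz psi -> integ (mu2 R) psi.
Proof.
move=> s; have [C [C0 pC]] := schwartz_wt s.
apply: (@integ_le _ _ _ (mu2 R) _ (fun z => C * wt z)) => //.
  exact: schwartz_measurable.
by apply: integZ; exact: integ_wt.
Qed.

End PlaneCalculus.

(** * Oscillatory integrals of Schwartz functions *)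

Section Osc.
Variable R : realType.
Notation leb := (@lebesgue_measure R).
Implicit Types (f psi : R * R -> R) (z zeta : R * R).

(** The phase [c] makes the real and the imaginary part of the Fourier
    transform, and all their derivatives, instances of one family. *)
Definition osc (c : R) psi zeta : R :=
  \int[mu2 R]_z (psi z * cos (pdot z zeta + c)).

Lemma integ_cosM psi (g : plane R -> R) : integ (mu2 R) psi ->
  measurable_fun setT g -> integ (mu2 R) (fun z => psi z * cos (g z)).
Proof.
move=> pi mg; have mp := integ_meas pi.
apply: (@integ_le _ _ _ (mu2 R) _ (fun z => `|psi z|)); first by meas.
- by move=> z; rewrite normrM ler_piMr// norm_cos_le1.
- exact: integ_norm.
Qed.

Lemma m_osc_phase zeta c : measurable_fun setT (fun z : plane R => pdot z zeta + c).
Proof. by meas. Qed.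

Lemma osc_bounded c psi zeta : integ (mu2 R) psi ->
  `|osc c psi zeta| <= \int[mu2 R]_z `|psi z|.
Proof.
move=> pi; apply: RI_norm.
- by have mp := integ_meas pi; meas.
- by move=> z; rewrite normrM ler_piMr// norm_cos_le1.
- exact: integ_norm.
Qed.

Lemma pdot_le z h : `|pdot z h| <= (`|z.1| + `|z.2|) * (`|h.1| + `|h.2|).
Proof.
rewrite /pdot (le_trans (ler_normD _ _))// !normrM.
have := normr_ge0 z.1; have := normr_ge0 z.2; have := normr_ge0 h.1.
have := normr_ge0 h.2; nra.
Qed.

(** Each derivative shifts the phase by a quarter turn; the remainder is bounded by
    [cos_taylor], because [psi] has second moments. *)
Lemma osc_diff c psi zeta : schwartz psi ->
  [/\ differentiable (osc c psi) zeta,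
      d_x (osc c psi) zeta = osc (c + pi / 2) (fun z => z.1 * psi z) zeta
    & d_y (osc c psi) zeta = osc (c + pi / 2) (fun z => z.2 * psi z) zeta].
Proof.
move=> s; have mp := schwartz_measurable s; have ip := schwartz_integ s.
have i1 := schwartz_integ (schwartz_fst s).
have i2 := schwartz_integ (schwartz_snd s).
have i11 := schwartz_integ (schwartz_fst (schwartz_fst s)).
have i22 := schwartz_integ (schwartz_snd (schwartz_snd s)).
pose M z := 2 * (`|z.1 * (z.1 * psi z)| + `|z.2 * (z.2 * psi z)|).
have iM : integ (mu2 R) M by apply: integZ; apply: integD; exact: integ_norm.
apply: (@quadratic_diff _ _ _ _ _ (\int[mu2 R]_z M z)) => h.
have a0 := integ_cosM ip (m_osc_phase zeta c).
have a1 := integ_cosM i1 (m_osc_phase zeta (c + pi / 2)).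
have a2 := integ_cosM i2 (m_osc_phase zeta (c + pi / 2)).
have ah := integ_cosM ip (m_osc_phase (zeta + h) c).
rewrite /lin2 ![_ * h.1]mulrC ![_ * h.2]mulrC /osc -!RIZ// -RID; try exact: integZ.
rewrite -RIB// -RIB//; [|exact: integB|by apply: integD; exact: integZ].
rewrite -RIZr//; apply: RI_norm.
- by meas.
- move=> z; rewrite !addrA !cosDpihalf.
  pose t := pdot z zeta + c.
  have -> : pdot z (zeta + h) + c = t + pdot z h by rewrite /t /pdot/=; ring.
  rewrite (_ : _ - _ = psi z * (cos (t + pdot z h) - cos t + pdot z h * sin t)); last first.
    by rewrite /t /pdot; ring.
  rewrite normrM /M !normrM; have h1 := cos_taylor t (pdot z h).
  have h2 : pdot z h ^+ 2 <= 2 * (`|z.1| ^+ 2 + `|z.2| ^+ 2) * (`|h.1| + `|h.2|) ^+ 2.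
    rewrite -real_normK ?num_real//.
    apply: (@le_trans _ _ (((`|z.1| + `|z.2|) * (`|h.1| + `|h.2|)) ^+ 2)).
      by rewrite lerXn2r// ?nnegrE ?mulr_ge0 ?addr_ge0// pdot_le.
    rewrite exprMn ler_wpM2r ?sqr_ge0//.
    have := sqr_ge0 (`|z.1| - `|z.2|); nra.
  have := le_trans h1 h2; set A := `|_ - _ + _| => h3.
  apply: le_trans (ler_wpM2l (normr_ge0 (psi z)) h3) _.
  by rewrite le_eqVlt; apply/orP; left; apply/eqP; ring.
- have -> : (fun z => M z * (`|h.1| + `|h.2|) ^+ 2) = (fun z => (`|h.1| + `|h.2|) ^+ 2 * M z).
    by apply/funext => z; rewrite mulrC.
  exact: integZ.
Qed.

Lemma w1_cvg0 : (w1 (n%:R : R)) @[n --> \oo] --> (0 : R).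
Proof.
apply: (@squeeze_cvgr _ _ _ _ (fun=> 0) (@harmonic R)); last 2 first.
- exact: cvg_cst.
- exact: cvg_harmonic.
apply: nearW => n; apply/andP; split; first exact/ltW/w1_gt0.
have p : 0 < 1 + n%:R ^+ 2 :> R by rewrite ltr_pwDl// sqr_ge0.
rewrite /harmonic/= /w1 lef_pV2 ?posrE ?ltr0Sn//.
rewrite -natrX -natr1 addrC lerD2l ler_nat expnS expn1.
by clear p; case: n => // n; rewrite leq_pmulr.
Qed.

Lemma w1_opp (x : R) : w1 (- x) = w1 x.
Proof. by rewrite /w1 sqrrN. Qed.

Lemma wt_le_fst x y : wt (x, y) <= w1 (x : R).
Proof.
apply: le_trans (wt_le_prod _) _; apply: ler_piMr; first exact/ltW/w1_gt0.
have p : 0 < 1 + y ^+ 2 by rewrite ltr_pwDl// sqr_ge0.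
by rewrite /w1 invf_le1// lerDl sqr_ge0.
Qed.

Lemma wt_le_snd x y : wt (x, y) <= w1 (y : R).
Proof.
apply: le_trans (wt_le_prod _) _; apply: ler_piMl; first exact/ltW/w1_gt0.
have p : 0 < 1 + x ^+ 2 by rewrite ltr_pwDl// sqr_ge0.
by rewrite /w1 invf_le1// lerDl sqr_ge0.
Qed.

Lemma line_integral_deriv (F f : R -> R) C :
  (forall x : R, is_derive x 1 F (f x)) -> continuous f ->
  (forall x, `|F x| <= C * w1 x) -> (forall x, `|f x| <= C * w1 x) ->
  \int[leb]_x f x = 0.
Proof.
move=> dF cf FC fC.
rewrite (@FTC_line _ F f 0 0) ?subrr//.
- apply: (@integ_le _ _ _ leb _ (fun x => C * w1 x)) => //.
    exact: continuous_measurable_fun.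
  by apply: integZ; exact: integ_w1.
- apply/cvgr0Pnorm_le => e e0.
  have : (C * w1 (n%:R : R)) @[n --> \oo] --> (0 : R).
    by rewrite -[X in _ --> X](mulr0 C); apply: cvgM; [exact: cvg_cst|exact: w1_cvg0].
  move=> /cvgr0Pnorm_le /(_ e e0); apply: filterS => n.
  by apply: le_trans; rewrite (le_trans (FC _))// ler_norm.
- apply/cvgr0Pnorm_le => e e0.
  have : (C * w1 (n%:R : R)) @[n --> \oo] --> (0 : R).
    by rewrite -[X in _ --> X](mulr0 C); apply: cvgM; [exact: cvg_cst|exact: w1_cvg0].
  move=> /cvgr0Pnorm_le /(_ e e0); apply: filterS => n.
  by apply: le_trans; rewrite (le_trans (FC _))// w1_opp ler_norm.
Qed.

Section ByParts.
Variables (f g : R * R -> R) (zeta : R * R) (c : R).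
Hypotheses (df : forall z, differentiable f z) (rf : rapid f)
  (dg : forall z, differentiable g z) (rg : rapid g).

Let cf : continuous f.
Proof. by move=> z; exact: differentiable_continuous. Qed.

Let cg : continuous g.
Proof. by move=> z; exact: differentiable_continuous. Qed.

Let mf := diff_measurable df.
Let mg := diff_measurable dg.

Lemma rapid_integ (h : R * R -> R) : measurable_fun [set: plane R] h -> rapid h -> integ (mu2 R) h.
Proof.
move=> mh rh; have [C [_ hC]] := rapid_wt rh.
apply: (@integ_le _ _ _ (mu2 R) _ (fun z => C * wt z)) => //.
by apply: integZ; exact: integ_wt.
Qed.

Let k z := g z * cos (pdot z zeta + c).

Let bound (b : R) : exists C, forall z, `|f z| <= C * wt z /\
  `|g z * cos (pdot z zeta + c) - b * (f z * sin (pdot z zeta + c))| <= C * wt z.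
Proof.
have [C [C0 fC]] := rapid_wt rf; have [D [D0 gD]] := rapid_wt rg.
exists (D + C + `|b| * C) => z; split.
  apply: le_trans (fC z) _; rewrite ler_wpM2r ?wt_ge0//.
  by have := mulr_ge0 (normr_ge0 b) C0; lra.
apply: le_trans (ler_normB _ _) _; rewrite !normrM !mulrDl; apply: lerD.
  apply: (@le_trans _ _ (D * wt z)); last by rewrite lerDl mulr_ge0// wt_ge0.
  by apply: le_trans (gD z); rewrite ler_piMr// norm_cos_le1.
rewrite -mulrA ler_wpM2l//; apply: le_trans (fC z).
by rewrite ler_piMr// norm_sin_le1.
Qed.

Let plane_zero (b : R) :
  (forall C : R, (forall z, `|f z| <= C * wt z /\
     `|g z * cos (pdot z zeta + c) - b * (f z * sin (pdot z zeta + c))| <= C * wt z) ->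
     (forall x, \int[leb]_y (g (x, y) * cos (pdot (x, y) zeta + c)
       - b * (f (x, y) * sin (pdot (x, y) zeta + c))) = 0) \/
     (forall y, \int[leb]_x (g (x, y) * cos (pdot (x, y) zeta + c)
       - b * (f (x, y) * sin (pdot (x, y) zeta + c))) = 0)) ->
  osc c g zeta = b * \int[mu2 R]_z (f z * sin (pdot z zeta + c)).
Proof.
move=> H; have [C HC] := bound b.
have i1 := integ_cosM (rapid_integ mg rg) (m_osc_phase zeta c).
have i2 : integ (mu2 R) (fun z => f z * sin (pdot z zeta + c)).
  have := integ_cosM (rapid_integ mf rf) (m_osc_phase zeta (c - pi / 2)).
  apply: integ_ext => z; congr (_ * _).
  by rewrite -[in RHS](subrK (pi / 2) (pdot z zeta + c)) sinDpihalf addrA.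
apply/eqP; rewrite -subr_eq0 -RIZ// -RIB//; last exact: integZ.
apply/eqP; set G := fun z => _ - _.
have mG : measurable_fun [set: plane R] G by rewrite /G; meas.
have GC (x y : R) : `|G (x, y)| <= C * w1 x * w1 y.
  apply: le_trans (HC (x, y)).2 _; rewrite -mulrA ler_wpM2l ?wt_le_prod//.
  have := (HC (0, 0)).1; have := wt_gt0 ((0, 0) : plane R); have := normr_ge0 (f (0, 0)).
  nra.
have iw := @integ_w1 R; have iCw : integ leb (fun x => C * w1 x) by exact: integZ.
have [h|h] := H C HC.
  rewrite (@RI_plane _ G _ _ mG iCw iw GC).
  by under RI_ext do rewrite /G h; exact: RI0.
rewrite (@RI_plane _ G _ _ mG iCw iw GC).
rewrite (@RI_swap_dom _ _ _ _ _ leb leb (fun x y => G (x, y)) _ _ _ iCw iw GC).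
  by under RI_ext do rewrite /G h; exact: RI0.
by rewrite (_ : (fun _ => _) = G)//; apply/funext => -[].
Qed.

Lemma cont_slice_x (h : R * R -> R) (y : R) : continuous h -> continuous (fun x : R => h (x, y)).
Proof.
move=> ch x; have hh : (u, y) @[u --> x] --> (x, y).
  by apply: (@cvg_pair _ _ _ _ (nbhs x) (nbhs y)) => /=; [exact: cvg_id|exact: cvg_cst].
exact: (cvg_comp _ _ hh (ch _)).
Qed.

Lemma cont_slice_y (h : R * R -> R) (x : R) : continuous h -> continuous (fun y : R => h (x, y)).
Proof.
move=> ch y; have hh : (x, u) @[u --> y] --> (x, y).
  by apply: (@cvg_pair _ _ _ _ (nbhs x) (nbhs y)) => /=; [exact: cvg_cst|exact: cvg_id].
exact: (cvg_comp _ _ hh (ch _)).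
Qed.

Let cG (b : R) : continuous (fun z : R * R => g z * cos (pdot z zeta + c)
       - b * (f z * sin (pdot z zeta + c))).
Proof.
have cp : continuous (fun z : R * R => pdot z zeta + c).
  move=> z; apply: cvgD; last exact: cvg_cst.
  by apply: cvgD; apply: cvgM; [exact: cvg_fst|exact: cvg_cst|exact: cvg_snd|exact: cvg_cst].
move=> z; apply: cvgB; first apply: cvgM; first exact: cg.
  by apply: (cvg_comp _ _ (cp z)); exact: continuous_cos.
apply: cvgM; first exact: cvg_cst.
apply: cvgM; first exact: cf.
by apply: (cvg_comp _ _ (cp z)); exact: continuous_sin.
Qed.

(** Integrating the derivative of [f cos] over each line in the direction of the
    derivative gives zero. *)
Lemma by_parts_x : d_x f = g ->
  osc c g zeta = zeta.1 * \int[mu2 R]_z (f z * sin (pdot z zeta + c)).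
Proof.
move=> fg; apply: plane_zero => C HC; right => y.
apply: (@line_integral_deriv (fun x => f (x, y) * cos (pdot (x, y) zeta + c)) _ C).
- move=> x; have d1 := line_derive_x (df (x, y)); rewrite fg in d1.
  have d2 : is_derive x 1 (fun x => cos (pdot (x, y) zeta + c))
      (- zeta.1 * sin (pdot (x, y) zeta + c)).
    rewrite /pdot /=; apply: is_derive_eq; rewrite /GRing.scale/=; ring.
  apply: is_derive_eq; rewrite /GRing.scale/=; ring.
- exact: (@cont_slice_x _ y (@cG zeta.1)).
- move=> x; apply: (@le_trans _ _ (C * wt (x, y))).
    apply: le_trans (HC (x, y)).1; by rewrite normrM ler_piMr// norm_cos_le1.
  rewrite ler_wpM2l ?wt_le_fst//.
  have := (HC (0, 0)).1; have := wt_gt0 ((0, 0) : plane R); have := normr_ge0 (f (0, 0)).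
  nra.
- move=> x; apply: le_trans (HC (x, y)).2 _; rewrite ler_wpM2l ?wt_le_fst//.
  have := (HC (0, 0)).1; have := wt_gt0 ((0, 0) : plane R); have := normr_ge0 (f (0, 0)).
  nra.
Qed.

Lemma by_parts_y : d_y f = g ->
  osc c g zeta = zeta.2 * \int[mu2 R]_z (f z * sin (pdot z zeta + c)).
Proof.
move=> fg; apply: plane_zero => C HC; left => x.
apply: (@line_integral_deriv (fun y => f (x, y) * cos (pdot (x, y) zeta + c)) _ C).
- move=> y; have d1 := line_derive_y (df (x, y)); rewrite fg in d1.
  have d2 : is_derive y 1 (fun y => cos (pdot (x, y) zeta + c))
      (- zeta.2 * sin (pdot (x, y) zeta + c)).
    rewrite /pdot /=; apply: is_derive_eq; rewrite /GRing.scale/=; ring.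
  apply: is_derive_eq; rewrite /GRing.scale/=; ring.
- exact: (@cont_slice_y _ x (@cG zeta.2)).
- move=> y; apply: (@le_trans _ _ (C * wt (x, y))).
    apply: le_trans (HC (x, y)).1; by rewrite normrM ler_piMr// norm_cos_le1.
  rewrite ler_wpM2l ?wt_le_snd//.
  have := (HC (0, 0)).1; have := wt_gt0 ((0, 0) : plane R); have := normr_ge0 (f (0, 0)).
  nra.
- move=> y; apply: le_trans (HC (x, y)).2 _; rewrite ler_wpM2l ?wt_le_snd//.
  have := (HC (0, 0)).1; have := wt_gt0 ((0, 0) : plane R); have := normr_ge0 (f (0, 0)).
  nra.
Qed.

End ByParts.

Lemma osc_sin c f zeta :
  \int[mu2 R]_z (f z * sin (pdot z zeta + c)) = osc (c - pi / 2) f zeta.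
Proof.
apply: RI_ext => z; congr (_ * _).
by rewrite -[in LHS](subrK (pi / 2) (pdot z zeta + c)) sinDpihalf addrA.
Qed.

Lemma osc_pow_x c psi zeta n : schwartz psi ->
  zeta.1 ^+ n * osc c psi zeta = osc (c + n%:R * (pi / 2)) (partial n 0 psi) zeta.
Proof.
move=> s; elim: n => [|n IH]; first by rewrite mul1r mul0r addr0.
rewrite exprS -mulrA IH (_ : c + n.+1%:R * _ = c + n%:R * (pi / 2) + pi / 2); last first.
  by rewrite -natr1; ring.
have d k z : differentiable (partial k 0 psi) z by exact: schwartz_diff.
have r k : rapid (partial k 0 psi) by exact: schwartz_rapid.
rewrite (@by_parts_x (partial n 0 psi) _ _ _ (d n) (r n) (d n.+1) (r n.+1))// osc_sin.
by rewrite addrK.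
Qed.

Lemma osc_pow_y c psi zeta n : schwartz psi ->
  zeta.2 ^+ n * osc c psi zeta = osc (c + n%:R * (pi / 2)) (partial 0 n psi) zeta.
Proof.
move=> s; elim: n => [|n IH]; first by rewrite mul1r mul0r addr0.
rewrite exprS -mulrA IH (_ : c + n.+1%:R * _ = c + n%:R * (pi / 2) + pi / 2); last first.
  by rewrite -natr1; ring.
have d k z : differentiable (partial 0 k psi) z by exact: schwartz_diff.
have r k : rapid (partial 0 k psi) by exact: schwartz_rapid.
rewrite (@by_parts_y (partial 0 n psi) _ _ _ (d n) (r n) (d n.+1) (r n.+1))// osc_sin.
by rewrite addrK.
Qed.

Lemma bracket_pow_le (x y : R) k :
  (1 + x ^+ 2 + y ^+ 2) ^+ k <= 3 ^+ k * (1 + x ^+ (2 * k) + y ^+ (2 * k)).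
Proof.
rewrite !exprM; have := sqr_ge0 x; have := sqr_ge0 y.
move: (x ^+ 2) (y ^+ 2) => a b b0 a0.
have H m : 0 <= m -> 1 + a + b <= 3 * m -> m ^+ k <= 1 + a ^+ k + b ^+ k ->
    (1 + a + b) ^+ k <= 3 ^+ k * (1 + a ^+ k + b ^+ k).
  move=> m0 h1 h2; apply: (@le_trans _ _ ((3 * m) ^+ k)).
    by rewrite lerXn2r// nnegrE; lra.
  by rewrite exprMn ler_wpM2l// exprn_ge0.
have ak : 0 <= a ^+ k by exact: exprn_ge0.
have bk : 0 <= b ^+ k by exact: exprn_ge0.
have [ab|ba] := leP a b; have [b1|b1] := leP b 1; have [a1|a1] := leP a 1.
- by apply: (H 1) => //; rewrite ?expr1n; lra.
- by apply: (H 1) => //; rewrite ?expr1n; lra.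
- by apply: (H b) => //; lra.
- by apply: (H b) => //; lra.
- by apply: (H 1) => //; rewrite ?expr1n; lra.
- by apply: (H a) => //; lra.
- by apply: (H a) => //; lra.
- by apply: (H a) => //; lra.
Qed.

(** Powers of the frequency are exchanged for derivatives of [psi]. *)
Lemma osc_rapid c psi : schwartz psi -> rapid (osc c psi).
Proof.
move=> s k.
have ix : integ (mu2 R) (partial (2 * k) 0 psi).
  by apply: rapid_integ; [apply: diff_measurable => z; exact: schwartz_diff|exact: schwartz_rapid].
have iy : integ (mu2 R) (partial 0 (2 * k) psi).
  by apply: rapid_integ; [apply: diff_measurable => z; exact: schwartz_diff|exact: schwartz_rapid].
have i0 := schwartz_integ s.
exists (3 ^+ k * (\int[mu2 R]_z `|psi z| + \int[mu2 R]_z `|partial (2 * k) 0 psi z|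
  + \int[mu2 R]_z `|partial 0 (2 * k) psi z|)) => z.
apply: (@le_trans _ _ (3 ^+ k * (1 + z.1 ^+ (2 * k) + z.2 ^+ (2 * k)) * `|osc c psi z|)).
  by rewrite ler_wpM2r// bracket_pow_le.
rewrite -mulrA ler_wpM2l ?exprn_ge0// !mulrDl mul1r.
have e2 (x : R) : 0 <= x ^+ (2 * k) by rewrite exprM exprn_ge0// sqr_ge0.
rewrite -[z.1 ^+ _]ger0_norm// -[z.2 ^+ _]ger0_norm// -!normrM osc_pow_x// osc_pow_y//.
by rewrite !lerD ?osc_bounded.
Qed.

(** The family of the oscillatory integrals of Schwartz functions is closed under
    both derivatives. *)
Lemma schwartz_osc c psi : schwartz psi -> schwartz (osc c psi).
Proof.
move=> s; pose K := [set f | exists c psi, schwartz psi /\ f = osc c psi].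
apply: (@schwartz_of_classes _ K K) => //; last by exists c, psi.
- move=> f [{}c [{}psi [{}s ->]]]; exists (c + pi / 2), (fun z => z.1 * psi z).
  split; first exact: schwartz_fst.
  by apply/funext => z; have [_ -> _] := osc_diff c z s.
- move=> f [{}c [{}psi [{}s ->]]]; exists (c + pi / 2), (fun z => z.2 * psi z).
  split; first exact: schwartz_snd.
  by apply/funext => z; have [_ _ ->] := osc_diff c z s.
- move=> f [{}c [{}psi [{}s ->]]]; split; last exact: osc_rapid.
  by move=> z; have [] := osc_diff c z s.
Qed.

End Osc.

(** * Inversion of the Hartley transform *)

Section Inversion.
Variable R : realType.
Notation leb := (@lebesgue_measure R).

Lemma RI_itv_split (f : R -> R) (a b c : R) : integ leb f -> a <= b -> b <= c ->
  \int[leb]_(x in `[a, c]) f x = \int[leb]_(x in `[a, b]) f x + \int[leb]_(x in `[b, c]) f x.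
Proof.
move=> fi ab bc; have mf := integ_meas fi.
have h := @Rintegral_itvB _ f (BLeft a) (BRight c) b.
rewrite -(@Rintegral_itv_obnd_cbnd _ b (BRight c) f); last first.
  by apply: (integrableS measurableT).
rewrite -h ?bnd_simp//; first by rewrite addrC subrK.
by apply: (integrableS measurableT).
Qed.

(** For integrands involving [|x|], with one primitive on each half line. *)
Lemma FTC_two_sided (F G fp fm f : R -> R) l l' :
  (forall x : R, is_derive x 1 F (fp x)) -> continuous fp ->
  (forall x : R, is_derive x 1 G (fm x)) -> continuous fm ->
  (forall x, 0 <= x -> f x = fp x) -> (forall x, x <= 0 -> f x = fm x) ->
  integ leb f -> F n%:R @[n --> \oo] --> l -> G (- n%:R) @[n --> \oo] --> l' ->
  \int[leb]_x f x = (l - F 0) + (G 0 - l').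
Proof.
move=> dF cfp dG cfm fpE fmE fi Fl Gl; have mf := integ_meas fi.
have E n : \int[leb]_(x in `[- n%:R, n%:R]) f x = (F n%:R - F 0) + (G 0 - G (- n%:R)).
  rewrite (@RI_itv_split f _ 0)// ?oppr_le0// addrC; congr (_ + _).
    rewrite -(@FTC_itv _ F fp)//; apply: eq_Rintegral => x.
    by rewrite inE/= in_itv/= => /andP[x0 _]; exact: fpE.
  rewrite -(@FTC_itv _ G fm) ?oppr_le0//; apply: eq_Rintegral => x.
  by rewrite inE/= in_itv/= => /andP[_ x0]; exact: fmE.
have h1 : (\int[leb]_(x in `[- n%:R, n%:R]) f x) @[n --> \oo] --> (l - F 0) + (G 0 - l').
  rewrite (funext E); apply: cvgD; first by apply: cvgB => //; exact: cvg_cst.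
  by apply: cvgB => //; exact: cvg_cst.
apply: cvg_unique h1; first exact: Rhausdorff.
have -> : (fun n : nat => \int[leb]_(x in `[- n%:R, n%:R]) f x) =
    (fun n : nat => \int[leb]_x (\1_(`[- n%:R, n%:R]%classic) x * f x)).
  by apply/funext => n; exact: RI_itv_indic.
apply: (@RI_dominated _ _ _ leb (fun (n : nat) x => \1_(`[- n%:R, n%:R]%classic) x * f x) f (fun x => `|f x|)) => //.
- by move=> n; apply: measurable_funM => //; exact: measurable_indic_itv.
- exact: integ_norm.
- apply: aeW => x; rewrite -[X in _ --> X]mul1r.
  by apply: cvgM; [exact: indic_itv_cvg|exact: cvg_cst].
- move=> n x; rewrite normrM indicE ler_piMl//.
  by case: (_ \in _); rewrite ?normr1 ?normr0.
Qed.

(** The summation factor of Abel; its Fourier transform is the Cauchy kernel, so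
    that the inversion constant is the mass of [1 / (1 + x^2)]. *)
Definition abel (d x : R) : R := expR (- (d * `|x|)).

Lemma abel_gt0 d x : 0 < abel d x. Proof. exact: expR_gt0. Qed.

Lemma m_abel d : measurable_fun setT (abel d).
Proof. by rewrite /abel; meas. Qed.

(** From [exp(-2t) <= (1+t)^-2], which follows from [1 + t <= exp t]. *)
Lemma abel_le_w1 d x : 0 < d -> abel d x <= (1 + (2 / d) ^+ 2) * w1 x.
Proof.
move=> d0; pose t := d / 2 * `|x|.
have t0 : 0 <= t by rewrite mulr_ge0// divr_ge0// ltW.
have e1 : 1 + t <= expR t by exact: expR_ge1Dx.
have e2 : (1 + t) ^+ 2 <= expR (d * `|x|).
  have -> : d * `|x| = t + t by rewrite /t -mulrDl -splitr.
  rewrite expRD -expr2 lerXn2r// ?nnegrE ?expR_ge0//; lra.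
have xE : x ^+ 2 = (2 / d) ^+ 2 * t ^+ 2.
  rewrite -[x ^+ 2]real_normK ?num_real// -exprMn /t; congr (_ ^+ 2).
  by field; rewrite gt_eqF.
have p : 0 < 1 + x ^+ 2 by rewrite ltr_pwDl// sqr_ge0.
rewrite /abel expRN /w1 ler_pdivlMr// mulrC ler_pdivrMr ?expR_gt0//.
apply: (@le_trans _ _ ((1 + (2 / d) ^+ 2) * (1 + t) ^+ 2)); last first.
  by rewrite ler_wpM2l// addr_ge0// sqr_ge0.
rewrite xE; have := sqr_ge0 (2 / d); nra.
Qed.

Lemma integ_abel d : 0 < d -> integ leb (abel d).
Proof.
move=> d0; apply: (@integ_le _ _ _ leb _ (fun x => (1 + (2 / d) ^+ 2) * w1 x)).
- exact: m_abel.
- by move=> x; rewrite gtr0_norm ?abel_gt0// abel_le_w1.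
- by apply: integZ; exact: integ_w1.
Qed.

Lemma abel_cvg0 d : 0 < d -> abel d n%:R @[n --> \oo] --> (0 : R).
Proof.
move=> d0; apply: (@squeeze_cvgr _ _ _ _ (fun=> 0) (fun n => (1 + (2 / d) ^+ 2) * w1 (n%:R : R))); last 2 first.
- exact: cvg_cst.
- by rewrite -[X in _ --> X](mulr0 (1 + (2 / d) ^+ 2)); apply: cvgM; [exact: cvg_cst|exact: w1_cvg0].
by apply: nearW => n; rewrite abel_le_w1// ltW// abel_gt0.
Qed.

Lemma abel_mul_cvg0 d C (g : nat -> R) : 0 < d -> (forall n, `|g n| <= C) ->
  abel d n%:R * g n @[n --> \oo] --> (0 : R).
Proof.
move=> d0 gC; apply/cvgr0Pnorm_le => e e0.
have : (C * abel d n%:R) @[n --> \oo] --> (0 : R).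
  by rewrite -[X in _ --> X](mulr0 C); apply: cvgM; [exact: cvg_cst|exact: abel_cvg0].
move=> /cvgr0Pnorm_le /(_ e e0); apply: filterS => n; apply: le_trans.
rewrite !normrM mulrC ler_wpM2r//; apply: le_trans (gC n) _; exact: ler_norm.
Qed.

Lemma abel_cos d a : 0 < d ->
  \int[leb]_x (abel d x * cos (a * x)) = 2 * d / (d ^+ 2 + a ^+ 2).
Proof.
move=> d0; have q0 : d ^+ 2 + a ^+ 2 != 0.
  by rewrite gt_eqF// ltr_pwDl ?exprn_gt0// sqr_ge0.
pose D := (d ^+ 2 + a ^+ 2)^-1.
pose F x := D * (expR (- d * x) * (a * sin (a * x) - d * cos (a * x))).
pose G x := D * (expR (d * x) * (a * sin (a * x) + d * cos (a * x))).
have dF (x : R) : is_derive x 1 F (expR (- d * x) * cos (a * x)).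
  by rewrite /F; apply: is_derive_eq; rewrite /GRing.scale/= /D; field.
have dG (x : R) : is_derive x 1 G (expR (d * x) * cos (a * x)).
  by rewrite /G; apply: is_derive_eq; rewrite /GRing.scale/= /D; field.
have dfp (x : R) : is_derive x 1 (fun x => expR (- d * x) * cos (a * x))
    (- d * expR (- d * x) * cos (a * x) - a * expR (- d * x) * sin (a * x)).
  by apply: is_derive_eq; rewrite /GRing.scale/=; ring.
have dfm (x : R) : is_derive x 1 (fun x => expR (d * x) * cos (a * x))
    (d * expR (d * x) * cos (a * x) - a * expR (d * x) * sin (a * x)).
  by apply: is_derive_eq; rewrite /GRing.scale/=; ring.
have bnd s (x : R) : `|D * (a * sin (a * x) + s * d * cos (a * x))| <= `|D| * (`|a| + `|s * d|).
  rewrite normrM ler_wpM2l// (le_trans (ler_normD _ _))// normrM [X in _ + X <= _]normrM.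
  by rewrite lerD// ler_piMr// ?norm_sin_le1 ?norm_cos_le1.
rewrite (@FTC_two_sided F G _ _ _ 0 0 dF (is_derive_continuous dfp) dG (is_derive_continuous dfm)).
- rewrite /F /G !mulr0 expR0 sin0 cos0 /D; field.
  by rewrite q0.
- by move=> x x0; rewrite /abel ger0_norm// mulNr.
- by move=> x x0; rewrite /abel ler0_norm// mulrN opprK.
- apply: (@integ_le _ _ _ leb _ (abel d)); last exact: integ_abel.
    by have ma := m_abel d; meas.
  by move=> x; rewrite normrM gtr0_norm ?abel_gt0// ler_piMr ?norm_cos_le1// ltW// abel_gt0.
- rewrite (_ : (fun n => F n%:R) = (fun n : nat => abel d n%:R * (D * (a * sin (a * n%:R) + (-1) * d * cos (a * n%:R))))).
    by apply: (@abel_mul_cvg0 d _ (fun n : nat => D * (a * sin (a * n%:R) + (-1) * d * cos (a * n%:R))) d0 (fun n => bnd _ _)).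
  by apply/funext => n; rewrite /F /abel normr_nat !mulNr; ring.
- rewrite (_ : (fun n => G (- n%:R)) = (fun n : nat => abel d n%:R * (D * (a * sin (a * - n%:R) + 1 * d * cos (a * - n%:R))))).
    by apply: (@abel_mul_cvg0 d _ (fun n : nat => D * (a * sin (a * - n%:R) + 1 * d * cos (a * - n%:R))) d0 (fun n => bnd _ _)).
  by apply/funext => n; rewrite /G /abel normr_nat mulrN; ring.
Qed.

Lemma integ_abel_trig (g : R -> R) d : 0 < d -> measurable_fun setT g ->
  (forall x, `|g x| <= 1) -> integ leb (fun x => abel d x * g x).
Proof.
move=> d0 mg g1; apply: (@integ_le _ _ _ leb _ (abel d)); last exact: integ_abel.
  by have ma := m_abel d; meas.
by move=> x; rewrite normrM gtr0_norm ?abel_gt0// ler_piMr// ltW// abel_gt0.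
Qed.

Lemma abel_sin d a : 0 < d -> \int[leb]_x (abel d x * sin (a * x)) = 0.
Proof.
move=> d0; have i : integ leb (fun x => abel d x * sin (a * x)).
  by apply: integ_abel_trig => //; [meas|move=> x; exact: norm_sin_le1].
have mo : measurable_fun setT (fun x : measurableTypeR R => - x : measurableTypeR R) by meas.
have := RI_transport mo ler01 (@transports_opp R) i; rewrite mul1r.
rewrite (_ : (fun x => _) = (fun x => - (abel d x * sin (a * x)))); last first.
  by apply/funext => x; rewrite /abel normrN mulrN sinN mulrN.
by rewrite RIN//; lra.
Qed.

Definition abel2 d (z : plane R) : R := abel d z.1 * abel d z.2.

Lemma integ_abel2 d : 0 < d -> integ (mu2 R) (abel2 d).
Proof. by move=> d0; apply: integ_plane_prod; exact: integ_abel. Qed.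

Lemma m_abel2 d : measurable_fun setT (abel2 d).
Proof. by rewrite /abel2; have ma := m_abel d; meas. Qed.

Lemma abel2_ge0 d z : 0 <= abel2 d z.
Proof. by rewrite mulr_ge0// ltW// abel_gt0. Qed.

Lemma abel2_le1 d z : 0 < d -> abel2 d z <= 1.
Proof.
move=> d0; have h x : abel d x <= 1 by rewrite -expR0 ler_expR oppr_le0 mulr_ge0// ltW.
by rewrite /abel2 mulr_ile1// ltW// abel_gt0.
Qed.

Lemma abel2_cos d a : 0 < d ->
  \int[mu2 R]_z (abel2 d z * cos (pdot a z)) =
  (2 * d / (d ^+ 2 + a.1 ^+ 2)) * (2 * d / (d ^+ 2 + a.2 ^+ 2)).
Proof.
move=> d0.
have ic (b : R) : integ leb (fun x => abel d x * cos (b * x)).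
  by apply: integ_abel_trig => //; [meas|move=> x; exact: norm_cos_le1].
have is_ (b : R) : integ leb (fun x => abel d x * sin (b * x)).
  by apply: integ_abel_trig => //; [meas|move=> x; exact: norm_sin_le1].
rewrite -!abel_cos// -RI_plane_prod//.
transitivity (\int[mu2 R]_z ((abel d z.1 * cos (a.1 * z.1)) * (abel d z.2 * cos (a.2 * z.2)) -
   (abel d z.1 * sin (a.1 * z.1)) * (abel d z.2 * sin (a.2 * z.2)))).
  by apply: RI_ext => z; rewrite /pdot cosD /abel2; ring.
rewrite RIB; [|exact: (integ_plane_prod (ic _) (ic _))|exact: (integ_plane_prod (is_ _) (is_ _))].
by rewrite [X in _ - X](RI_plane_prod (is_ _) (is_ _)) abel_sin// mul0r subr0.
Qed.

Lemma abel2_sin d a : 0 < d -> \int[mu2 R]_z (abel2 d z * sin (pdot a z)) = 0.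
Proof.
move=> d0.
have ic (b : R) : integ leb (fun x => abel d x * cos (b * x)).
  by apply: integ_abel_trig => //; [meas|move=> x; exact: norm_cos_le1].
have is_ (b : R) : integ leb (fun x => abel d x * sin (b * x)).
  by apply: integ_abel_trig => //; [meas|move=> x; exact: norm_sin_le1].
transitivity (\int[mu2 R]_z ((abel d z.1 * sin (a.1 * z.1)) * (abel d z.2 * cos (a.2 * z.2)) +
   (abel d z.1 * cos (a.1 * z.1)) * (abel d z.2 * sin (a.2 * z.2)))).
  by apply: RI_ext => z; rewrite /pdot sinD /abel2; ring.
rewrite RID; [|exact: (integ_plane_prod (is_ _) (ic _))|exact: (integ_plane_prod (ic _) (is_ _))].
by rewrite (RI_plane_prod (is_ _) (ic _)) (RI_plane_prod (ic _) (is_ _)) !abel_sin// mul0r mulr0 addr0.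
Qed.

Definition cas (x : R) : R := cos x + sin x.

Lemma cas_le2 x : `|cas x| <= 2.
Proof.
apply: le_trans (ler_normD _ _) _; have := norm_cos_le1 x; have := norm_sin_le1 x; lra.
Qed.

Lemma casM x y : cas x * cas y = cos (x - y) + sin (x + y).
Proof. by rewrite /cas cosB sinD; ring. Qed.

Lemma m_cas d (T : measurableType d) (f : T -> R) : measurable_fun setT f ->
  measurable_fun setT (fun x => cas (f x)).
Proof. by move=> mf; rewrite /cas; meas. Qed.

(** The real counterpart of the Fourier transform: it represents a conjugate
    symmetric function by one real function without any symmetry. *)
Definition hart (psi : R * R -> R) (zeta : R * R) : R :=
  \int[mu2 R]_z (psi z * cas (pdot z zeta)).

Lemma hart_osc psi : integ (mu2 R) psi ->
  hart psi = fun zeta => 1 * osc 0 psi zeta + osc (- (pi / 2)) psi zeta.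
Proof.
move=> ip; apply/funext => zeta; rewrite mul1r -RID; try exact: integ_cosM (m_osc_phase _ _).
apply: RI_ext => z; rewrite addr0 /cas mulrDr; congr (_ + _ * _).
by rewrite -[pdot z zeta in LHS](subrK (pi / 2)) sinDpihalf.
Qed.

Lemma schwartz_hart psi : schwartz psi -> schwartz (hart psi).
Proof.
move=> s; rewrite hart_osc; last exact: schwartz_integ.
by apply: schwartz_lc; exact: schwartz_osc.
Qed.

Lemma integ_casM (psi g : plane R -> R) : integ (mu2 R) psi ->
  measurable_fun setT g -> integ (mu2 R) (fun z => psi z * cas (g z)).
Proof.
move=> ip mg; have mp := integ_meas ip; have mc := m_cas mg.
apply: (@integ_le _ _ _ (mu2 R) _ (fun z => 2 * `|psi z|)); first by meas.
- by move=> z; rewrite normrM mulrC ler_wpM2r// cas_le2.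
- exact/integZ/integ_norm.
Qed.

Section HartK.
Variables (psi : R * R -> R) (z : R * R).
Hypothesis s : schwartz psi.

Let ip : integ (mu2 R) psi := schwartz_integ s.
Let mp := schwartz_measurable s.

(** The product formula [casM] leaves the Cauchy kernel at [u - z], the sine of the
    sum being killed by the symmetry of the summation factor; then [u = d p + z]. *)
Lemma hart_abel d : 0 < d ->
  \int[mu2 R]_zeta (hart psi zeta * cas (pdot z zeta) * abel2 d zeta) =
  4 * \int[mu2 R]_p (psi (d * p.1 + z.1, d * p.2 + z.2) * (w1 p.1 * w1 p.2)).
Proof.
move=> d0; have ia := integ_abel2 d0; have ma := m_abel2 d.
have dn0 : d != 0 by rewrite gt_eqF.
pose k (a : plane R) := (2 * d / (d ^+ 2 + a.1 ^+ 2)) * (2 * d / (d ^+ 2 + a.2 ^+ 2)).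
transitivity (\int[mu2 R]_u (psi u * k (psub u z))).
  pose f (zeta u : plane R) := psi u * cas (pdot u zeta) * (cas (pdot z zeta) * abel2 d zeta).
  transitivity (\int[mu2 R]_zeta \int[mu2 R]_u f zeta u).
    apply: RI_ext => zeta; rewrite -mulrA -RIZr//.
    by apply: integ_casM => //; meas.
  rewrite (@RI_swap_dom _ _ _ _ _ (leb2 R) (leb2 R) f (fun zeta => 4 * abel2 d zeta) (fun u => `|psi u|)).
  - apply: RI_ext => u; rewrite /k -(abel2_cos (psub u z) d0).
    transitivity (psi u * (\int[mu2 R]_zeta (abel2 d zeta * cos (pdot (psub u z) zeta)) +
       \int[mu2 R]_zeta (abel2 d zeta * sin (pdot (padd u z) zeta)))); last first.
      by rewrite abel2_sin// addr0.
    have i1 : integ (mu2 R) (fun zeta => abel2 d zeta * cos (pdot (psub u z) zeta)).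
      by apply: integ_cosM => //; meas.
    have i2 : integ (mu2 R) (fun zeta => abel2 d zeta * sin (pdot (padd u z) zeta)).
      apply: (@integ_le _ _ _ (mu2 R) _ (fun z => `|abel2 d z|)); first by meas.
      - by move=> v; rewrite normrM ler_piMr// norm_sin_le1.
      - exact: integ_norm.
    rewrite -RID// -RIZ; last exact: integD.
    apply: RI_ext => zeta; rewrite /f -mulrA [cas _ * (_ * _)]mulrA casM.
    have -> : pdot u zeta - pdot z zeta = pdot (psub u z) zeta by rewrite /pdot /=; ring.
    have -> : pdot u zeta + pdot z zeta = pdot (padd u z) zeta by rewrite /pdot /=; ring.
    ring.
  - have mc1 : measurable_fun setT (fun p : plane R * plane R => cas (pdot p.2 p.1)).
      by apply: m_cas; meas.
    have mc2 : measurable_fun setT (fun p : plane R * plane R => cas (pdot z p.1)).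
      by apply: m_cas; meas.
    by rewrite /f; meas.
  - exact: integZ.
  - exact: integ_norm.
  - move=> zeta u; rewrite /f 3!normrM (ger0_norm (abel2_ge0 _ _)).
    have h1 := cas_le2 (pdot u zeta); have h2 := cas_le2 (pdot z zeta).
    have a0 := abel2_ge0 d zeta; have p0 := normr_ge0 (psi u).
    have c1 := normr_ge0 (cas (pdot u zeta)); have c2 := normr_ge0 (cas (pdot z zeta)).
    have h12 : `|cas (pdot u zeta)| * `|cas (pdot z zeta)| <= 4 by nra.
    rewrite (_ : _ * _ * _ = (`|cas (pdot u zeta)| * `|cas (pdot z zeta)|) * (abel2 d zeta * `|psi u|)); last by ring.
    by rewrite -[leRHS]mulrA ler_wpM2r// mulr_ge0.
pose phi (p : plane R) : plane R := (d * p.1 + z.1, d * p.2 + z.2).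
have mphi : measurable_fun setT phi by rewrite /phi; meas.
have tphi : transports (mu2 R) phi (d^-1 * d^-1).
  apply: (@transports_prod R (fun x => d * x + z.1) (fun x => d * x + z.2)).
  - by meas.
  - by meas.
  - by rewrite invr_ge0 ltW.
  - by rewrite invr_ge0 ltW.
  - exact: transports_affine.
  - exact: transports_affine.
have kk a : 0 <= k a <= (2 / d) * (2 / d).
  have h (x : R) : 0 <= 2 * d / (d ^+ 2 + x ^+ 2) <= 2 / d.
    have q : 0 < d ^+ 2 + x ^+ 2 by rewrite ltr_pwDl ?exprn_gt0// sqr_ge0.
    apply/andP; split; first by apply: divr_ge0; [apply: mulr_ge0 => //|]; exact: ltW.
    rewrite ler_pdivrMr// mulrAC ler_pdivlMr//.
    by have := sqr_ge0 x; nra.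
  have /andP[h1 h2] := h a.1; have /andP[h3 h4] := h a.2.
  by rewrite mulr_ge0//= ler_pM.
have mk : measurable_fun setT (fun u => k (psub u z)) by rewrite /k; meas.
have ik : integ (mu2 R) (fun u => psi u * k (psub u z)).
  have := @integ_mulb _ _ _ (mu2 R) (fun u => k (psub u z)) psi _ mk _ ip.
  move=> /(_ ((2 / d) * (2 / d))) h; apply: integ_ext (h _) => u; first by rewrite mulrC.
  by have /andP[k0 kle] := kk (psub u z); rewrite ger0_norm.
have dd : 0 <= d^-1 * d^-1 by rewrite mulr_ge0// invr_ge0 ltW.
have := RI_transport mphi dd tphi ik.
move=> /(congr1 (fun t => d ^+ 2 * t)); rewrite mulrA expr2 mulrACA divff// !mul1r => <-.
rewrite -!RIZ.
- apply: RI_ext => p; rewrite /phi /k /psub/= !addrK /w1.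
  have q (x : R) : 1 + x ^+ 2 != 0 by rewrite gt_eqF// ltr_pwDl// sqr_ge0.
  have q' (x : R) : d ^+ 2 + (d * x) ^+ 2 != 0.
    by rewrite gt_eqF// ltr_pwDl ?exprn_gt0// sqr_ge0.
  by field; rewrite !q !q'.
- have mw : measurable_fun setT (fun p : plane R => psi (phi p)) by apply: mcompT.
  have [C [C0 pC]] := schwartz_wt s.
  apply: (@integ_mulb _ _ _ (mu2 R) _ _ C) => //.
    by move=> p; apply: le_trans (pC _) _; rewrite ler_piMr// wt_le1.
  by apply: integ_plane_prod; exact: integ_w1.
- exact: (integ_transport mphi dd tphi ik).
Qed.

Lemma hartK : \int[mu2 R]_zeta (hart psi zeta * cas (pdot z zeta)) =
  4 * (cauchy_mass R * cauchy_mass R) * psi z.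
Proof.
pose dn (n : nat) : R := n.+1%:R^-1.
have dn0 n : 0 < dn n by rewrite invr_gt0.
have dnc : dn n @[n --> \oo] --> (0 : R) by exact: cvg_harmonic.
have sh := schwartz_hart s; have ih := schwartz_integ sh; have mh := schwartz_measurable sh.
have mc : measurable_fun setT (fun zeta : plane R => cas (pdot z zeta)) by apply: m_cas; meas.
have A : (\int[mu2 R]_zeta (hart psi zeta * cas (pdot z zeta) * abel2 (dn n) zeta))
    @[n --> \oo] --> \int[mu2 R]_zeta (hart psi zeta * cas (pdot z zeta)).
  apply: (@RI_dominated _ _ _ (mu2 R) (fun n zeta => hart psi zeta * cas (pdot z zeta) * abel2 (dn n) zeta)
     _ (fun zeta => `|hart psi zeta * cas (pdot z zeta)|)).
  - by move=> n; have ma := m_abel2 (dn n); meas.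
  - by meas.
  - by apply: integ_norm; apply: integ_casM => //; meas.
  - apply: aeW => zeta; rewrite -[X in _ --> X]mulr1; apply: cvgM; first exact: cvg_cst.
    have ab (x : R) : abel (dn n) x @[n --> \oo] --> (1 : R).
      have h : - (dn n * `|x|) @[n --> \oo] --> (0 : R).
        by rewrite -oppr0; apply: cvgN; rewrite -(mul0r `|x|); apply: cvgM => //; exact: cvg_cst.
      by rewrite -(expR0 R); apply: (cvg_comp _ _ h); exact: continuous_expR.
    by rewrite -(mulr1 1); apply: cvgM; exact: ab.
  - by move=> n zeta; rewrite normrM (ger0_norm (abel2_ge0 _ _)) ler_piMr// abel2_le1.
have [C [C0 pC]] := schwartz_wt s.
have iw : integ (mu2 R) (fun p => w1 p.1 * w1 p.2) by apply: integ_plane_prod; exact: integ_w1.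
have B : (4 * \int[mu2 R]_p (psi (dn n * p.1 + z.1, dn n * p.2 + z.2) * (w1 p.1 * w1 p.2)))
    @[n --> \oo] --> 4 * \int[mu2 R]_p (psi z * (w1 p.1 * w1 p.2)).
  apply: cvgM; first exact: cvg_cst.
  have mw := integ_meas iw.
  apply: (@RI_dominated _ _ _ (mu2 R) (fun n p => psi (dn n * p.1 + z.1, dn n * p.2 + z.2) * (w1 p.1 * w1 p.2))
     _ (fun p => C * (w1 p.1 * w1 p.2))).
  - move=> n; have mphi : measurable_fun setT (fun p : plane R => (dn n * p.1 + z.1, dn n * p.2 + z.2) : plane R) by meas.
    have mw' : measurable_fun setT (fun p : plane R => psi (dn n * p.1 + z.1, dn n * p.2 + z.2)).
      exact: (mcompT (h := psi : plane R -> R)).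
    by meas.
  - by meas.
  - exact: integZ.
  - apply: aeW => p; apply: cvgM; last exact: cvg_cst.
    have h : (dn n * p.1 + z.1, dn n * p.2 + z.2) @[n --> \oo] --> (0 * p.1 + z.1, 0 * p.2 + z.2).
      apply: (@cvg_pair _ _ _ _ (nbhs _) (nbhs _)) => /=.
        by apply: cvgD; [apply: cvgM => //; exact: cvg_cst|exact: cvg_cst].
      by apply: cvgD; [apply: cvgM => //; exact: cvg_cst|exact: cvg_cst].
    rewrite !mul0r !add0r -surjective_pairing in h.
    have cpsi : continuous psi.
      by move=> u; apply: differentiable_continuous; exact: (schwartz_diff 0 0).
    exact: (cvg_comp _ _ h (cpsi z)).
  - move=> n p.
    have w0 : 0 <= w1 p.1 * w1 p.2 by apply: mulr_ge0; exact/ltW/w1_gt0.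
    rewrite normrM (ger0_norm w0) ler_wpM2r//.
    by apply: le_trans (pC _) _; rewrite ler_piMr// wt_le1.
rewrite (funext (fun n => hart_abel (dn0 n))) in A.
rewrite (cvg_unique _ A B)// RIZ// RI_plane_prod; try exact: integ_w1.
by rewrite /cauchy_mass; ring.
Qed.

End HartK.

End Inversion.

(** * Uniqueness of functions tested against Schwartz functions *)

Section Sigmoid.
Variable R : realType.
Implicit Types (x : R) (z : R * R).

Definition sigm x : R := (1 + expR (- x))^-1.

Lemma sigm_den x : 0 < 1 + expR (- x).
Proof. by rewrite ltr_pwDl// expR_ge0. Qed.

Lemma sigm_gt0 x : 0 < sigm x.
Proof. by rewrite invr_gt0 sigm_den. Qed.

Lemma sigm_opp x : 1 - sigm x = sigm (- x).
Proof.
have e0 : expR x != 0 by rewrite gt_eqF// expR_gt0.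
have e1 : 1 + expR x != 0 by rewrite gt_eqF// ltr_pwDl// expR_ge0.
have e2 : expR x + 1 != 0 by rewrite addrC.
by rewrite /sigm opprK expRN; field; rewrite e0 e1 ?e2.
Qed.

Lemma sigm_le_expR x : sigm x <= expR x.
Proof.
rewrite /sigm -[expR x]invrK -expRN lef_pV2 ?posrE ?sigm_den ?expR_gt0//.
by rewrite lerDr.
Qed.

Lemma sigm_le1 x : sigm x <= 1.
Proof. by rewrite -subr_ge0 sigm_opp ltW// sigm_gt0. Qed.

Lemma norm_sigm_le1 x : `|sigm x| <= 1.
Proof. by rewrite gtr0_norm ?sigm_gt0// sigm_le1. Qed.

(** All the derivatives of [sigm] are polynomials in [sigm]. *)
Lemma is_derive_sigm x : is_derive x 1 sigm (sigm x * (1 - sigm x)).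
Proof.
have n0 : 1 + expR (- x) != 0 by rewrite gt_eqF// sigm_den.
have d1 : is_derive x 1 (fun x => 1 + expR (- x)) (- expR (- x)).
  by apply: is_derive_eq; rewrite /GRing.scale/=; ring.
have h := @is_deriveV R (fun x => 1 + expR (- x)) x _ _ n0 d1.
have -> : sigm x * (1 - sigm x) = - (1 + expR (- x)) ^- 2 *: - expR (- x).
  by rewrite /GRing.scale/= /sigm; field.
exact: h.
Qed.

(** The derivative of the sigmoid, decaying like [exp(- |x|)]. *)
Definition bump x : R := sigm x * (1 - sigm x).

Lemma bump_gt0 x : 0 < bump x.
Proof. by rewrite /bump sigm_opp mulr_gt0// sigm_gt0. Qed.

Lemma bump_le_abel x : bump x <= expR (- `|x|).
Proof.
have [x0|x0] := leP 0 x.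
  rewrite /bump sigm_opp ger0_norm// -[leRHS]mul1r.
  by apply: ler_pM; [exact/ltW/sigm_gt0|exact/ltW/sigm_gt0|exact: sigm_le1|exact: sigm_le_expR].
rewrite /bump ltr0_norm// opprK -[leRHS]mulr1 sigm_opp.
by apply: ler_pM; [exact/ltW/sigm_gt0|exact/ltW/sigm_gt0|exact: sigm_le_expR|exact: sigm_le1].
Qed.

Lemma bump_rapid k : exists C, forall x, (1 + x ^+ 2) ^+ k * bump x <= C.
Proof.
pose m : R := 2 * k.+1%:R.
have m1 : 1 <= m by rewrite /m -natrM ler1n.
have m0 : 0 < m by exact: lt_le_trans m1.
exists ((m ^+ 2) ^+ k.+1) => x.
have q1 : 1 <= 1 + x ^+ 2 by rewrite lerDl sqr_ge0.
have q0 : 0 <= 1 + x ^+ 2 by exact: le_trans q1.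
apply: (@le_trans _ _ ((1 + x ^+ 2) ^+ k.+1 * expR (- `|x|))).
  apply: ler_pM => //; [exact: exprn_ge0|exact/ltW/bump_gt0| |exact: bump_le_abel].
  by rewrite ler_weXn2l// leqnSn.
rewrite expRN ler_pdivrMr ?expR_gt0//.
pose t := `|x| / m.
have t0 : 0 <= t by rewrite divr_ge0// ltW.
have xt : `|x| = (2 * k.+1)%:R * t.
  by rewrite /t natrM -/m mulrC mulfVK// gt_eqF.
rewrite xt expRM_natl exprM -exprMn lerXn2r// ?nnegrE// ?mulr_ge0 ?sqr_ge0//.
have -> : x ^+ 2 = m ^+ 2 * t ^+ 2.
  by rewrite -exprMn /t mulrCA divff ?gt_eqF// mulr1 real_normK ?num_real.
apply: (@le_trans _ _ (m ^+ 2 * (1 + t) ^+ 2)); first by nra.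
rewrite ler_wpM2l ?sqr_ge0// lerXn2r// ?nnegrE ?expR_ge0// ?expR_ge1Dx//; lra.
Qed.

(** Test functions: the bump in both variables, multiplied by sigmoids of
    affine functions of one coordinate. *)
Inductive sigmoidal : (R * R -> R) -> Prop :=
| sigmoidal_bump : sigmoidal (fun z => bump z.1 * bump z.2)
| sigmoidal_lc c f g : sigmoidal f -> sigmoidal g -> sigmoidal (fun z => c * f z + g z)
| sigmoidal_x c d f : sigmoidal f -> sigmoidal (fun z => sigm (c * z.1 + d) * f z)
| sigmoidal_y c d f : sigmoidal f -> sigmoidal (fun z => sigm (c * z.2 + d) * f z).

Lemma diff_along_x (g dg : R -> R) z : (forall x : R, is_derive x 1 g (dg x)) ->
  [/\ differentiable (fun z : R * R => g z.1) z,
      d_x (fun z => g z.1) z = dg z.1 & d_y (fun z => g z.1) z = 0].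
Proof.
move=> dG; have D : differentiable (fun z : R * R => g z.1) z.
  apply: (differentiable_comp (f := fst) (g := g)); first by have [] := diff_fst z.
  by apply/derivable1_diffP; case: (dG z.1).
case: z D => x y D; split => //.
  have [_ <-] := line_derive_x D; by have [_ <-] := dG x.
have [_ <-] := line_derive_y D; exact: (derive_cst (g x)).
Qed.

Lemma diff_along_y (g dg : R -> R) z : (forall x : R, is_derive x 1 g (dg x)) ->
  [/\ differentiable (fun z : R * R => g z.2) z,
      d_x (fun z => g z.2) z = 0 & d_y (fun z => g z.2) z = dg z.2].
Proof.
move=> dG; have D : differentiable (fun z : R * R => g z.2) z.
  apply: (differentiable_comp (f := snd) (g := g)); first by have [] := diff_snd z.
  by apply/derivable1_diffP; case: (dG z.2).
case: z D => x y D; split => //.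
  have [_ <-] := line_derive_x D; exact: (derive_cst (g y)).
have [_ <-] := line_derive_y D; by have [_ <-] := dG y.
Qed.

Lemma is_derive_sigm_affine c d x :
  is_derive x 1 (fun x => sigm (c * x + d)) (c * (sigm (c * x + d) * (1 - sigm (c * x + d)))).
Proof.
have h := is_derive_sigm (c * x + d).
have h1 : is_derive x 1 (fun x => c * x + d) c.
  by apply: is_derive_eq; rewrite /GRing.scale/=; ring.
have := @is_derive1_comp R sigm (fun x => c * x + d) x _ _ h h1; rewrite mulrC; exact.
Qed.

Lemma is_derive_bump x : is_derive x 1 bump (bump x - 2 * (sigm (1 * x + 0) * bump x)).
Proof.
have h := is_derive_sigm x.
by apply: is_derive_eq; rewrite /GRing.scale/= mul1r addr0 /bump; ring.
Qed.

Lemma sigmoidal_regular f : sigmoidal f ->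
  [/\ forall z, differentiable f z, rapid f, sigmoidal (d_x f) & sigmoidal (d_y f)].
Proof.
elim=> [|c {}f g _ [df rf sx sy] _ [dg rg tx ty]|c d {}f sf [df rf sx sy]|c d {}f sf [df rf sx sy]].
- have D z := diff_along_x z is_derive_bump; have E z := diff_along_y z is_derive_bump.
  have dD z : differentiable (fun z : R * R => bump z.1) z by have [] := D z.
  have dE z : differentiable (fun z : R * R => bump z.2) z by have [] := E z.
  split.
  + by move=> z; apply: differentiable_mul.
  + move=> k; have [C hC] := bump_rapid k; exists (C * C) => z.
    have q (x : R) : 0 <= 1 + x ^+ 2 by rewrite addr_ge0// sqr_ge0.
    rewrite ger0_norm; last by rewrite mulr_ge0// ltW// bump_gt0.
    apply: (@le_trans _ _ (((1 + z.1 ^+ 2) * (1 + z.2 ^+ 2)) ^+ k * (bump z.1 * bump z.2))).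
      apply: ler_wpM2r; first by apply: mulr_ge0; exact/ltW/bump_gt0.
      rewrite lerXn2r// ?nnegrE.
      - exact/ltW/(bracket_gt0 z).
      - by rewrite mulr_ge0.
      - by have := sqr_ge0 z.1; have := sqr_ge0 z.2; nra.
    rewrite exprMn mulrACA ler_pM// ?hC// mulr_ge0 ?exprn_ge0//; exact/ltW/bump_gt0.
  + have -> : d_x (fun z : R * R => bump z.1 * bump z.2) =
       fun z => (-2) * (sigm (1 * z.1 + 0) * (bump z.1 * bump z.2)) + bump z.1 * bump z.2.
      apply/funext => z; rewrite d_x_mul//.
      by have [_ -> _] := D z; have [_ -> _] := E z; ring.
    by apply: sigmoidal_lc; [apply: sigmoidal_x|]; exact: sigmoidal_bump.
  + have -> : d_y (fun z : R * R => bump z.1 * bump z.2) =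
       fun z => (-2) * (sigm (1 * z.2 + 0) * (bump z.1 * bump z.2)) + bump z.1 * bump z.2.
      apply/funext => z; rewrite d_y_mul//.
      by have [_ _ ->] := D z; have [_ _ ->] := E z; ring.
    by apply: sigmoidal_lc; [apply: sigmoidal_y|]; exact: sigmoidal_bump.
- split.
  + by move=> z; exact: differentiable_lc.
  + exact: rapid_lc.
  + have -> : d_x (fun z => c * f z + g z) = fun z => c * d_x f z + d_x g z.
      by apply/funext => z; rewrite d_x_lc.
    exact: sigmoidal_lc.
  + have -> : d_y (fun z => c * f z + g z) = fun z => c * d_y f z + d_y g z.
      by apply/funext => z; rewrite d_y_lc.
    exact: sigmoidal_lc.
- have D z := diff_along_x z (is_derive_sigm_affine c d).
  have dD z : differentiable (fun z : R * R => sigm (c * z.1 + d)) z by have [] := D z.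
  split.
  + by move=> z; apply: differentiable_mul.
  + by apply: rapid_mul => // z; apply: le_trans (norm_sigm_le1 _) (bracket_ge1 z).
  + have -> : d_x (fun z => sigm (c * z.1 + d) * f z) = fun z =>
       (- c) * (sigm (c * z.1 + d) * (sigm (c * z.1 + d) * f z)) +
       (c * (sigm (c * z.1 + d) * f z) + sigm (c * z.1 + d) * d_x f z).
      apply/funext => z; rewrite d_x_mul//.
      by have [_ -> _] := D z; ring.
    by do !apply: sigmoidal_lc; do !apply: sigmoidal_x.
  + have -> : d_y (fun z => sigm (c * z.1 + d) * f z) = fun z => sigm (c * z.1 + d) * d_y f z.
      apply/funext => z; rewrite d_y_mul//.
      by have [_ _ ->] := D z; ring.
    exact: sigmoidal_x.
- have D z := diff_along_y z (is_derive_sigm_affine c d).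
  have dD z : differentiable (fun z : R * R => sigm (c * z.2 + d)) z by have [] := D z.
  split.
  + by move=> z; apply: differentiable_mul.
  + by apply: rapid_mul => // z; apply: le_trans (norm_sigm_le1 _) (bracket_ge1 z).
  + have -> : d_x (fun z => sigm (c * z.2 + d) * f z) = fun z => sigm (c * z.2 + d) * d_x f z.
      apply/funext => z; rewrite d_x_mul//.
      by have [_ -> _] := D z; ring.
    exact: sigmoidal_y.
  + have -> : d_y (fun z => sigm (c * z.2 + d) * f z) = fun z =>
       (- c) * (sigm (c * z.2 + d) * (sigm (c * z.2 + d) * f z)) +
       (c * (sigm (c * z.2 + d) * f z) + sigm (c * z.2 + d) * d_y f z).
      apply/funext => z; rewrite d_y_mul//.
      by have [_ _ ->] := D z; ring.
    by do !apply: sigmoidal_lc; do !apply: sigmoidal_y.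
Qed.

Lemma sigmoidal_schwartz f : sigmoidal f -> schwartz f.
Proof.
apply: (@schwartz_of_classes _ sigmoidal sigmoidal) => // g sg;
  by have [] := sigmoidal_regular sg.
Qed.

(** The arguments [n^2 (x - a) - n] make the limit exactly the indicator of
    the open ray, also at the end point. *)
Definition ramp (a : R) (n : nat) x : R := sigm (n%:R ^+ 2 * x + (- (n%:R ^+ 2 * a) - n%:R)).

Lemma expRN_nat_cvg0 : expR (- n%:R : R) @[n --> \oo] --> (0 : R).
Proof.
apply: (@squeeze_cvgr _ _ _ _ (fun=> 0) (@harmonic R)); last 2 first.
- exact: cvg_cst.
- exact: cvg_harmonic.
apply: nearW => n; rewrite expR_ge0/= expRN /harmonic/= lef_pV2 ?posrE ?expR_gt0 ?ltr0Sn//.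
by rewrite -natr1 addrC expR_ge1Dx.
Qed.

Lemma ramp_cvg a x : ramp a n x @[n --> \oo] --> (\1_(`]a, +oo[%classic) x : R).
Proof.
rewrite indicE; have [xa|ax] := leP x a.
  rewrite memNset; last by rewrite /= in_itv/= andbT; apply/negP; rewrite -leNgt.
  apply: (@squeeze_cvgr _ _ _ _ (fun=> 0) (fun n => expR (- n%:R))); last 2 first.
  - exact: cvg_cst.
  - exact: expRN_nat_cvg0.
  apply: nearW => n; rewrite ltW ?sigm_gt0//=; apply: le_trans (sigm_le_expR _) _.
  by rewrite ler_expR; have := sqr_ge0 (n%:R : R); nra.
rewrite mem_set; last by rewrite /= in_itv/= andbT.
rewrite -[X in _ --> X]subr0.
have -> : (fun n => ramp a n x) = (fun n => 1 - sigm (- (n%:R ^+ 2 * x + (- (n%:R ^+ 2 * a) - n%:R)))).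
  by apply/funext => n; rewrite -sigm_opp; rewrite /ramp; ring.
apply: cvgB; first exact: cvg_cst.
apply: (@squeeze_cvgr _ _ _ _ (fun=> 0) (fun n => expR (- n%:R))); last 2 first.
- exact: cvg_cst.
- exact: expRN_nat_cvg0.
near=> n; rewrite ltW ?sigm_gt0//=; apply: le_trans (sigm_le_expR _) _.
rewrite ler_expR.
have n0 : 0 <= n%:R :> R by [].
have : 2 / (x - a) <= n%:R by near: n; exact: nbhs_infty_ger.
rewrite ler_pdivrMr ?subr_gt0// => h.
by nra.
Unshelve. all: by end_near. Qed.

End Sigmoid.

Lemma m_indic d1 d2 (X : measurableType d1) (Y : measurableType d2) (R : realType)
  (A : set Y) (f : X -> Y) : measurable A -> measurable_fun setT f ->
  measurable_fun setT (fun x => \1_A (f x) : R).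
Proof.
move=> mA mf; have mi : measurable_fun setT (\1_A : Y -> R) by exact: measurable_indic.
exact: (measurableT_comp mi mf).
Qed.

Section Uniqueness.
Variable R : realType.
Implicit Types h G : plane R -> R.

(** The sets on which the integral of [h] vanishes form a Dynkin system. *)
Lemma null_generated d (T : measurableType d) (phi : plane R -> T) h (S : set (set T)) :
  measurable_fun setT phi -> integ (mu2 R) h -> setI_closed S ->
  @measurable d T = <<s S >> ->
  (forall A, S A -> \int[mu2 R]_z (h z * \1_A (phi z)) = 0) ->
  \int[mu2 R]_z h z = 0 ->
  forall A, measurable A -> \int[mu2 R]_z (h z * \1_A (phi z)) = 0.
Proof.
move=> mphi ih SI SE hS h0; have mh := integ_meas ih.
pose H := [set A : set T | measurable A /\ \int[mu2 R]_z (h z * \1_A (phi z)) = 0].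
have m1 (A : set T) : measurable A -> measurable_fun setT (fun z => \1_A (phi z) : R).
  by move=> mA; exact: m_indic.
have n1 (A : set T) z : `|\1_A (phi z) : R| <= 1.
  by rewrite indicE; case: (_ \in _); rewrite ?normr1 ?normr0.
have i1 (A : set T) : measurable A -> integ (mu2 R) (fun z => h z * \1_A (phi z)).
  move=> mA; have mA1 := m1 A mA; apply: (@integ_le _ _ _ (mu2 R) _ (fun z => `|h z|)); first by meas.
  - by move=> z; rewrite normrM ler_piMr.
  - exact: integ_norm.
suff sub : <<s S >> `<=` H by move=> A mA; have [] : H A by apply: sub; rewrite -SE.
apply: lambda_system_subset => //; last by move=> A SA; split; [rewrite SE; exact: sub_sigma_algebra|exact: hS].
split => //.
- split; first exact: measurableT.
  by rewrite -[RHS]h0; apply: RI_ext => z; rewrite indicT mulr1.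
- move=> A B BA [mA A0] [mB B0]; split; first exact: measurableD.
  transitivity (\int[mu2 R]_z (h z * \1_A (phi z) - h z * \1_B (phi z))).
    apply: RI_ext => z; rewrite -mulrBr; congr (_ * _); rewrite !indicE.
    have [zA|zA] := boolP (phi z \in A); have [zB|zB] := boolP (phi z \in B).
    + by rewrite memNset ?subrr// => -[_]; rewrite inE in zB.
    + by rewrite mem_set ?subr0//; split; [rewrite inE in zA|rewrite notin_setE in zB].
    + by move: zA; rewrite notin_setE; rewrite inE in zB; move: (BA _ zB).
    + by rewrite memNset ?subr0//; rewrite notin_setE in zA => -[].
  by rewrite RIB; [rewrite A0 B0 subrr|exact: i1|exact: i1].
- move=> F ndF FH; have mF n : measurable (F n) by have [] := FH n.
  have mU : measurable (\bigcup_n F n) by exact: bigcupT_measurable.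
  split => //.
  have : (\int[mu2 R]_z (h z * \1_(F n) (phi z))) @[n --> \oo] -->
      \int[mu2 R]_z (h z * \1_(\bigcup_n F n) (phi z)).
    apply: (@RI_dominated _ _ _ (mu2 R) (fun n z => h z * \1_(F n) (phi z)) _ (fun z => `|h z|)).
    - by move=> n; have mFn := m1 _ (mF n); meas.
    - by have mUn := m1 _ mU; meas.
    - exact: integ_norm.
    - apply: aeW => z; apply: cvgM; first exact: cvg_cst.
      rewrite indicE; have [|nU] := boolP (phi z \in _).
        rewrite inE => -[k _ Fk]; apply: cvg_near_cst; near=> n.
        rewrite indicE mem_set//; have /subsetPset : (F k <= F n)%O by apply: ndF; near: n; exact: nbhs_infty_ge.
        exact.
      apply: cvg_near_cst; apply: nearW => n; rewrite indicE memNset// => Fn.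
      by move: nU; rewrite notin_setE; apply; exists n.
    - by move=> n z; rewrite normrM ler_piMr.
  rewrite (_ : (fun n => _) = (fun=> 0)); last by apply/funext => n; have [] := FH n.
  by move=> /cvg_unique; apply; [exact: Rhausdorff|exact: cvg_cst].
Unshelve. all: by end_near. Qed.

Lemma null_rays (phi : plane R -> R) h :
  measurable_fun setT phi -> integ (mu2 R) h ->
  (forall a, \int[mu2 R]_z (h z * \1_(`]a, +oo[%classic) (phi z)) = 0) ->
  (forall A : set R, measurable A -> \int[mu2 R]_z (h z * \1_A (phi z)) = 0).
Proof.
move=> mphi ih hr; have mh := integ_meas ih.
apply: (@null_generated _ (measurableTypeR R) phi h (@RGenOInfty.G R)) => //.
- move=> _ _ [a ->] [b ->]; exists (Num.max a b).
  apply/seteqP; split => x /=; rewrite !in_itv/= !andbT gt_max.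
    by move=> [-> ->].
  by move/andP.
- exact: RGenOInfty.measurableE.
- by move=> A [a ->]; exact: hr.
have : (\int[mu2 R]_z (h z * \1_(`](- n%:R), +oo[%classic) (phi z))) @[n --> \oo] -->
    \int[mu2 R]_z h z.
  apply: (@RI_dominated _ _ _ (mu2 R) (fun (n : nat) z => h z * \1_(`](- n%:R), +oo[%classic) (phi z)) _ (fun z => `|h z|)).
  - move=> n; have m1 : measurable_fun setT (fun z => \1_(`](- n%:R), +oo[%classic) (phi z) : R).
      by apply: m_indic => //; exact: measurable_itv.
    by meas.
  - exact: mh.
  - exact: integ_norm.
  - apply: aeW => z; rewrite -[X in _ --> X]mulr1; apply: cvgM; first exact: cvg_cst.
    apply: cvg_near_cst; near=> n; rewrite indicE mem_set//= in_itv/= andbT.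
    rewrite ltrNl; apply: le_lt_trans (ler_norm _) _.
    by near: n; exact: nbhs_infty_gtr.
  - by move=> n z; rewrite normrM ler_piMr// indicE; case: (_ \in _); rewrite ?normr1 ?normr0.
rewrite (_ : (fun n => _) = (fun=> 0)); last by apply/funext => n; exact: hr.
by move=> /cvg_unique; apply; [exact: Rhausdorff|exact: cvg_cst].
Unshelve. all: by end_near. Qed.

Lemma null_ae h : integ (mu2 R) h ->
  (forall A : set (plane R), measurable A -> \int[mu2 R]_z (h z * \1_A z) = 0) ->
  {ae mu2 R, forall z, h z = 0}.
Proof.
move=> ih h0; have mh := integ_meas ih.
pose P := [set z : plane R | 0 <= h z].
have mP : measurable P.
  have -> : P = h @^-1` `[0, +oo[%classic.
    by apply/seteqP; split => z; rewrite /P/= in_itv/= andbT.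
  by rewrite -[X in measurable X]setTI; exact: mh.
have hp : \int[mu2 R]_z `|h z| = 0.
  transitivity (\int[mu2 R]_z (h z * \1_P z - h z * \1_(~` P) z)).
    apply: RI_ext => z; rewrite -mulrBr !indicE in_setC.
    have [zP|zP] := boolP (z \in P).
      by rewrite subr0 mulr1 ger0_norm//; rewrite inE in zP.
    rewrite sub0r mulrN1 ltr0_norm//; rewrite notin_setE/= in zP.
    by rewrite ltNge; apply/negP.
  have im A : measurable A -> integ (mu2 R) (fun z => h z * \1_A z).
    move=> mA; have m1 : measurable_fun setT (\1_A : plane R -> R) by exact: measurable_indic.
    apply: (@integ_le _ _ _ (mu2 R) _ (fun z => `|h z|)); first by meas.
    - by move=> z; rewrite normrM ler_piMr// indicE; case: (_ \in _); rewrite ?normr1 ?normr0.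
    - exact: integ_norm.
  have mC : measurable (~` P) by exact: measurableC.
  by rewrite RIB; [rewrite !h0// subrr|exact: im|exact: im].
have H : (\int[mu2 R]_z `|(h z)%:E| = 0)%E.
  by have := EFin_RI (integ_norm ih); rewrite hp => /esym.
have mE : measurable_fun setT (EFin \o h) by exact/measurable_EFinP.
have K := (ae_eq_integral_abs (mu2 R) measurableT mE).1 H.
by apply: filterS K => z /= /(_ I) [].
Qed.

(** Products of sigmoid ramps converge to indicators of quadrants, which generate
    the Borel sets of the plane; the positive bump only makes them Schwartz. *)
Lemma schwartz_separates (G : R * R -> R) :
  measurable_fun [set: plane R] G ->
  (forall psi, schwartz psi -> integ (mu2 R) (fun z => G z * psi z) /\
     \int[mu2 R]_z (G z * psi z) = 0) ->
  {ae mu2 R, forall z, G z = 0}.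
Proof.
move=> mG hG.
pose B (z : plane R) := bump z.1 * bump z.2.
pose H (z : plane R) := G z * B z.
have B0 z : 0 < B z by rewrite mulr_gt0// bump_gt0.
have iH : integ (mu2 R) H by have [] := hG _ (sigmoidal_schwartz (sigmoidal_bump R)).
suff H0 : {ae mu2 R, forall z, H z = 0}.
  apply: filterS H0 => z /eqP; rewrite /H mulf_eq0 => /orP[/eqP//|].
  by rewrite gt_eqF.
have mH := integ_meas iH.
have m1 (A : set R) (f : plane R -> R) : measurable A -> measurable_fun setT f ->
    measurable_fun setT (fun z : plane R => \1_A (f z) : R).
  exact: m_indic.
have n1 (A : set R) (x : R) : `|\1_A x : R| <= 1.
  by rewrite indicE; case: (_ \in _); rewrite ?normr1 ?normr0.
have mray a : measurable (`]a, +oo[%classic : set R) by exact: measurable_itv.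
have mf1 : measurable_fun setT (fun z : plane R => z.1) by exact: measurable_fst.
have mf2 : measurable_fun setT (fun z : plane R => z.2) by exact: measurable_snd.
have quad a b : \int[mu2 R]_z (H z * \1_(`]b, +oo[%classic) z.2 * \1_(`]a, +oo[%classic) z.1) = 0.
  have E n : \int[mu2 R]_z (H z * ramp b n z.2 * ramp a n z.1) = 0.
    have sg := sigmoidal_x (n%:R ^+ 2) (- (n%:R ^+ 2 * a) - n%:R)
      (sigmoidal_y (n%:R ^+ 2) (- (n%:R ^+ 2 * b) - n%:R) (sigmoidal_bump R)).
    have [_ <-] := hG _ (sigmoidal_schwartz sg).
    by apply: RI_ext => z; rewrite /H /B /ramp; ring.
  have : (\int[mu2 R]_z (H z * ramp b n z.2 * ramp a n z.1)) @[n --> \oo] -->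
      \int[mu2 R]_z (H z * \1_(`]b, +oo[%classic) z.2 * \1_(`]a, +oo[%classic) z.1).
    apply: (@RI_dominated _ _ _ (mu2 R) (fun n z => H z * ramp b n z.2 * ramp a n z.1) _ (fun z => `|H z|)).
    - by move=> n; rewrite /ramp /sigm; meas.
    - have k1 := m1 _ _ (mray a) mf1; have k2 := m1 _ _ (mray b) mf2.
      by apply: mM => //; apply: mM.
    - exact: integ_norm.
    - apply: aeW => z; apply: cvgM; last exact: ramp_cvg.
      by apply: cvgM; [exact: cvg_cst|exact: ramp_cvg].
    - move=> n z; rewrite !normrM -mulrA ler_piMr// mulr_ile1//; exact: norm_sigm_le1.
  rewrite (funext E) => /cvg_unique; apply; [exact: Rhausdorff|exact: cvg_cst].
have iHi A (f : plane R -> R) h : measurable A -> measurable_fun setT f ->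
    integ (mu2 R) h -> integ (mu2 R) (fun z => h z * \1_A (f z)).
  move=> mA mf ih; have mh := integ_meas ih; have k1 := m1 _ _ mA mf.
  apply: (@integ_le _ _ _ (mu2 R) _ (fun z => `|h z|)); first by apply: mM.
  - by move=> z; rewrite normrM ler_piMr.
  - exact: integ_norm.
have step1 (A : set R) b : measurable A ->
    \int[mu2 R]_z (H z * \1_(`]b, +oo[%classic) z.2 * \1_A z.1) = 0.
  move=> mA; apply: (@null_rays (fun z => z.1)) => //; first exact: iHi.
have step2 (A B' : set R) : measurable A -> measurable B' ->
    \int[mu2 R]_z (H z * \1_A z.1 * \1_B' z.2) = 0.
  move=> mA mB; apply: (@null_rays (fun z => z.2)) => //; first exact: iHi.
  by move=> b; rewrite -[RHS](step1 A b mA); apply: RI_ext => z; rewrite mulrAC.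
apply: null_ae => //.
apply: (@null_generated _ (plane R) id H [set C | exists2 A, measurable A & exists2 B, measurable B & A `*` B = C]) => //.
- move=> _ _ [A1 mA1 [B1 mB1 <-]] [A2 mA2 [B2 mB2 <-]].
  exists (A1 `&` A2); first exact: measurableI.
  exists (B1 `&` B2); first exact: measurableI.
  by rewrite setXI.
- by rewrite measurable_prod_measurableType.
- move=> _ [A mA [B' mB <-]]; rewrite -[RHS](step2 A B' mA mB).
  apply: RI_ext => z; rewrite -mulrA; congr (_ * _).
  by rewrite !indicE in_setX -natrM mulnb.
- rewrite -[RHS](step2 setT setT measurableT measurableT).
  by apply: RI_ext => z; rewrite !indicT !mulr1.
Qed.

End Uniqueness.

(** * Tempered distributions with an integrable Fourier transform *)

Section Distributions.
Variable R : realType.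
Implicit Types (psi : R * R -> R) (v w : functional R) (h a b : plane R -> R).

Lemma fourier_fun_Re psi zeta : complex.Re (fourier_fun psi zeta) = osc 0 psi zeta.
Proof.
apply: RI_ext => z /=.
by rewrite mul0r subr0 cosN addr0.
Qed.

Lemma fourier_fun_Im psi zeta : complex.Im (fourier_fun psi zeta) = osc (pi / 2) psi zeta.
Proof.
apply: RI_ext => z /=.
by rewrite mul0r addr0 sinN cosDpihalf.
Qed.

(** [a + i b] is the Fourier transform of [v], with the real and the imaginary parts
    of the test functions written as oscillatory integrals. *)
Definition fourier_pair v a b : Prop :=
  [/\ tempered v, measurable_fun setT a, measurable_fun setT b
    & forall psi, schwartz psi ->
      [/\ integ (mu2 R) (fun z => a z * psi z), integ (mu2 R) (fun z => b z * psi z),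
          v (osc 0 psi) = \int[mu2 R]_z (a z * psi z)
        & v (osc (pi / 2) psi) = \int[mu2 R]_z (b z * psi z)]].

Lemma has_fourierE v (F : R * R -> R[i]) : has_fourier v F <->
  fourier_pair v (fun z => complex.Re (F z)) (fun z => complex.Im (F z)).
Proof.
have E1 psi : (fun z => complex.Re (F z * (psi z)%:C)%C) = (fun z => complex.Re (F z) * psi z).
  by apply/funext => z; case: (F z) => u t /=; rewrite mulr0 subr0.
have E2 psi : (fun z => complex.Im (F z * (psi z)%:C)%C) = (fun z => complex.Im (F z) * psi z).
  by apply/funext => z; case: (F z) => u t /=; rewrite mulr0 add0r.
have E3 psi : (fun z => complex.Re (fourier_fun psi z)) = osc 0 psi.
  by apply/funext => z; exact: fourier_fun_Re.
have E4 psi : (fun z => complex.Im (fourier_fun psi z)) = osc (pi / 2) psi.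
  by apply/funext => z; exact: fourier_fun_Im.
split=> [[tv ma mb H]|[tv ma mb H]]; split => // psi s.
  have [[i1 i2]] := H psi s; rewrite /Cintegral E3 E4 => -[V1 V2].
  have G1 := congr1 (fun f => integ (mu2 R) f) (E1 psi).
  have G2 := congr1 (fun f => integ (mu2 R) f) (E2 psi).
  split.
  - by rewrite -G1.
  - by rewrite -G2.
  - by rewrite V1; apply: RI_ext => z; rewrite -[LHS]/((fun z => complex.Re (F z * (psi z)%:C)%C) z) E1.
  - by rewrite V2; apply: RI_ext => z; rewrite -[LHS]/((fun z => complex.Im (F z * (psi z)%:C)%C) z) E2.
have [i1 i2 V1 V2] := H psi s.
split; first by split; [rewrite -E1 in i1|rewrite -E2 in i2].
rewrite E3 E4 V1 V2 /Cintegral; congr Complex.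
- by apply: RI_ext => z; rewrite -[RHS]/((fun z => complex.Re (F z * (psi z)%:C)%C) z) E1.
- by apply: RI_ext => z; rewrite -[RHS]/((fun z => complex.Im (F z * (psi z)%:C)%C) z) E2.
Qed.

(** [psi] ranges over all Schwartz functions on the frequency side. *)
Lemma fourier_pair_unique v a b a' b' : fourier_pair v a b -> fourier_pair v a' b' ->
  {ae mu2 R, forall z, a z = a' z /\ b z = b' z}.
Proof.
move=> [_ ma mb H] [_ ma' mb' H'].
have A : {ae mu2 R, forall z, a z - a' z = 0}.
  apply: schwartz_separates; first by meas.
  move=> psi s; have [i1 _ V1 _] := H _ s; have [i1' _ V1' _] := H' _ s.
  have E : (fun z => (a z - a' z) * psi z) = (fun z => a z * psi z - a' z * psi z).
    by apply/funext => z; rewrite mulrBl.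
  rewrite E; split; first exact: integB.
  by rewrite RIB// -V1 -V1' subrr.
have B : {ae mu2 R, forall z, b z - b' z = 0}.
  apply: schwartz_separates; first by meas.
  move=> psi s; have [_ i1 _ V1] := H _ s; have [_ i1' _ V1'] := H' _ s.
  have E : (fun z => (b z - b' z) * psi z) = (fun z => b z * psi z - b' z * psi z).
    by apply/funext => z; rewrite mulrBl.
  rewrite E; split; first exact: integB.
  by rewrite RIB// -V1 -V1' subrr.
by apply: filterS2 A B => z /subr0_eq -> /subr0_eq ->.
Qed.

Lemma patch_idem (T : Type) (f : T -> R) (A : set T) : (f \_ A) \_ A = f \_ A.
Proof.
by apply/funext => x; rewrite [LHS]patchE; case: ifPn => // xA; rewrite patchE (negPf xA).
Qed.

Lemma tempered_lc c v w : tempered v -> tempered w -> tempered (c *: v + w : functional R).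
Proof.
move=> [v0 vl [C [k vb]]] [w0 wl [D [j wb]]]; split.
- apply/funext => psi; rewrite patchE; case: ifPn => // sp.
  rewrite -[RHS]/(c * v psi + w psi) -v0 -w0 !patchE (negPf sp).
  by rewrite mulr0 addr0.
- move=> d psi1 psi2 s1 s2; rewrite -[LHS]/(c * v _ + w _) vl// wl//.
  by rewrite -[RHS]/(d * (c * v psi1 + w psi1) + (c * v psi2 + w psi2)); ring.
- exists (`|c| * `|C| + `|D|), (maxn k j) => psi M s H.
  have M0 : 0 <= M.
    by apply: le_trans (H 0%N 0%N (0, 0) _) => //; rewrite mulr_ge0// exprn_ge0// ltW// (bracket_gt0 (0, 0)).
  have mono m n z : (m <= n)%N -> (1 + z.1 ^+ 2 + z.2 ^+ 2 : R) ^+ m <= (1 + z.1 ^+ 2 + z.2 ^+ 2) ^+ n.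
    by move=> mn; rewrite ler_weXn2l// (bracket_ge1 z).
  have hv : `|v psi| <= C * M.
    apply: vb => // p q z pq; apply: le_trans (H p q z _); last exact: leq_trans pq (leq_maxl _ _).
    by rewrite ler_wpM2r// mono// leq_maxl.
  have hw : `|w psi| <= D * M.
    apply: wb => // p q z pq; apply: le_trans (H p q z _); last exact: leq_trans pq (leq_maxr _ _).
    by rewrite ler_wpM2r// mono// leq_maxr.
  rewrite -[(c *: v + w) psi]/(c * v psi + w psi) mulrDl (le_trans (ler_normD _ _))//.
  rewrite normrM -mulrA; apply: lerD.
    rewrite ler_wpM2l//; apply: le_trans hv _; rewrite ler_wpM2r// ler_norm//.
  by apply: le_trans hw _; rewrite ler_wpM2r// ler_norm.
Qed.

Lemma fourier_pair_lc c v w a b a' b' : fourier_pair v a b -> fourier_pair w a' b' ->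
  fourier_pair (c *: v + w : functional R) (fun z => c * a z + a' z) (fun z => c * b z + b' z).
Proof.
move=> [tv ma mb H] [tw ma' mb' H']; split; [exact: tempered_lc|by meas|by meas|].
move=> psi s; have [i1 i2 V1 V2] := H _ s; have [j1 j2 W1 W2] := H' _ s.
have E (f g : plane R -> R) : (fun z => (c * f z + g z) * psi z) = (fun z => c * (f z * psi z) + g z * psi z).
  by apply/funext => z; rewrite mulrDl mulrA.
rewrite !E; split.
- by apply: integD => //; exact: integZ.
- by apply: integD => //; exact: integZ.
- rewrite RID//; last exact: integZ.
  by rewrite RIZ// -V1 -W1.
- rewrite RID//; last exact: integZ.
  by rewrite RIZ// -V2 -W2.
Qed.

Lemma fourier_pair_dx v a b : fourier_pair v a b ->
  fourier_pair (dist_dx v) (fun z => - (z.1 * b z)) (fun z => z.1 * a z).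
Proof.
move=> [[v0 vl [C [k vb]]] ma mb H].
have E psi : schwartz psi -> dist_dx v psi = - v (d_x psi).
  by move=> s; rewrite /dist_dx patchE mem_set.
split.
- split.
  + exact: patch_idem.
  + move=> c psi1 psi2 s1 s2.
    have D : d_x (c *: psi1 + psi2) = c *: d_x psi1 + d_x psi2.
      by apply/funext => z; rewrite -[RHS]/(c * d_x psi1 z + d_x psi2 z) -(@d_x_lc _ psi1 psi2);
        [|exact: (schwartz_diff 0 0)|exact: (schwartz_diff 0 0)].
    rewrite !E//; last exact: schwartz_lc.
    by rewrite D vl; [ring|exact: schwartz_d_x|exact: schwartz_d_x].
  + exists C, k.+1 => psi M s HM; rewrite E// normrN; apply: vb; first exact: schwartz_d_x.
    move=> p q z pq; have := HM p.+1 q z; rewrite addSn ltnS => /(_ pq).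
    rewrite {1}/partial iterSr; apply: le_trans; rewrite ler_wpM2r// ler_weXn2l//.
    exact: (bracket_ge1 z).
- by meas.
- by meas.
- move=> psi s; have s1 := schwartz_fst s; have [i1 i2 V1 V2] := H _ s1.
  have Ea : (fun z => z.1 * a z * psi z) = (fun z => a z * (z.1 * psi z)).
    by apply/funext => z; ring.
  have Eb : (fun z => - (z.1 * b z) * psi z) = (fun z => - (b z * (z.1 * psi z))).
    by apply/funext => z; ring.
  rewrite Ea Eb; split => //; first exact: integN.
  + rewrite E; last exact: schwartz_osc.
    rewrite RIN// -V2; congr (- v _); apply/funext => z.
    by have [_ -> _] := osc_diff 0 z s; rewrite add0r.
  + rewrite E; last exact: schwartz_osc.
    have D : d_x (osc (pi / 2) psi) = (-1) *: osc 0 (fun z => z.1 * psi z) + (fun=> 0).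
      apply/funext => z; have [_ -> _] := osc_diff (pi / 2) z s.
      rewrite -[RHS]/((-1) * osc 0 (fun z => z.1 * psi z) z + 0) addr0 mulN1r -RIN; last first.
        by apply: integ_cosM (m_osc_phase _ _); exact: schwartz_integ.
      by apply: RI_ext => u; rewrite addrA !cosDpihalf sinDpihalf addr0 mulrN.
    rewrite D vl; [|exact: schwartz_osc|exact: schwartz0].
    have v00 : v (fun=> 0) = 0.
      have := vl 1 _ _ (@schwartz0 R) (@schwartz0 R); rewrite scale1r mul1r.
      have -> : ((fun=> 0) + (fun=> 0) : R * R -> R) = (fun=> 0).
        by apply/funext => u; rewrite -[LHS]/(0 + 0) addr0.
      by lra.
    by rewrite v00 addr0 mulN1r opprK V1.
Qed.

(** The real and the imaginary part of the conjugate symmetric function encoded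
    by [h]. *)

Definition hev h : plane R -> R := fun z => (h z + h (popp z)) / 2.
Definition hod h : plane R -> R := fun z => (h (popp z) - h z) / 2.

(** The constant of Hartley inversion, equal to [1 / (4 pi^2)]. *)
Definition hkap : R := (4 * (cauchy_mass R * cauchy_mass R))^-1.

Lemma hkap_gt0 : 0 < hkap.
Proof. by rewrite invr_gt0 mulr_gt0// mulr_gt0// cauchy_mass_gt0. Qed.

Definition hfun h : R * R -> R := fun z => hkap * hart h z.

Definition hdist h : functional R :=
  (fun psi => \int[mu2 R]_z (hfun h z * psi z)) \_ (@schwartz R).

Lemma hart_bounded h zeta : integ (mu2 R) h ->
  `|hart h zeta| <= 2 * \int[mu2 R]_z `|h z|.
Proof.
move=> ih; have mh := integ_meas ih.
have mc : measurable_fun setT (fun z : plane R => cas (pdot z zeta)) by apply: m_cas; meas.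
rewrite -RIZ; last exact: integ_norm.
apply: RI_norm; [by meas| |by apply: integZ; exact: integ_norm].
by move=> z; rewrite normrM mulrC ler_wpM2r// cas_le2.
Qed.

Lemma m_hart h : integ (mu2 R) h -> measurable_fun [set: plane R] (hart h).
Proof.
move=> ih; have mh := integ_meas ih.
apply: (@measurable_paramr _ _ (plane R) (plane R) R (leb2 R) (fun zeta z => h z * cas (pdot z zeta))).
have mc : measurable_fun setT (fun p : plane R * plane R => cas (pdot p.2 p.1)).
  by apply: m_cas; meas.
by meas.
Qed.

Section Hdist.
Variable h : plane R -> R.
Hypothesis ih : integ (mu2 R) h.
Let mh := integ_meas ih.

Lemma hfun_bounded : exists C, forall z, `|hfun h z| <= C.
Proof.
exists (hkap * (2 * \int[mu2 R]_z `|h z|)) => z.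
by rewrite normrM gtr0_norm ?hkap_gt0// ler_pM2l ?hkap_gt0// hart_bounded.
Qed.

Lemma m_hfun : measurable_fun [set: plane R] (hfun h).
Proof. by have mk := m_hart ih; rewrite /hfun; meas. Qed.

Lemma integ_hfunM psi : schwartz psi -> integ (mu2 R) (fun z => hfun h z * psi z).
Proof.
move=> s; have [C hC] := hfun_bounded.
by apply: (@integ_mulb _ _ _ (mu2 R) _ _ C) => //; [exact: m_hfun|exact: schwartz_integ].
Qed.

Lemma hdistE psi : schwartz psi -> hdist h psi = \int[mu2 R]_z (hfun h z * psi z).
Proof. by move=> s; rewrite /hdist patchE mem_set. Qed.

Lemma hdist_pairing psi : schwartz psi ->
  hdist h psi = hkap * \int[mu2 R]_z (h z * hart psi z).
Proof.
move=> s; rewrite hdistE//; have ip := schwartz_integ s; have mp := schwartz_measurable s.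
pose f (z zeta : plane R) := h zeta * cas (pdot zeta z) * psi z.
transitivity (hkap * \int[mu2 R]_z \int[mu2 R]_zeta f z zeta).
  rewrite -RIZ.
    apply: RI_ext => z; rewrite /hfun -mulrA; congr (_ * _); rewrite -RIZr//.
    by apply: integ_casM => //; meas.
  apply: (@integ_ext _ _ _ (mu2 R) (fun z => hart h z * psi z)).
    by move=> z; rewrite /f RIZr//; apply: integ_casM => //; meas.
  apply: (@integ_mulb _ _ _ (mu2 R) _ _ (2 * \int[mu2 R]_z `|h z|)) => //; first exact: m_hart.
  by move=> z; exact: hart_bounded.
congr (_ * _).
rewrite (@RI_swap_dom _ _ (plane R) (plane R) R (leb2 R) (leb2 R) f (fun z => 2 * `|psi z|) (fun z => `|h z|)).
- apply: RI_ext => zeta; rewrite /hart -RIZ.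
    by apply: RI_ext => z; rewrite /f -mulrA [pdot z zeta](_ : _ = pdot zeta z) ?[cas _ * _]mulrC// /pdot; ring.
  by apply: integ_casM => //; meas.
- have mc : measurable_fun setT (fun p : plane R * plane R => cas (pdot p.2 p.1)).
    by apply: m_cas; meas.
  by rewrite /f; meas.
- by apply: integZ; exact: integ_norm.
- exact: integ_norm.
- move=> z zeta; rewrite /f !normrM; have := cas_le2 (pdot zeta z).
  rewrite (_ : _ * _ * _ = `|cas (pdot zeta z)| * (`|psi z| * `|h zeta|)); last by ring.
  by move=> c2; rewrite -[leRHS]mulrA ler_wpM2r// mulr_ge0.
Qed.

(** Parseval: exchanging the integrals leaves the inverse of a Hartley
    transform. *)
Lemma hdist_hart psi : schwartz psi ->
  hdist h (hart psi) = \int[mu2 R]_z (h z * psi z).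
Proof.
move=> s; rewrite hdist_pairing; last exact: schwartz_hart.
have [C [C0 pC]] := schwartz_wt s; have mp := schwartz_measurable s.
have ihp : integ (mu2 R) (fun z => h z * psi z).
  apply: (@integ_ext _ _ _ (mu2 R) (fun z => psi z * h z)); first by move=> z; rewrite mulrC.
  apply: (@integ_mulb _ _ _ (mu2 R) _ _ C) => // z.
  by apply: le_trans (pC _) _; rewrite ler_piMr// wt_le1.
rewrite -RIZ.
  apply: RI_ext => z; rewrite {1}/hart.
  rewrite (_ : (fun u => _) = (fun u => hart psi u * cas (pdot z u))); last first.
    by apply/funext => u; congr (_ * cas _); rewrite /pdot; ring.
  have K : hkap * (4 * (cauchy_mass R * cauchy_mass R)) = 1.
    by rewrite /hkap mulVf// mulf_neq0// mulf_neq0// gt_eqF// cauchy_mass_gt0.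
  rewrite (hartK z s).
  transitivity (hkap * (4 * (cauchy_mass R * cauchy_mass R)) * (h z * psi z)); first by ring.
  by rewrite K mul1r.
have sh := schwartz_hart (schwartz_hart s).
have [D [D0 pD]] := schwartz_wt sh; have mq := schwartz_measurable sh.
apply: (@integ_ext _ _ _ (mu2 R) (fun z => hart (hart psi) z * h z)); first by move=> z; rewrite mulrC.
apply: (@integ_mulb _ _ _ (mu2 R) _ _ D) => // z.
by apply: le_trans (pD _) _; rewrite ler_piMr// wt_le1.
Qed.

Lemma tempered_hdist : tempered (hdist h).
Proof.
have [C hC] := hfun_bounded.
have C0 : 0 <= C by apply: le_trans (hC (0, 0)).
split.
- exact: patch_idem.
- move=> c psi1 psi2 s1 s2; rewrite !hdistE//; last exact: schwartz_lc.
  rewrite -RIZ; last exact: integ_hfunM.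
  rewrite -RID; [|by apply: integZ; exact: integ_hfunM|exact: integ_hfunM].
  by apply: RI_ext => z; rewrite -[(c *: psi1 + psi2) z]/(c * psi1 z + psi2 z); ring.
- exists (C * wt_mass R), 2%N => psi M s HM; rewrite hdistE//.
  have mp := schwartz_measurable s; have mg := m_hfun.
  have -> : C * wt_mass R * M = \int[mu2 R]_z ((C * M) * wt z).
    by rewrite RIZ ?/wt_mass; [ring|exact: integ_wt].
  apply: RI_norm; [by meas| |by apply: integZ; exact: integ_wt].
  move=> z; rewrite normrM -mulrA ler_pM//.
  have := HM 0%N 0%N z isT; rewrite /partial /= => h0.
  by rewrite /wt ler_pdivlMr ?exprn_gt0 ?bracket_gt0// mulrC.
Qed.

Lemma is_function_hdist : is_function (hdist h) (hfun h).
Proof.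
split; [exact: tempered_hdist|exact: m_hfun|].
by move=> psi s; split; [exact: integ_hfunM|exact: hdistE].
Qed.

End Hdist.

Lemma diff_popp (f : R * R -> R) z : (forall u, differentiable f u) ->
  [/\ differentiable (fun z => f (popp z)) z,
    d_x (fun z => f (popp z)) z = - d_x f (popp z)
    & d_y (fun z => f (popp z)) z = - d_y f (popp z)].
Proof.
move=> df; have E : (fun z => f (popp z)) = f \o -%R by apply/funext => -[x y].
have dn : differentiable (fun z => f (popp z)) z.
  rewrite E; apply: differentiable_comp; last exact: df.
  by apply: differentiableN; exact: ex_diff.
split => //; case: z dn => x y dn.
- have [_ <-] := line_derive_x dn.
  have no : is_derive x 1 (fun t : R => - t) (-1) by exact: is_deriveNid.
  have := is_derive1_comp (f := fun t => f (t, - y)) (line_derive_x (df (- x, - y))) no.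
  by move=> [_]; rewrite mulrN1.
- have [_ <-] := line_derive_y dn.
  have no : is_derive y 1 (fun t : R => - t) (-1) by exact: is_deriveNid.
  have := is_derive1_comp (f := fun t => f (- x, t)) (line_derive_y (df (- x, - y))) no.
  by move=> [_]; rewrite mulrN1.
Qed.

Lemma schwartz_popp psi : schwartz psi -> schwartz (fun z => psi (popp z)).
Proof.
move=> s.
pose H (c : R) (a b : nat) := fun z : R * R => c * partial a b psi (popp z).
have dp (a b : nat) z : differentiable (partial a b psi) z by exact: schwartz_diff.
have dH (a b : nat) z : [/\ differentiable (fun z => partial a b psi (popp z)) z,
    d_x (fun z => partial a b psi (popp z)) z = - d_x (partial a b psi) (popp z)
    & d_y (fun z => partial a b psi (popp z)) z = - d_y (partial a b psi) (popp z)].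
  by apply: diff_popp.
have d0 z : [/\ differentiable (fun=> 0 : R) z, d_x (fun=> 0 : R) z = 0 & d_y (fun=> 0 : R) z = 0].
  split; first exact: differentiable_cst.
  - exact: (derive_cst (0 : R)).
  - exact: (derive_cst (0 : R)).
have H0 (c : R) (a b : nat) : H c a b = fun z => c * partial a b psi (popp z) + 0.
  by apply/funext => z; rewrite addr0.
apply: (@schwartz_of_classes _ [set f | exists (c : R) (a : nat), f = H c a 0%N]
  [set f | exists (c : R) (a b : nat), f = H c a b]).
- by move=> f [c [a ->]]; exists c, a, 0%N.
- move=> f [c [a ->]]; exists (- c), a.+1; apply/funext => z.
  have [h1 h2 _] := dH a 0%N z; have [g1 g2 _] := d0 z.
  by rewrite H0 (@d_x_lc _ _ (fun=> 0))// h2 g2 addr0 /H mulrN mulNr.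
- move=> f [c [a [b ->]]]; exists (- c), a, b.+1; apply/funext => z.
  have [h1 _ h2] := dH a b z; have [g1 _ g2] := d0 z.
  by rewrite H0 (@d_y_lc _ _ (fun=> 0))// h2 g2 addr0 /H mulrN mulNr.
- move=> f [c [a [b ->]]]; rewrite H0; split.
    by move=> z; have [h1 _ _] := dH a b z; have [g1 _ _] := d0 z; apply: (@differentiable_lc _ _ (fun=> 0)).
  apply: (@rapid_lc _ c _ (fun=> 0)); last by move=> k; exists 0 => z; rewrite normr0 mulr0.
  move=> k; have [C hC] := schwartz_rapid a b s k; exists C => z.
  by have := hC (popp z); rewrite /popp/= !sqrrN.
- by exists 1, 0%N; apply/funext => z; rewrite /H mul1r.
Qed.

(** The even part of [psi] has the real part of the Fourier transform of [psi]
    as its Hartley transform, the odd part the imaginary one. *)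
Lemma osc0_hart psi : schwartz psi ->
  osc 0 psi = hart (fun z => 2^-1 * psi z + 2^-1 * psi (popp z)).
Proof.
move=> s; have i1 := schwartz_integ s; have i2 := schwartz_integ (schwartz_popp s).
apply/funext => zeta; have mz : measurable_fun setT (fun z : plane R => pdot z zeta) by meas.
have c1 := integ_casM i1 mz.
have mz' : measurable_fun setT (fun z : plane R => - pdot z zeta) by meas.
have c2 := integ_casM i1 mz'; have c3 := integ_casM i2 mz.
transitivity (2^-1 * \int[mu2 R]_z (psi z * cas (pdot z zeta)) +
   2^-1 * \int[mu2 R]_z (psi (popp z) * cas (pdot z zeta))); last first.
  rewrite -!RIZ// -RID; try exact: integZ.
  by apply: RI_ext => z; ring.
have -> : \int[mu2 R]_z (psi (popp z) * cas (pdot z zeta)) =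
    \int[mu2 R]_z (psi z * cas (- pdot z zeta)).
  rewrite -(RI_popp c2); apply: RI_ext => z; congr (_ * cas _).
  by rewrite /pdot /popp/=; ring.
rewrite -!RIZ// -RID; try exact: integZ.
by apply: RI_ext => z; rewrite addr0 /cas cosN sinN; field.
Qed.

Lemma osc1_hart psi : schwartz psi ->
  osc (pi / 2) psi = hart (fun z => 2^-1 * psi (popp z) + (- 2^-1) * psi z).
Proof.
move=> s; have i1 := schwartz_integ s; have i2 := schwartz_integ (schwartz_popp s).
apply/funext => zeta; have mz : measurable_fun setT (fun z : plane R => pdot z zeta) by meas.
have c1 := integ_casM i1 mz.
have mz' : measurable_fun setT (fun z : plane R => - pdot z zeta) by meas.
have c2 := integ_casM i1 mz'; have c3 := integ_casM i2 mz.
transitivity (2^-1 * \int[mu2 R]_z (psi (popp z) * cas (pdot z zeta)) +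
   (- 2^-1) * \int[mu2 R]_z (psi z * cas (pdot z zeta))); last first.
  rewrite -!RIZ// -RID; try exact: integZ.
  by apply: RI_ext => z; ring.
have -> : \int[mu2 R]_z (psi (popp z) * cas (pdot z zeta)) =
    \int[mu2 R]_z (psi z * cas (- pdot z zeta)).
  rewrite -(RI_popp c2); apply: RI_ext => z; congr (_ * cas _).
  by rewrite /pdot /popp/=; ring.
rewrite -!RIZ// -RID; try exact: integZ.
by apply: RI_ext => z; rewrite cosDpihalf /cas cosN sinN; field.
Qed.

Lemma integ_Mschwartz h psi : integ (mu2 R) h -> schwartz psi ->
  integ (mu2 R) (fun z => h z * psi z).
Proof.
move=> ih s; have [C [C0 pC]] := schwartz_wt s; have mp := schwartz_measurable s.
apply: (@integ_ext _ _ _ (mu2 R) (fun z => psi z * h z)); first by move=> z; rewrite mulrC.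
apply: (@integ_mulb _ _ _ (mu2 R) _ _ C) => // z.
by apply: le_trans (pC _) _; rewrite ler_piMr// wt_le1.
Qed.

Lemma fourier_hdist h : integ (mu2 R) h -> fourier_pair (hdist h) (hev h) (hod h).
Proof.
move=> ih; have mh := integ_meas ih; have ih' := integ_popp ih; have mh' := integ_meas ih'.
split; [exact: tempered_hdist|by rewrite /hev; meas|by rewrite /hod; meas|].
move=> psi s; have s' := schwartz_popp s.
have i1 := integ_Mschwartz ih s; have i2 := integ_Mschwartz ih' s.
have i3 := integ_Mschwartz ih s'.
have E : \int[mu2 R]_z (h z * psi (popp z)) = \int[mu2 R]_z (h (popp z) * psi z).
  by rewrite -(RI_popp i3); apply: RI_ext => z; rewrite poppK.
have Ee : (fun z => hev h z * psi z) = (fun z => 2^-1 * (h z * psi z) + 2^-1 * (h (popp z) * psi z)).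
  by apply/funext => z; rewrite /hev; field.
have Eo : (fun z => hod h z * psi z) = (fun z => 2^-1 * (h (popp z) * psi z) + (- 2^-1) * (h z * psi z)).
  by apply/funext => z; rewrite /hod; field.
rewrite Ee Eo; split.
- by apply: integD; exact: integZ.
- by apply: integD; exact: integZ.
- rewrite osc0_hart// hdist_hart//; last by apply: schwartz_lc => //; exact: schwartz_scale.
  rewrite RID; [|exact: integZ|exact: integZ].
  rewrite !RIZ// -E -!RIZ// -RID; [|exact: integZ|exact: integZ].
  by apply: RI_ext => z; ring.
- rewrite osc1_hart// hdist_hart//; last by apply: schwartz_lc => //; exact: schwartz_scale.
  rewrite RID; [|exact: integZ|exact: integZ].
  rewrite !RIZ// -E -!RIZ// -RID; [|exact: integZ|exact: integZ].
  by apply: RI_ext => z; ring.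
Qed.

End Distributions.

(** * The nonlinearity and the propagator on the Hartley side *)

Section Square.
Variable R : realType.
Implicit Types (h k : plane R -> R) (z zeta a b : plane R).

(** The class of Hartley transforms in which the equation is solved. *)
Definition bounded_by (M : R) h : Prop :=
  measurable_fun setT h /\ forall z, `|h z| <= M * wt z.

Lemma bounded_by_integ M h : bounded_by M h -> integ (mu2 R) h.
Proof.
move=> [mh hM]; apply: (@integ_le _ _ _ (mu2 R) _ (fun z => M * wt z)) => //.
by apply: integZ; exact: integ_wt.
Qed.

Lemma bounded_by_ge0 M h : bounded_by M h -> 0 <= M.
Proof.
by move=> [_ /(_ (0, 0))] /(le_trans (normr_ge0 _)); rewrite pmulr_lge0// wt_gt0.
Qed.

(** From [cas a cas b] in terms of [cas (+- a +- b)]. *)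
Definition cas_prod h a b : R :=
  h a * h (popp b) + h (popp a) * h b + h a * h b - h (popp a) * h (popp b).

(** The product of two functions corresponds to this twisted convolution of
    their Hartley transforms, which is the convolution of their Fourier
    transforms. *)
Definition hsq h zeta : R := hkap R / 2 * \int[mu2 R]_a cas_prod h a (psub zeta a).

Lemma psub_popp z a : psub (popp z) (popp a) = popp (psub z a).
Proof. by rewrite /psub /popp/=; congr pair; rewrite opprB opprK addrC. Qed.

Lemma m_cas_prod h zeta : measurable_fun setT h ->
  measurable_fun setT (fun a => cas_prod h a (psub zeta a)).
Proof. by move=> mh; rewrite /cas_prod; meas. Qed.

Lemma cas_prod_bound M h a b : bounded_by M h ->
  `|cas_prod h a b| <= 4 * M ^+ 2 * (wt a * wt b).
Proof.
move=> bM; have M0 := bounded_by_ge0 bM; case: bM => mh hM.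
have H x y : `|h x * h y| <= M ^+ 2 * (wt x * wt y).
  rewrite normrM (_ : M ^+ 2 * _ = (M * wt x) * (M * wt y)); last by ring.
  by rewrite ler_pM.
have h1 := H a (popp b); have h2 := H (popp a) b; have h3 := H a b.
have h4 := H (popp a) (popp b); rewrite !wt_popp in h1 h2 h3 h4.
rewrite /cas_prod; apply: le_trans (ler_normB _ _) _.
apply: le_trans (lerD (ler_normD _ _) (lexx _)) _.
apply: le_trans (lerD (lerD (ler_normD _ _) (lexx _)) (lexx _)) _.
by lra.
Qed.

Lemma integ_cas_prod M h zeta : bounded_by M h ->
  integ (mu2 R) (fun a => cas_prod h a (psub zeta a)).
Proof.
move=> bM; apply: (@integ_le _ _ _ (mu2 R) _ (fun a => 4 * M ^+ 2 * (wt a * wt (psub zeta a)))).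
- by apply: m_cas_prod; case: bM.
- by move=> a; exact: cas_prod_bound.
- by apply: integZ; exact: integ_wt_conv.
Qed.

Definition conv_const : R := 32 * hkap R * wt_mass R.

Lemma conv_const_ge0 : 0 <= conv_const.
Proof. by rewrite !mulr_ge0// ?wt_mass_ge0// ltW// hkap_gt0. Qed.

Lemma hsq_bound M h zeta : bounded_by M h -> `|hsq h zeta| <= conv_const * M ^+ 2 * wt zeta.
Proof.
move=> bM; rewrite /hsq normrM gtr0_norm ?divr_gt0 ?hkap_gt0//.
have h1 : `|\int[mu2 R]_a cas_prod h a (psub zeta a)| <= 4 * M ^+ 2 * (16 * wt_mass R * wt zeta).
  apply: (@le_trans _ _ (\int[mu2 R]_a (4 * M ^+ 2 * (wt a * wt (psub zeta a))))).
    apply: RI_norm.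
    - by apply: m_cas_prod; case: bM.
    - by move=> a; exact: cas_prod_bound.
    - by apply: integZ; exact: integ_wt_conv.
  rewrite RIZ; last exact: integ_wt_conv.
  apply: ler_wpM2l; first by rewrite mulr_ge0// sqr_ge0.
  exact: RI_wt_conv.
apply: le_trans (ler_wpM2l _ h1) _; first by rewrite ltW// divr_gt0// hkap_gt0.
by rewrite /conv_const; lra.
Qed.

Lemma cas_prod_lip M D h k a b : bounded_by M h -> bounded_by M k ->
  (forall z, `|h z - k z| <= D * wt z) ->
  `|cas_prod h a b - cas_prod k a b| <= 8 * M * D * (wt a * wt b).
Proof.
move=> bh bk hk; have M0 := bounded_by_ge0 bh; case: bh => mh hM; case: bk => mk kM.
have D0 : 0 <= D.
  by have := le_trans (normr_ge0 _) (hk (0, 0)); rewrite pmulr_lge0// wt_gt0.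
have H x y : `|h x * h y - k x * k y| <= 2 * M * D * (wt x * wt y).
  rewrite (_ : _ - _ = (h x - k x) * h y + k x * (h y - k y)); last by ring.
  apply: le_trans (ler_normD _ _) _; rewrite !normrM.
  have e1 : `|h x - k x| * `|h y| <= (D * wt x) * (M * wt y) by rewrite ler_pM.
  have e2 : `|k x| * `|h y - k y| <= (M * wt x) * (D * wt y) by rewrite ler_pM.
  by lra.
have h1 := H a (popp b); have h2 := H (popp a) b; have h3 := H a b.
have h4 := H (popp a) (popp b); rewrite !wt_popp in h1 h2 h3 h4.
rewrite (_ : _ - _ = (h a * h (popp b) - k a * k (popp b)) + (h (popp a) * h b - k (popp a) * k b)
  + (h a * h b - k a * k b) - (h (popp a) * h (popp b) - k (popp a) * k (popp b))); last first.
  by rewrite /cas_prod; ring.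
apply: le_trans (ler_normB _ _) _.
apply: le_trans (lerD (ler_normD _ _) (lexx _)) _.
apply: le_trans (lerD (lerD (ler_normD _ _) (lexx _)) (lexx _)) _.
by lra.
Qed.

Lemma hsq_lip M D h k zeta : bounded_by M h -> bounded_by M k ->
  (forall z, `|h z - k z| <= D * wt z) ->
  `|hsq h zeta - hsq k zeta| <= 2 * conv_const * M * D * wt zeta.
Proof.
move=> bh bk hk; have M0 := bounded_by_ge0 bh.
have D0 : 0 <= D.
  by have := le_trans (normr_ge0 _) (hk (0, 0)); rewrite pmulr_lge0// wt_gt0.
have ih := integ_cas_prod zeta bh; have ik := integ_cas_prod zeta bk.
rewrite /hsq -mulrBr -RIB// normrM gtr0_norm ?divr_gt0 ?hkap_gt0//.
set I := \int[_]_x _.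
have h1 : `|I| <= 8 * M * D * (16 * wt_mass R * wt zeta).
  apply: (@le_trans _ _ (\int[mu2 R]_a (8 * M * D * (wt a * wt (psub zeta a))))).
    apply: RI_norm.
    - by apply: mB; apply: m_cas_prod; [case: bh|case: bk].
    - by move=> a; exact: cas_prod_lip.
    - by apply: integZ; exact: integ_wt_conv.
  rewrite RIZ; last exact: integ_wt_conv.
  apply: ler_wpM2l; first by rewrite !mulr_ge0.
  exact: RI_wt_conv.
apply: le_trans (ler_wpM2l _ h1) _; first by rewrite ltW// divr_gt0// hkap_gt0.
by rewrite /conv_const; lra.
Qed.

Lemma hsq_scale e h zeta : integ (mu2 R) (fun a => cas_prod h a (psub zeta a)) ->
  hsq (fun z => e * h z) zeta = e ^+ 2 * hsq h zeta.
Proof.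
move=> i; rewrite /hsq [RHS]mulrCA -[in RHS]RIZ//; congr (_ * _); apply: RI_ext => a.
by rewrite /cas_prod; ring.
Qed.

Lemma m_hsq d (T : measurableType d) (U : T -> plane R -> R) :
  measurable_fun setT (fun p : T * plane R => U p.1 p.2) ->
  measurable_fun setT (fun p : T * plane R => hsq (U p.1) p.2).
Proof.
move=> mU; apply: mM; first by meas.
apply: (@measurable_paramr _ _ (T * plane R)%type (plane R) R (leb2 R)
  (fun p a => cas_prod (U p.1) a (psub p.2 a))).
have m2 (f : (T * plane R) * plane R -> plane R) : measurable_fun setT f ->
    measurable_fun setT (fun q : (T * plane R) * plane R => U q.1.1 (f q)).
  move=> mf; apply: (mcompT (h := fun p : T * plane R => U p.1 p.2) (f := fun q => (q.1.1, f q))) => //.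
  by apply: mpair => //; do 2 apply: mpair1; exact: measurable_id.
have ms : measurable_fun setT (fun q : (T * plane R) * plane R => q.2) by exact: measurable_snd.
have md : measurable_fun setT (fun q : (T * plane R) * plane R => psub q.1.2 q.2) by meas.
rewrite /cas_prod; apply: mB; first apply: mD; first apply: mD.
- by apply: mM; [exact: m2 ms|exact: m2 (m_popp md)].
- by apply: mM; [exact: m2 (m_popp ms)|exact: m2 md].
- by apply: mM; [exact: m2 ms|exact: m2 md].
- by apply: mM; [exact: m2 (m_popp ms)|exact: m2 (m_popp md)].
Qed.

Lemma hsq_bounded_by M h : bounded_by M h -> bounded_by (conv_const * M ^+ 2) (hsq h).
Proof.
move=> bM; split; last by move=> z; exact: hsq_bound.
have mU : measurable_fun setT (fun p : plane R * plane R => h p.2).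
  by case: bM => mh _; meas.
have := measurable_fun_pair2 (f := fun p => hsq ((fun=> h) p.1) p.2) ((0, 0) : plane R) (m_hsq mU).
exact.
Qed.

Lemma casD x y : cas (x + y) = cos y * cas x + sin y * cas (- x) :> R.
Proof. by rewrite /cas cosD sinD cosN sinN; ring. Qed.

Section SquareTransform.
Variables (M : R) (h : plane R -> R) (z : plane R).
Hypothesis bM : bounded_by M h.
Let mh : measurable_fun setT h. Proof. by case: bM. Qed.
Let ih := bounded_by_integ bM.

Let mz : measurable_fun setT (fun b : plane R => pdot b z).
Proof. by meas. Qed.

Let integ_sin (f : plane R -> R) : integ (mu2 R) f ->
  integ (mu2 R) (fun b => f b * sin (pdot b z)).
Proof.
move=> i; have mf := integ_meas i.
apply: (@integ_le _ _ _ (mu2 R) _ (fun b => `|f b|)); first by meas.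
- by move=> b; rewrite normrM ler_piMr// norm_sin_le1.
- exact: integ_norm.
Qed.

Let Ac := \int[mu2 R]_b (h b * cos (pdot b z)).
Let As := \int[mu2 R]_b (h b * sin (pdot b z)).

Let AcE : \int[mu2 R]_b (h (popp b) * cos (pdot b z)) = Ac.
Proof.
rewrite /Ac -(RI_popp (integ_cosM ih mz)); apply: RI_ext => b.
by rewrite -cosN; congr (_ * cos _); rewrite /pdot /popp/=; ring.
Qed.

Let AsE : \int[mu2 R]_b (h (popp b) * sin (pdot b z)) = - As.
Proof.
rewrite /As -(RI_popp (integ_sin ih)) -RIN; last exact: (integ_popp (integ_sin ih)).
apply: RI_ext => b; rewrite -mulrN -sinN; congr (_ * sin _); rewrite /pdot /popp/=; ring.
Qed.

Let hartE : hart h z = Ac + As.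
Proof.
rewrite /Ac /As -RID; [|exact: integ_cosM|exact: integ_sin].
by apply: RI_ext => b; rewrite /cas; ring.
Qed.

Let inner a : \int[mu2 R]_b (cas_prod h a b * cas (pdot a z + pdot b z)) =
  2 * Ac * (h a * cas (pdot a z)) + 2 * As * (h (popp a) * cas (- pdot a z)).
Proof.
have ih' := integ_popp ih.
have i1 := integ_cosM ih mz; have i2 := integ_cosM ih' mz.
have i3 := integ_sin ih; have i4 := integ_sin ih'.
pose ca := cas (pdot a z); pose cm := cas (- pdot a z).
transitivity (\int[mu2 R]_b (
    ((h (popp a) + h a) * ca * (h b * cos (pdot b z)) +
     (h a - h (popp a)) * ca * (h (popp b) * cos (pdot b z))) +
    ((h (popp a) + h a) * cm * (h b * sin (pdot b z)) +
     (h a - h (popp a)) * cm * (h (popp b) * sin (pdot b z))))).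
  by apply: RI_ext => b; rewrite casD /cas_prod -/ca -/cm; ring.
rewrite RID; [|by apply: integD; exact: integZ|by apply: integD; exact: integZ].
rewrite RID; [|exact: integZ|exact: integZ].
rewrite [X in _ + X]RID; [|exact: integZ|exact: integZ].
by rewrite !RIZ// AcE AsE -/Ac -/As /ca /cm; ring.
Qed.

(** Both sides are computed from the cosine and the sine integral of [h]. *)
Lemma hfun_hsq : hfun (hsq h) z = hfun h z ^+ 2.
Proof.
suff E : hart (hsq h) z = hkap R * hart h z ^+ 2 by rewrite /hfun E; ring.
pose f a zeta := cas_prod h a (psub zeta a) * cas (pdot zeta z).
have M0 := bounded_by_ge0 bM.
have mC (g : plane R * plane R -> plane R) : measurable_fun setT g ->
    measurable_fun setT (fun p => h (g p)) by move=> mg; meas.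
have mf : measurable_fun setT (fun p : plane R * plane R => f p.1 p.2).
  apply: mM; last by apply: m_cas; meas.
  by rewrite /cas_prod; meas.
have f_le a zeta : `|f a zeta| <= (8 * M ^+ 2) * (wt a * wt (psub zeta a)).
  rewrite normrM; have h1 := cas_prod_bound a (psub zeta a) bM; have h2 := cas_le2 (pdot zeta z).
  apply: le_trans (ler_pM (normr_ge0 _) (normr_ge0 _) h1 h2) _; lra.
have fy zeta : integ (mu2 R) (f ^~ zeta).
  apply: (@integ_le _ _ _ (mu2 R) _ (fun a => (8 * M ^+ 2) * (wt a * wt (psub zeta a)))).
  - exact: (measurable_fun_pair1 (f := fun p : plane R * plane R => f p.1 p.2)).
  - by move=> a; exact: f_le.
  - by apply: integZ; exact: integ_wt_conv.
have iw a := integ_shift a (@integ_wt R).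
have fx a : integ (mu2 R) (f a).
  apply: (@integ_le _ _ _ (mu2 R) _ (fun zeta => (8 * M ^+ 2 * wt a) * wt (psub zeta a))).
  - exact: (measurable_fun_pair2 (f := fun p : plane R * plane R => f p.1 p.2)).
  - by move=> zeta; rewrite -mulrA; exact: f_le.
  - exact: integZ.
have fM a : \int[mu2 R]_zeta `|f a zeta| <= (8 * M ^+ 2 * wt_mass R) * wt a.
  apply: (@le_trans _ _ (\int[mu2 R]_zeta ((8 * M ^+ 2 * wt a) * wt (psub zeta a)))).
    apply: RI_le; [exact: integ_norm|exact: integZ|].
    by move=> zeta; rewrite -mulrA; exact: f_le.
  by rewrite RIZ// RI_shift; [rewrite /wt_mass mulrAC|exact: integ_wt].
transitivity (hkap R / 2 * \int[mu2 R]_zeta \int[mu2 R]_a f a zeta).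
  rewrite -RIZ.
    apply: RI_ext => zeta; rewrite /hsq -mulrA; congr (_ * _).
    by rewrite -RIZr//; exact: integ_cas_prod bM.
  apply: (@integ_ext _ _ _ (mu2 R) (fun zeta => (hkap R / 2)^-1 * (hsq h zeta * cas (pdot zeta z)))).
    move=> zeta; rewrite /hsq mulrA mulKf ?gt_eqF ?divr_gt0 ?hkap_gt0//.
    by rewrite -RIZr//; exact: integ_cas_prod bM.
  by apply: integZ; apply: integ_casM => //; exact: bounded_by_integ (hsq_bounded_by bM).
rewrite -(@RI_swap _ _ (plane R) (plane R) R (leb2 R) (leb2 R) f (fun a => (8 * M ^+ 2 * wt_mass R) * wt a))//;
  last by apply: integZ; exact: integ_wt.
have E a : \int[mu2 R]_zeta f a zeta =
    2 * Ac * (h a * cas (pdot a z)) + 2 * As * (h (popp a) * cas (- pdot a z)).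
  rewrite -inner; pose F b := cas_prod h a b * cas (pdot a z + pdot b z).
  transitivity (\int[mu2 R]_zeta F (psub zeta a)).
    by apply: RI_ext => zeta; rewrite /f /F; congr (_ * cas _); rewrite /pdot /psub/=; ring.
  apply: (@RI_shift R a F).
  have := integ_shift (popp a) (fx a); apply: integ_ext => b; rewrite /f /F.
  have -> : psub (psub b (popp a)) a = b.
    by rewrite /psub /popp/=; case: b => b1 b2 /=; congr pair; ring.
  by congr (_ * cas _); rewrite /pdot /psub/=; ring.
transitivity (hkap R / 2 * \int[mu2 R]_a (2 * Ac * (h a * cas (pdot a z)) +
   2 * As * (h (popp a) * cas (- pdot a z)))).
  by congr (_ * _); apply: RI_ext.
have i1 := integ_casM ih mz.
have E2 a : h (popp a) * cas (- pdot a z) = (fun b => h b * cas (pdot b z)) (popp a).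
  by rewrite /=; congr (_ * cas _); rewrite /pdot/=; ring.
have i2 : integ (mu2 R) (fun a => h (popp a) * cas (- pdot a z)).
  by rewrite (funext E2); exact: (integ_popp i1).
rewrite RID; [|exact: integZ|exact: integZ].
rewrite !RIZ// (funext E2) (RI_popp i1) -/(hart h z) hartE.
by field.
Qed.

End SquareTransform.

Lemma is_square_hdist M h : bounded_by M h -> is_square (hdist h) (hdist (hsq h)).
Proof.
move=> bM; exists (hfun h); first exact: is_function_hdist (bounded_by_integ bM).
have -> : (fun z => hfun h z ^+ 2) = hfun (hsq h).
  by apply/funext => z; rewrite (hfun_hsq z bM).
exact: is_function_hdist (bounded_by_integ (hsq_bounded_by bM)).
Qed.

End Square.

Section Propagator.
Variable R : realType.
Implicit Types (h k : plane R -> R) (z zeta : plane R).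

Lemma KP_symbol_popp z : KP_symbol (popp z) = - KP_symbol z.
Proof.
rewrite /KP_symbol /popp/=; have [->|n0] := eqVneq z.1 0; first by rewrite oppr0 !invr0 expr0n/= !mulr0; ring.
by field; rewrite ?oppr_eq0 n0.
Qed.

(** [exp(i t P)] turns the pair ([hev h], [hod h]) by the angle [t P], and [P] is odd;
    hence the reflected term. *)
Definition propagate (t : R) h zeta : R := expR (- (zeta.1 ^+ 2 * t)) *
  (cos (t * KP_symbol zeta) * h zeta - sin (t * KP_symbol zeta) * h (popp zeta)).

(** The Hartley transform of [W(t) d_x v] when [k] is that of [v]. *)
Definition propagate_dx (t : R) k : plane R -> R :=
  propagate t (fun z => - (z.1 * k (popp z))).

Lemma propagate_dxE t k zeta : propagate_dx t k zeta =
  - (zeta.1 * expR (- (zeta.1 ^+ 2 * t)) *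
     (cos (t * KP_symbol zeta) * k (popp zeta) + sin (t * KP_symbol zeta) * k zeta)).
Proof. by rewrite /propagate_dx /propagate poppK /=; ring. Qed.

Lemma evolves_hdist t v h : fourier_pair v (hev h) (hod h) ->
  integ (mu2 R) (propagate t h) -> evolves t v (hdist (propagate t h)).
Proof.
move=> fv ip; exists (fun z => (hev h z +i* hod h z)%C); first by apply/has_fourierE.
apply/has_fourierE.
rewrite (_ : (fun z => complex.Re _) = hev (propagate t h)); last first.
  apply/funext => z; rewrite /= /hev /hod /propagate KP_symbol_popp poppK mulrN cosN sinN /= sqrrN.
  by field.
rewrite (_ : (fun z => complex.Im _) = hod (propagate t h)); last first.
  apply/funext => z; rewrite /= /hev /hod /propagate KP_symbol_popp poppK mulrN cosN sinN /= sqrrN.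
  by field.
exact: fourier_hdist.
Qed.

Lemma evolves_dx_hdist t k : integ (mu2 R) k -> integ (mu2 R) (propagate_dx t k) ->
  evolves t (dist_dx (hdist k)) (hdist (propagate_dx t k)).
Proof.
move=> ik ip; apply: evolves_hdist => //.
have := fourier_pair_dx (fourier_hdist ik).
rewrite (_ : (fun z => - _) = hev (fun z => - (z.1 * k (popp z)))); last first.
  by apply/funext => z; rewrite /hev /hod poppK/=; field.
rewrite (_ : (fun z => z.1 * _) = hod (fun z => - (z.1 * k (popp z)))) //.
by apply/funext => z; rewrite /hev /hod poppK/=; field.
Qed.

Lemma m_KP d (T : measurableType d) (f : T -> plane R) : measurable_fun setT f ->
  measurable_fun setT (fun x => KP_symbol (f x)).
Proof. by move=> mf; rewrite /KP_symbol; meas. Qed.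

Lemma propagate_bound M t h zeta : 0 <= t -> bounded_by M h ->
  `|propagate t h zeta| <= 2 * M * wt zeta.
Proof.
move=> t0 [mh hM]; rewrite normrM gtr0_norm ?expR_gt0//.
have e1 : expR (- (zeta.1 ^+ 2 * t)) <= 1.
  by rewrite -expR0 ler_expR oppr_le0 mulr_ge0// sqr_ge0.
rewrite -[leRHS]mul1r ler_pM// ?expR_ge0//.
apply: le_trans (ler_normB _ _) _; rewrite !normrM.
have h1 := hM zeta; have := hM (popp zeta); rewrite wt_popp => h2.
have c1 := norm_cos_le1 (t * KP_symbol zeta); have s1 := norm_sin_le1 (t * KP_symbol zeta).
have e2 : `|cos (t * KP_symbol zeta)| * `|h zeta| <= 1 * (M * wt zeta) by rewrite ler_pM.
have e3 : `|sin (t * KP_symbol zeta)| * `|h (popp zeta)| <= 1 * (M * wt zeta) by rewrite ler_pM.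
lra.
Qed.

Lemma propagate_dx_bound M t k zeta : bounded_by M k ->
  `|propagate_dx t k zeta| <= 2 * M * (`|zeta.1| * expR (- (zeta.1 ^+ 2 * t))) * wt zeta.
Proof.
move=> [mk kM]; rewrite propagate_dxE normrN !normrM (gtr0_norm (expR_gt0 _)).
have h1 := kM zeta; have := kM (popp zeta); rewrite wt_popp => h2.
have c1 := norm_cos_le1 (t * KP_symbol zeta); have s1 := norm_sin_le1 (t * KP_symbol zeta).
have e2 : `|cos (t * KP_symbol zeta)| * `|k (popp zeta)| <= 1 * (M * wt zeta) by rewrite ler_pM.
have e3 : `|sin (t * KP_symbol zeta)| * `|k zeta| <= 1 * (M * wt zeta) by rewrite ler_pM.
rewrite (_ : 2 * M * _ * _ = `|zeta.1| * expR (- (zeta.1 ^+ 2 * t)) * (2 * (M * wt zeta))); last by ring.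
rewrite ler_wpM2l ?mulr_ge0 ?expR_ge0//.
by apply: le_trans (ler_normD _ _) _; rewrite !normrM; lra.
Qed.

(** Dissipation controls the derivative at positive times. *)
Lemma dissipation_le (x t : R) : 0 < t -> `|x| * expR (- (x ^+ 2 * t)) <= 1 + t^-1.
Proof.
move=> t0; have e1 : expR (- (x ^+ 2 * t)) <= 1.
  by rewrite -expR0 ler_expR oppr_le0 mulr_ge0 ?sqr_ge0// ltW.
have i0 : 0 < t^-1 by rewrite invr_gt0.
have e0 := expR_ge0 (- (x ^+ 2 * t)).
have [x1|x1] := leP `|x| 1.
  apply: (@le_trans _ _ (1 * 1)); first by rewrite ler_pM.
  by rewrite mulr1 lerDl ltW.
apply: (@le_trans _ _ t^-1); last by rewrite lerDr.
rewrite expRN ler_pdivrMr ?expR_gt0// mulrC ler_pdivlMr//.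
apply: le_trans (expR_ge1Dx _); rewrite -[x ^+ 2]real_normK ?num_real//.
have p : 0 <= t * (`|x| * (`|x| - 1)).
  by apply: mulr_ge0; [exact: ltW|apply: mulr_ge0 => //; lra].
rewrite expr2; lra.
Qed.

Lemma integ_propagate_dx M t k : 0 < t -> bounded_by M k -> integ (mu2 R) (propagate_dx t k).
Proof.
move=> t0 bM; have M0 := bounded_by_ge0 bM; have [mk kM] := bM.
have mK : measurable_fun setT (@KP_symbol R : plane R -> R) by apply: (m_KP (f := id)).
apply: (@integ_le _ _ _ (mu2 R) _ (fun z => (2 * M * (1 + t^-1)) * wt z)).
- by rewrite (funext (propagate_dxE t k)); meas.
- move=> z; apply: le_trans (propagate_dx_bound _ _ bM) _.
  by rewrite ler_wpM2r ?wt_ge0// ler_wpM2l ?mulr_ge0// dissipation_le.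
- by apply: integZ; exact: integ_wt.
Qed.

Lemma integ_propagate M t h : 0 <= t -> bounded_by M h -> integ (mu2 R) (propagate t h).
Proof.
move=> t0 bM; have [mh hM] := bM.
have mK : measurable_fun setT (@KP_symbol R : plane R -> R) by apply: (m_KP (f := id)).
apply: (@integ_le _ _ _ (mu2 R) _ (fun z => (2 * M) * wt z)).
- by rewrite /propagate; meas.
- by move=> z; exact: propagate_bound.
- by apply: integZ; exact: integ_wt.
Qed.

End Propagator.

(** * The Duhamel fixed point *)

Section Geometric.
Variable R : realType.

(** The sequences [u n -+ 2 c / 2 ^ n] are monotone and enclose the limit. *)
Lemma geometric_cvg (u : nat -> R) c : (forall n, `|u n.+1 - u n| <= c / 2 ^+ n) ->
  exists l, forall n, `|l - u n| <= 2 * c / 2 ^+ n.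
Proof.
move=> uc; pose e n : R := 2 * c / 2 ^+ n.
have eS n : e n.+1 = e n - c / 2 ^+ n.
  by rewrite /e exprS; field; rewrite expf_neq0.
have up n : u n - e n <= u n.+1 - e n.+1.
  by rewrite eS; have := uc n; rewrite ler_norml => /andP[h _]; lra.
have dn n : u n.+1 + e n.+1 <= u n + e n.
  by rewrite eS; have := uc n; rewrite ler_norml => /andP[_ h]; lra.
have ups m n : u n - e n <= u (m + n)%N - e (m + n)%N.
  by elim: m => // m IH; apply: le_trans IH _; rewrite addSn; exact: up.
have dns m n : u (m + n)%N + e (m + n)%N <= u n + e n.
  by elim: m => // m IH; apply: le_trans IH; rewrite addSn; exact: dn.
have c0 : 0 <= c by have := le_trans (normr_ge0 _) (uc 0%N); rewrite expr0 divr1.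
have e0 n : 0 <= e n by rewrite /e divr_ge0 ?mulr_ge0// exprn_ge0.
have ud m n : u m - e m <= u n + e n.
  apply: le_trans (ups n m) _; apply: le_trans _ (dns m n).
  by rewrite [(m + n)%N]addnC; have := e0 (n + m)%N; lra.
pose A : set R := [set u n - e n | n in [set: nat]].
have A0 : A !=set0 by exists (u 0%N - e 0%N); exists 0%N.
have hA : has_ubound A by exists (u 0%N + e 0%N) => _ [n _ <-]; exact: ud.
exists (sup A) => n; rewrite ler_norml; apply/andP; split.
- by have : u n - e n <= sup A; [apply: ub_le_sup => //; exists n|rewrite -/(e n); lra].
- have : sup A <= u n + e n by apply: ge_sup => // _ [m _ <-]; exact: ud.
  by rewrite -/(e n); lra.
Qed.

Lemma geometric_cvg0 (c : R) : c / 2 ^+ n @[n --> \oo] --> (0 : R).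
Proof.
have h : (2^-1 : R) ^+ n @[n --> \oo] --> (0 : R).
  by apply: cvg_expr; rewrite gtr0_norm// invf_lt1// ltr1n.
have E : (fun n => c / 2 ^+ n) = (fun n => c * (2^-1 : R) ^+ n).
  by apply/funext => n; rewrite exprVn.
by rewrite E -(mulr0 c); apply: cvgM => //; exact: cvg_cst.
Qed.

Lemma le0_geometric (x c : R) : (forall n, x <= c / 2 ^+ n) -> x <= 0.
Proof.
move=> h; have g := geometric_cvg0 c.
have k : x @[_ --> \oo] --> x by exact: cvg_cst.
by apply: (ler_cvg_to k g); exact: nearW.
Qed.

End Geometric.

Section Duhamel.
Variable R : realType.
Notation leb := (@lebesgue_measure R).
Notation time := (measurableTypeR R).
Implicit Types (t s : R) (zeta : plane R) (U V : R -> plane R -> R).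

(** The indicator of [[0, s)], by comparisons, so that it is measurable in both
    variables. *)
Definition cut s t : R := ((0 <= t)%R)%:R * (1 - ((s <= t)%R)%:R).

Lemma cutE s t : cut s t = if (0 <= t) && (t < s) then 1 else 0.
Proof.
by rewrite /cut ltNge; case: (0 <= t); case: (s <= t);
  rewrite /= ?(mulr1n, mulr0n, subrr, subr0, mulr0, mul0r, mulr1).
Qed.

Lemma cut_ge0 s t : 0 <= cut s t.
Proof. by rewrite cutE; case: ifP. Qed.

Lemma cut_le_indic s t : cut s t <= \1_(`[0, s]%classic) t.
Proof.
rewrite cutE indicE; case: ifP => // /andP[t0 ts].
by rewrite mem_set//= in_itv/= t0 ltW.
Qed.

Lemma m_cut d (T : measurableType d) (f g : T -> R) : measurable_fun setT f ->
  measurable_fun setT g -> measurable_fun setT (fun x => cut (f x) (g x)).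
Proof.
move=> mf mg; apply: mM; first by apply: (@mle _ _ _ (fun=> 0) g) => //; meas.
by apply: mB; [meas|exact: mle].
Qed.

Lemma integ_indic_itv (a b : R) : integ leb (\1_(`[a, b]%classic) : R -> R).
Proof.
exact: (@integrable_indic_itv R a b true false).
Qed.

Lemma RI_indic_itv (a b : R) : a <= b -> \int[leb]_t (\1_(`[a, b]%classic) t : R) = b - a.
Proof.
move=> ab; have d1 (x : R) : is_derive x 1 (fun x => 1 * x) 1.
  by apply: is_derive_eq; rewrite /GRing.scale/= ?mulr1.
have c1 : continuous (fun _ : R => 1 : R) by move=> y; exact: cvg_cst.
have := FTC_itv ab d1 c1; rewrite !mul1r => <-.
by rewrite RI_itv_indic; apply: RI_ext => t; rewrite mulr1.
Qed.

Definition kernel s (x t : R) : R := cut s t * (`|x| * expR (- (x ^+ 2 * (s - t)))).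

Lemma kernel_le s x t : 0 <= kernel s x t <= \1_(`[0, s]%classic) t * `|x|.
Proof.
apply/andP; split; first by rewrite mulr_ge0 ?cut_ge0// mulr_ge0// expR_ge0.
rewrite /kernel cutE; case: ifP => [/andP[t0 ts]|_].
  have tin : t \in `[0, s]%classic by rewrite inE/= in_itv/= t0 ltW.
  rewrite mul1r indicE tin mul1r ler_piMr//.
  by rewrite -expR0 ler_expR oppr_le0 mulr_ge0 ?sqr_ge0// subr_ge0 ltW.
by rewrite mul0r mulr_ge0// indicE.
Qed.

Lemma m_kernel s x : measurable_fun setT (kernel s x : time -> R).
Proof. by rewrite /kernel; apply: mM; [apply: m_cut; meas|meas]. Qed.

Lemma integ_kernel s x : integ leb (kernel s x).
Proof.
apply: (@integ_le _ _ _ leb _ (fun t => \1_(`[0, s]%classic) t * `|x|)).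
- exact: m_kernel.
- by move=> t; have /andP[h1 h2] := kernel_le s x t; rewrite ger0_norm.
- have := integZ `|x| (integ_indic_itv 0 s); apply: integ_ext => t; exact: mulrC.
Qed.

(** The gain of a factor [xi^-2] by dissipation, against the loss of [xi] by
    the derivative. *)
Lemma kernel_mass s x : 0 <= s -> \int[leb]_t kernel s x t <= 1 + s.
Proof.
move=> s0; have [x1|x1] := leP `|x| 1.
  apply: (@le_trans _ _ (\int[leb]_t (\1_(`[0, s]%classic) t : R))).
    apply: RI_le; [exact: integ_kernel|exact: integ_indic_itv|] => t.
    have /andP[_ h] := kernel_le s x t; apply: le_trans h _.
    by rewrite ler_piMr// indicE.
  by rewrite RI_indic_itv// subr0 lerDr.
have x0 : 0 < `|x| by exact: lt_trans x1.
have n0 : `|x| != 0 by rewrite gt_eqF.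
have xE : x ^+ 2 = `|x| ^+ 2 by rewrite real_normK ?num_real.
pose g t := `|x| * expR (- (x ^+ 2 * (s - t))).
pose F t := `|x|^-1 * expR (- (x ^+ 2 * (s - t))).
have dF t : is_derive t 1 F (g t).
  by apply: is_derive_eq; rewrite /GRing.scale/= /g xE; field.
have dg t : is_derive t 1 g (`|x| * (x ^+ 2 * expR (- (x ^+ 2 * (s - t))))).
  by apply: is_derive_eq; rewrite /GRing.scale/=; ring.
have cg := is_derive_continuous dg.
have mg : measurable_fun setT (g : time -> R) by exact: continuous_measurable_fun.
have g0 t : 0 <= g t by rewrite mulr_ge0// expR_ge0.
have i1 : integ leb (fun t => \1_(`[0, s]%classic) t * g t).
  apply: (@integ_le _ _ _ leb _ (fun t => \1_(`[0, s]%classic) t * `|x|)).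
  - by apply: mM => //; exact: measurable_indic_itv.
  - move=> t; rewrite normrM (ger0_norm (g0 t)) indicE.
    have [tin|tin] := boolP (t \in `[0, s]%classic); last by rewrite normr0 !mul0r.
    move: (tin); rewrite inE/= in_itv/= => /andP[_ ts].
    by rewrite normr1 !mul1r /g ler_piMr// -expR0 ler_expR oppr_le0 mulr_ge0 ?sqr_ge0// subr_ge0.
  - have := integZ `|x| (integ_indic_itv 0 s); apply: integ_ext => t; exact: mulrC.
apply: (@le_trans _ _ (\int[leb]_t (\1_(`[0, s]%classic) t * g t))).
  apply: RI_le; [exact: integ_kernel|exact: i1|] => t.
  by rewrite /kernel -/(g t) ler_wpM2r// cut_le_indic.
rewrite -RI_itv_indic (FTC_itv s0 dF cg).
have F0 : 0 <= F 0 by rewrite /F mulr_ge0 ?invr_ge0// expR_ge0.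
have : F s <= 1 by rewrite /F subrr mulr0 oppr0 expR0 mulr1 invf_le1// ltW.
lra.
Qed.

(** The Hartley transform of [- 1/2 \int_0^s W(s-t) d_x (u(t)^2) dt]. *)
Definition duh U s zeta : R :=
  - (2^-1 * \int[leb]_t (cut s t * propagate_dx (s - t) (hsq (U t)) zeta)).

Section DuhBound.
Variables (T M : R) (U : R -> plane R -> R).
Hypotheses (mU : measurable_fun setT (fun p : time * plane R => U p.1 p.2))
  (bU : forall t, bounded_by M (U t)).

Lemma m_duh_integrand : measurable_fun setT (fun p : (time * plane R) * time =>
  cut p.1.1 p.2 * propagate_dx (p.1.1 - p.2) (hsq (U p.2)) p.1.2).
Proof.
have mS := m_hsq mU.
have m1 : measurable_fun setT (fun p : (time * plane R) * time => hsq (U p.2) p.1.2).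
  by apply: (mcompT (f := fun p : (time * plane R) * time => (p.2, p.1.2)) mS); meas.
have m2 : measurable_fun setT (fun p : (time * plane R) * time => hsq (U p.2) (popp p.1.2)).
  by apply: (mcompT (f := fun p : (time * plane R) * time => (p.2, popp p.1.2)) mS); meas.
have mK : measurable_fun setT (fun p : (time * plane R) * time => KP_symbol p.1.2).
  by apply: m_KP; meas.
apply: mM; first by apply: m_cut; meas.
rewrite (_ : (fun p => _) = (fun p : (time * plane R) * time =>
  - (p.1.2.1 * expR (- (p.1.2.1 ^+ 2 * (p.1.1 - p.2))) *
     (cos ((p.1.1 - p.2) * KP_symbol p.1.2) * hsq (U p.2) (popp p.1.2) +
      sin ((p.1.1 - p.2) * KP_symbol p.1.2) * hsq (U p.2) p.1.2)))).
  by meas.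
by apply/funext => p; exact: propagate_dxE.
Qed.

Lemma m_duh : measurable_fun setT (fun p : time * plane R => duh U p.1 p.2).
Proof.
apply: mN; apply: mM; first by meas.
exact: (measurable_paramr leb (f := fun (p : time * plane R) (t : time) =>
  cut p.1 t * propagate_dx (p.1 - t) (hsq (U t)) p.2) m_duh_integrand).
Qed.

Lemma m_duh_slice s zeta :
  measurable_fun setT (fun t : time => cut s t * propagate_dx (s - t) (hsq (U t)) zeta).
Proof.
exact: (measurable_fun_pair2 (f := fun p : (time * plane R) * time =>
  cut p.1.1 p.2 * propagate_dx (p.1.1 - p.2) (hsq (U p.2)) p.1.2) (s, zeta) m_duh_integrand).
Qed.

Lemma duh_integrand_bound s zeta t :
  `|cut s t * propagate_dx (s - t) (hsq (U t)) zeta| <=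
  (2 * (conv_const R * M ^+ 2) * wt zeta) * kernel s zeta.1 t.
Proof.
rewrite normrM (ger0_norm (cut_ge0 _ _)).
have := propagate_dx_bound (s - t) zeta (hsq_bounded_by (bU t)).
move=> /(ler_wpM2l (cut_ge0 s t)) h; apply: le_trans h _.
by rewrite /kernel le_eqVlt; apply/orP; left; apply/eqP; ring.
Qed.

Lemma integ_duh s zeta :
  integ leb (fun t => cut s t * propagate_dx (s - t) (hsq (U t)) zeta).
Proof.
apply: (@integ_le _ _ _ leb _ (fun t => (2 * (conv_const R * M ^+ 2) * wt zeta) * kernel s zeta.1 t)).
- exact: m_duh_slice.
- by move=> t; exact: duh_integrand_bound.
- by apply: integZ; exact: integ_kernel.
Qed.

Lemma duh_bound s zeta : 0 <= s <= T ->
  `|duh U s zeta| <= (1 + T) * conv_const R * M ^+ 2 * wt zeta.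
Proof.
move=> /andP[s0 sT]; have c0 := conv_const_ge0 R; have w0 := wt_ge0 zeta.
have M0 := bounded_by_ge0 (bU 0).
rewrite normrN normrM gtr0_norm//.
have h : `|\int[leb]_t (cut s t * propagate_dx (s - t) (hsq (U t)) zeta)| <=
    (2 * (conv_const R * M ^+ 2) * wt zeta) * (1 + T).
  apply: (@le_trans _ _ (\int[leb]_t ((2 * (conv_const R * M ^+ 2) * wt zeta) * kernel s zeta.1 t))).
    apply: RI_norm.
    - exact: m_duh_slice.
    - by move=> t; exact: duh_integrand_bound.
    - by apply: integZ; exact: integ_kernel.
  rewrite RIZ; last exact: integ_kernel.
  apply: ler_wpM2l; first by rewrite mulr_ge0// mulr_ge0// mulr_ge0// exprn_ge0.
  by apply: le_trans (kernel_mass _ s0) _; rewrite lerD2l.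
apply: le_trans (ler_wpM2l _ h) _; first by [].
by rewrite le_eqVlt; apply/orP; left; apply/eqP; field.
Qed.

End DuhBound.

Lemma propagate_dxB t (h k : plane R -> R) zeta :
  propagate_dx t h zeta - propagate_dx t k zeta = propagate_dx t (fun z => h z - k z) zeta.
Proof. by rewrite !propagate_dxE; ring. Qed.

Lemma propagate_dxZ e t (h : plane R -> R) zeta :
  propagate_dx t (fun z => e * h z) zeta = e * propagate_dx t h zeta.
Proof. by rewrite !propagate_dxE; ring. Qed.

Lemma duh_lip T M D U V s zeta :
  measurable_fun setT (fun p : time * plane R => U p.1 p.2) ->
  measurable_fun setT (fun p : time * plane R => V p.1 p.2) ->
  (forall t, bounded_by M (U t)) -> (forall t, bounded_by M (V t)) ->
  (forall t z, `|U t z - V t z| <= D * wt z) -> 0 <= s <= T ->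
  `|duh U s zeta - duh V s zeta| <= 2 * ((1 + T) * conv_const R) * M * D * wt zeta.
Proof.
move=> mU mV bU bV UV /andP[s0 sT].
have c0 := conv_const_ge0 R; have w0 := wt_ge0 zeta; have M0 := bounded_by_ge0 (bU 0).
have D0 : 0 <= D.
  by have := le_trans (normr_ge0 _) (UV 0 (0, 0)); rewrite pmulr_lge0// wt_gt0.
have -> : duh U s zeta - duh V s zeta =
    2^-1 * (\int[leb]_t (cut s t * propagate_dx (s - t) (hsq (V t)) zeta) -
            \int[leb]_t (cut s t * propagate_dx (s - t) (hsq (U t)) zeta)).
  by rewrite /duh; move: (\int[_]_t _) (\int[_]_t _) => a b; ring.
rewrite normrM gtr0_norm// -RIB; [|exact: integ_duh mV bV s zeta|exact: integ_duh mU bU s zeta].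
set I := \int[_]_x _.
have bd t : bounded_by (2 * conv_const R * M * D) (fun z => hsq (V t) z - hsq (U t) z).
  split; first by apply: mB; [case: (hsq_bounded_by (bV t))|case: (hsq_bounded_by (bU t))].
  move=> z; apply: hsq_lip => // z'; rewrite distrC; exact: UV.
have h : `|I| <= (2 * (2 * conv_const R * M * D) * wt zeta) * (1 + T).
  apply: (@le_trans _ _ (\int[leb]_t ((2 * (2 * conv_const R * M * D) * wt zeta) * kernel s zeta.1 t))).
    apply: RI_norm.
    - by apply: mB; [exact: m_duh_slice mV s zeta|exact: m_duh_slice mU s zeta].
    - move=> t; rewrite -mulrBr propagate_dxB normrM (ger0_norm (cut_ge0 _ _)).
      have := propagate_dx_bound (s - t) zeta (bd t).
      move=> /(ler_wpM2l (cut_ge0 s t)) h; apply: le_trans h _.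
      by rewrite /kernel le_eqVlt; apply/orP; left; apply/eqP; ring.
    - by apply: integZ; exact: integ_kernel.
  rewrite RIZ; last exact: integ_kernel.
  apply: ler_wpM2l; first by rewrite mulr_ge0// mulr_ge0// mulr_ge0// mulr_ge0// mulr_ge0.
  by apply: le_trans (kernel_mass _ s0) _; rewrite lerD2l.
apply: le_trans (ler_wpM2l _ h) _; first by rewrite invr_ge0.
by rewrite le_eqVlt; apply/orP; left; apply/eqP; field.
Qed.

Lemma duh_scale e M U s zeta :
  measurable_fun setT (fun p : time * plane R => U p.1 p.2) ->
  (forall t, bounded_by M (U t)) ->
  duh (fun t z => e * U t z) s zeta = e ^+ 2 * duh U s zeta.
Proof.
move=> mU bU; rewrite /duh [RHS]mulrN [in RHS]mulrCA -[in RHS]RIZ; last exact: integ_duh mU bU s zeta.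
congr (- (_ * _)); apply: RI_ext => t; rewrite [RHS]mulrCA; congr (_ * _).
rewrite -propagate_dxZ !propagate_dxE.
by rewrite !(hsq_scale e (integ_cas_prod _ (bU t))).
Qed.

(** Clipping the time defines all the curves, with uniform bounds, on the whole
    line. *)
Definition clip (T t : R) : R := Num.max 0 (Num.min t T).

Lemma clip_itv T t : 0 <= T -> 0 <= clip T t <= T.
Proof. by move=> T0; rewrite /clip le_max lexx/= ge_max T0 ge_min lexx orbT. Qed.

Lemma clip_id T t : 0 <= t <= T -> clip T t = t.
Proof. by move=> /andP[t0 tT]; rewrite /clip; rewrite (min_idPl tT) (max_idPr t0). Qed.

Lemma m_clip T d (X : measurableType d) (f : X -> R) : measurable_fun setT f ->
  measurable_fun setT (fun x => clip T (f x)).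
Proof.
move=> mf; have c0 : measurable_fun setT (fun _ : X => 0 : R) by meas.
have cT : measurable_fun setT (fun _ : X => T) by meas.
exact: (measurable_maxr c0 (measurable_minr mf cT)).
Qed.

Lemma m_propagate d (X : measurableType d) (f : X -> R) (h : plane R -> R) :
  measurable_fun setT f -> measurable_fun setT h ->
  measurable_fun setT (fun p : X * plane R => propagate (f p.1) h p.2).
Proof.
move=> mf mh.
have mK : measurable_fun setT (fun p : X * plane R => KP_symbol p.2).
  by apply: m_KP; meas.
by rewrite /propagate; meas.
Qed.

Section Picard.
Variables (T A : R) (h0 : plane R -> R).
Hypotheses (T0 : 0 <= T) (bA : bounded_by A h0).

Let A0 : 0 <= A. Proof. exact: bounded_by_ge0 bA. Qed.

Definition linear_flow (t : R) : plane R -> R := propagate (clip T t) h0.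

Lemma m_linear_flow : measurable_fun setT (fun p : time * plane R => linear_flow p.1 p.2).
Proof.
case: bA => mh _; apply: (@m_propagate _ time (clip T)) => //; apply: (@m_clip T _ time id); exact: measurable_id.
Qed.

Lemma slice_bounded_by M U : measurable_fun setT (fun p : time * plane R => U p.1 p.2) ->
  (forall t z, `|U t z| <= M * wt z) -> forall t, bounded_by M (U t).
Proof.
move=> mU h t; split; last exact: h.
exact: (measurable_fun_pair2 (f := fun p : time * plane R => U p.1 p.2) t mU).
Qed.

Lemma linear_flow_bounded t : bounded_by (2 * A) (linear_flow t).
Proof.
apply: slice_bounded_by; first exact: m_linear_flow.
move=> {}t z; have /andP[c0 _] := clip_itv t T0.
exact: propagate_bound c0 bA.
Qed.

Definition second_flow (t : R) : plane R -> R := duh linear_flow (clip T t).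

Definition duh_const : R := (1 + T) * conv_const R.

Lemma duh_const_ge0 : 0 <= duh_const.
Proof. by rewrite mulr_ge0 ?conv_const_ge0// addr_ge0. Qed.

Lemma m_clipped_duh U : measurable_fun setT (fun p : time * plane R => U p.1 p.2) ->
  measurable_fun setT (fun p : time * plane R => duh U (clip T p.1) p.2).
Proof.
move=> mU; apply: (mcompT (h := fun p : time * plane R => duh U p.1 p.2)
  (f := fun p : time * plane R => (clip T p.1, p.2)) (m_duh mU)).
apply: mpair; last by meas.
by apply: m_clip; meas.
Qed.

Variable e : R.
Hypotheses (e0 : 0 <= e) (small : 16 * duh_const * A * e <= 1).

Let M := 4 * A * e.
Let M0 : 0 <= M. Proof. by rewrite /M !mulr_ge0. Qed.

Fixpoint picard_iter (n : nat) : R -> plane R -> R :=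
  if n is n'.+1 then fun t z => e * linear_flow t z + duh (picard_iter n') (clip T t) z
  else fun _ _ => 0.

Lemma picard_step U : measurable_fun setT (fun p : time * plane R => U p.1 p.2) ->
  (forall t, bounded_by M (U t)) ->
  measurable_fun setT (fun p : time * plane R => e * linear_flow p.1 p.2 + duh U (clip T p.1) p.2)
  /\ forall t, bounded_by M (fun z => e * linear_flow t z + duh U (clip T t) z).
Proof.
move=> mU bU.
have m1 : measurable_fun setT (fun p : time * plane R => e * linear_flow p.1 p.2 + duh U (clip T p.1) p.2).
  have m0 := m_linear_flow; have m2 := m_clipped_duh mU.
  by apply: mD => //; apply: mM => //; meas.
split=> //; apply: (slice_bounded_by m1) => t z.
apply: le_trans (ler_normD _ _) _; rewrite normrM (ger0_norm e0).
have [_ h1] := linear_flow_bounded t; have h2 := duh_bound mU bU z (clip_itv t T0).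
apply: le_trans (lerD (ler_wpM2l e0 (h1 z)) h2) _.
rewrite -/duh_const; have w0 := wt_ge0 z.
rewrite mulrA -mulrDl ler_wpM2r// /M.
have ae := mulr_ge0 A0 e0; have := ler_wpM2r ae small; lra.
Qed.

Lemma picard_iter_bounded n :
  measurable_fun setT (fun p : time * plane R => picard_iter n p.1 p.2)
  /\ forall t, bounded_by M (picard_iter n t).
Proof.
elim: n => [|n [mI bI]]; last exact: picard_step.
split=> [|t]; first by rewrite /=; meas.
by split=> [|z]; [rewrite /=; meas|rewrite normr0 mulr_ge0// wt_ge0].
Qed.

Lemma picard_contract U V D :
  measurable_fun setT (fun p : time * plane R => U p.1 p.2) ->
  measurable_fun setT (fun p : time * plane R => V p.1 p.2) ->
  (forall t, bounded_by M (U t)) -> (forall t, bounded_by M (V t)) ->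
  (forall t z, `|U t z - V t z| <= D * wt z) ->
  forall t z, `|duh U (clip T t) z - duh V (clip T t) z| <= D / 2 * wt z.
Proof.
move=> mU mV bU bV UV t z.
have D0 : 0 <= D.
  by have := le_trans (normr_ge0 _) (UV 0 (0, 0)); rewrite pmulr_lge0// wt_gt0.
apply: le_trans (duh_lip z mU mV bU bV UV (clip_itv t T0)) _.
rewrite -/duh_const ler_wpM2r ?wt_ge0// /M.
have := ler_wpM2r D0 small; lra.
Qed.

(** The Duhamel map contracts by [1/2] in the weighted sup norm on the ball of radius
    [M], twice the bound of the linear part [e * linear_flow]. *)
Lemma picard_fixpoint : exists U,
  [/\ measurable_fun setT (fun p : time * plane R => U p.1 p.2),
      forall t, bounded_by M (U t)
    & forall t z, U t z = e * linear_flow t z + duh U (clip T t) z].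
Proof.
have good := picard_iter_bounded.
have step n : forall t z, `|picard_iter n.+1 t z - picard_iter n t z| <= M / 2 ^+ n * wt z.
  elim: n => [|n IH] t z.
    rewrite subr0 expr0 divr1; by have [_ /(_ t)[_]] := good 1%N.
  have [m1 b1] := good n.+1; have [m2 b2] := good n.
  rewrite [picard_iter n.+2]/= [picard_iter n.+1 t z]/= opprD addrACA subrr add0r.
  apply: le_trans (picard_contract m1 m2 b1 b2 IH t z) _.
  by rewrite le_eqVlt exprS; apply/orP; left; apply/eqP; field; rewrite expf_neq0.
have lim t z : exists l, forall n, `|l - picard_iter n t z| <= 2 * (M * wt z) / 2 ^+ n.
  by apply: geometric_cvg => n; apply: le_trans (step n t z) _; rewrite mulrAC.
pose U t z := xget 0 [set l : R | forall n, `|l - picard_iter n t z| <= 2 * (M * wt z) / 2 ^+ n].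
have UE t z n : `|U t z - picard_iter n t z| <= 2 * (M * wt z) / 2 ^+ n.
  by have := xgetPex 0 (lim t z); exact.
have Uc t z : picard_iter n t z @[n --> \oo] --> U t z.
  apply/cvgrPdist_le => d d0; have := @geometric_cvg0 R (2 * (M * wt z)).
  move=> /cvgr0Pnorm_le /(_ d d0); apply: filterS => n; apply: le_trans.
  by apply: le_trans (UE t z n) _; exact: ler_norm.
have mU : measurable_fun setT (fun p : time * plane R => U p.1 p.2).
  apply: (measurable_fun_cvg (h := fun n (p : time * plane R) => picard_iter n p.1 p.2)).
    by move=> n; have [] := good n.
  by move=> p _; exact: Uc.
have bU : forall t, bounded_by M (U t).
  apply: slice_bounded_by => // t z; rewrite -subr_le0.
  apply: (@le0_geometric _ _ (2 * (M * wt z))) => n.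
  have [_ /(_ t)[_ /(_ z) h]] := good n; have := UE t z n.
  have : `|U t z| <= `|U t z - picard_iter n t z| + `|picard_iter n t z|.
    by rewrite -{1}(subrK (picard_iter n t z) (U t z)) ler_normD.
  lra.
exists U; split => // t z; apply/eqP; rewrite -subr_eq0 -normr_le0.
apply: (@le0_geometric _ _ (2 * (M * wt z))) => n.
have [m1 b1] := good n.
have D t' z' : `|picard_iter n t' z' - U t' z'| <= 2 * M / 2 ^+ n * wt z'.
  rewrite distrC; apply: le_trans (UE t' z' n) _.
  by rewrite le_eqVlt; apply/orP; left; apply/eqP; ring.
have h1 := UE t z n.+1; have h2 := picard_contract m1 mU b1 bU D t z.
have -> : U t z - (e * linear_flow t z + duh U (clip T t) z) =
    (U t z - picard_iter n.+1 t z) + (duh (picard_iter n) (clip T t) z - duh U (clip T t) z).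
  by rewrite /=; move: (duh _ _ _) (duh _ _ _) (e * _) => a b c; ring.
apply: le_trans (ler_normD _ _) _; apply: le_trans (lerD h1 h2) _.
rewrite exprS le_eqVlt; apply/orP; left; apply/eqP; field.
by rewrite expf_neq0.
Qed.

(** The solution differs by [O(e^2)] from the linear flow, so the quadratic Duhamel
    map moves by [O(e^3)] when the solution is replaced by the linear flow. *)
Lemma picard_expansion U : measurable_fun setT (fun p : time * plane R => U p.1 p.2) ->
  (forall t, bounded_by M (U t)) ->
  (forall t z, U t z = e * linear_flow t z + duh U (clip T t) z) ->
  forall t z, `|U t z - e * linear_flow t z - e ^+ 2 * second_flow t z| <=
    (128 * duh_const ^+ 2 * A ^+ 3) * e ^+ 3 * wt z.
Proof.
move=> mU bU UE t z.
have mL : measurable_fun setT (fun p : time * plane R => e * linear_flow p.1 p.2).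
  by have m0 := m_linear_flow; apply: mM => //; meas.
have bL : forall t, bounded_by M (fun z => e * linear_flow t z).
  apply: (slice_bounded_by mL) => {}t {}z; rewrite normrM (ger0_norm e0).
  have [_ h1] := linear_flow_bounded t; apply: le_trans (ler_wpM2l e0 (h1 z)) _.
  rewrite mulrA ler_wpM2r ?wt_ge0// /M; have := mulr_ge0 A0 e0; lra.
have E : duh (fun t z => e * linear_flow t z) (clip T t) z = e ^+ 2 * second_flow t z.
  exact: (@duh_scale e _ _ _ _ m_linear_flow linear_flow_bounded).
have -> : U t z - e * linear_flow t z - e ^+ 2 * second_flow t z =
    duh U (clip T t) z - duh (fun t z => e * linear_flow t z) (clip T t) z.
  by rewrite E UE; move: (e ^+ 2 * _) (e * _) (duh _ _ _) => a b c; ring.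
have D t' z' : `|U t' z' - e * linear_flow t' z'| <= duh_const * M ^+ 2 * wt z'.
  have -> : U t' z' - e * linear_flow t' z' = duh U (clip T t') z'.
    by rewrite UE; move: (e * _) (duh _ _ _) => a b; ring.
  exact: (duh_bound mU bU z' (clip_itv t' T0)).
apply: le_trans (duh_lip z mU mL bU bL D (clip_itv t T0)) _.
rewrite -/duh_const ler_wpM2r ?wt_ge0// /M.
by rewrite le_eqVlt; apply/orP; left; apply/eqP; ring.
Qed.

End Picard.

End Duhamel.

(** * Sobolev spaces as inner product spaces *)

Section Sobolev.
Variables (R : realType) (s : R).
Implicit Types (v w : functional R) (a b : plane R -> R).

Definition sobw (z : plane R) : R :=
  japanese z.1 `^ (2 * s) * japanese z.2 `^ (2 * 0).

Lemma sobwE z : sobw z = japanese z.1 `^ (2 * s).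
Proof. by rewrite /sobw mulr0 powRr0 mulr1. Qed.

Lemma japanese_ge1 (x : R) : 1 <= japanese x.
Proof. by rewrite /japanese -[leLHS]sqrtr1 ler_wsqrtr// lerDl sqr_ge0. Qed.

Lemma japanese_gt0 (x : R) : 0 < japanese x.
Proof. exact: lt_le_trans (japanese_ge1 x). Qed.

Lemma sobw_gt0 z : 0 < sobw z.
Proof. by rewrite sobwE powR_gt0// japanese_gt0. Qed.

Lemma sobw_le1 z : s <= 0 -> sobw z <= 1.
Proof.
move=> s0; have s20 : 2 * s <= 0 by rewrite pmulr_rle0.
by have := ler_powR (japanese_ge1 z.1) s20; rewrite powRr0 -sobwE.
Qed.

Lemma m_japanese d (T : measurableType d) (f : T -> R) : measurable_fun setT f ->
  measurable_fun setT (fun x => japanese (f x)).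
Proof.
move=> mf; have c : continuous (@japanese R).
  move=> x; have := @sqrt_continuous R (1 + x ^+ 2); apply: cvg_comp.
  by apply: cvgD; [exact: cvg_cst|exact: exprn_continuous].
exact: (mcompT (continuous_measurable_fun c) mf).
Qed.

Lemma m_sobw : measurable_fun setT sobw.
Proof.
have m1 : measurable_fun setT (fun z : plane R => japanese z.1) by apply: m_japanese; meas.
have m2 : measurable_fun setT (fun z : plane R => japanese z.2) by apply: m_japanese; meas.
by apply: mM; apply: mpow.
Qed.

Definition energy a b a' b' (z : plane R) : R := sobw z * (a z * a' z + b z * b' z).

Lemma m_energy a b a' b' : measurable_fun setT a -> measurable_fun setT b ->
  measurable_fun setT a' -> measurable_fun setT b' -> measurable_fun setT (energy a b a' b').
Proof. by move=> *; have mw := m_sobw; rewrite /energy; meas. Qed.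

Lemma energy_ge0 a b z : 0 <= energy a b a b z.
Proof.
apply: mulr_ge0; first exact: ltW (sobw_gt0 z).
by rewrite -!expr2 addr_ge0// sqr_ge0.
Qed.

Lemma integ_energy a b a' b' : measurable_fun setT a -> measurable_fun setT b ->
  measurable_fun setT a' -> measurable_fun setT b' ->
  integ (mu2 R) (energy a b a b) -> integ (mu2 R) (energy a' b' a' b') ->
  integ (mu2 R) (energy a b a' b').
Proof.
move=> ma mb ma' mb' i1 i2.
apply: (@integ_le _ _ _ (mu2 R) _ (fun z => energy a b a b z + energy a' b' a' b' z)).
- exact: m_energy.
- move=> z; rewrite /energy normrM gtr0_norm ?sobw_gt0// -mulrDr.
  apply: ler_wpM2l; first exact: ltW (sobw_gt0 z).
  have h1 := sqr_ge0 (a z + a' z); have h2 := sqr_ge0 (b z + b' z).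
  have h3 := sqr_ge0 (a z - a' z); have h4 := sqr_ge0 (b z - b' z).
  have h5 := sqr_ge0 (a z); have h6 := sqr_ge0 (b z).
  have h7 := sqr_ge0 (a' z); have h8 := sqr_ge0 (b' z).
  rewrite !expr2 in h1 h2 h3 h4 h5 h6 h7 h8.
  by rewrite ler_norml; apply/andP; split; lra.
- exact: integD.
Qed.

Let Fr v : plane R -> R := fun z => complex.Re (fourier v z).
Let Fi v : plane R -> R := fun z => complex.Im (fourier v z).

Definition sob_ip v w : R := \int[mu2 R]_z energy (Fr v) (Fi v) (Fr w) (Fi w) z.

Lemma fourier_pairP v : (exists F, has_fourier v F) -> fourier_pair v (Fr v) (Fi v).
Proof. by move=> ex; apply/has_fourierE; exact: (xgetPex (fun=> 0) ex). Qed.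

Lemma fourier_pair_ex v a b : fourier_pair v a b -> exists F, has_fourier v F.
Proof. by move=> fv; exists (fun z => (a z +i* b z)%C); apply/has_fourierE. Qed.

(** The Fourier transform of a distribution is determined up to a null set only. *)
Lemma sob_ipE v w a b a' b' : fourier_pair v a b -> fourier_pair w a' b' ->
  sob_ip v w = \int[mu2 R]_z energy a b a' b' z.
Proof.
move=> fv fw; have fv' := fourier_pairP (fourier_pair_ex fv).
have fw' := fourier_pairP (fourier_pair_ex fw).
apply: RI_ae.
- by case: fv' => _ ? ? _; case: fw' => _ ? ? _; exact: m_energy.
- by case: fv => _ ? ? _; case: fw => _ ? ? _; exact: m_energy.
apply: filterS2 (fourier_pair_unique fv' fv) (fourier_pair_unique fw' fw) => z.
by rewrite /energy => -[-> ->] [-> ->].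
Qed.

Lemma sqnormE v : sobolev_sqnorm s 0 (fourier v) =
  (\int[mu2 R]_z (energy (Fr v) (Fi v) (Fr v) (Fi v) z)%:E)%E.
Proof. by []. Qed.

Definition finite_energy v a b : Prop :=
  fourier_pair v a b /\ integ (mu2 R) (energy a b a b).

Lemma sobolevP v : sobolev s 0 v <-> finite_energy v (Fr v) (Fi v).
Proof.
split=> [[ex foo]|[fv i]].
  have fv := fourier_pairP ex; split => //; case: fv => _ ma mb _.
  by apply: integ_ge0P; [exact: m_energy|exact: energy_ge0|exact: foo].
split; first exact: fourier_pair_ex fv.
by rewrite sqnormE -EFin_RI// ltry.
Qed.

Lemma sobolev_of v a b : finite_energy v a b -> sobolev s 0 v.
Proof.
move=> [fv i]; have fv' := fourier_pairP (fourier_pair_ex fv).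
apply/sobolevP; split => //; case: (fv') => _ ma' mb' _; case: (fv) => _ ma mb _.
apply: integ_ge0P; [exact: m_energy|exact: energy_ge0|].
have -> : (\int[mu2 R]_z (energy (Fr v) (Fi v) (Fr v) (Fi v) z)%:E =
    \int[mu2 R]_z (energy a b a b z)%:E)%E; last by rewrite -EFin_RI// ltry.
apply: ae_eq_integral => //.
- by apply/measurable_EFinP; exact: m_energy.
- by apply/measurable_EFinP; exact: m_energy.
- apply: filterS (fourier_pair_unique fv' fv) => z.
  by rewrite /energy => -[-> ->] _.
Qed.

Lemma sobolev_normE v : sobolev_norm s 0 v = Num.sqrt (sob_ip v v).
Proof. by rewrite /sobolev_norm sqnormE. Qed.

Lemma sob_ip_ge0 v : 0 <= sob_ip v v.
Proof. by apply: RI_ge0 => z; exact: energy_ge0. Qed.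

Lemma sobolev_norm_ge0 v : 0 <= sobolev_norm s 0 v.
Proof. exact: sqrtr_ge0. Qed.

Lemma sobolev_norm_sqr v : sobolev_norm s 0 v ^+ 2 = sob_ip v v.
Proof. by rewrite sobolev_normE sqr_sqrtr// sob_ip_ge0. Qed.

Lemma sob_ipC v w : sob_ip v w = sob_ip w v.
Proof. by apply: RI_ext => z; rewrite /energy; ring. Qed.

Lemma finite_energy_lc c v w a b a' b' : finite_energy v a b -> finite_energy w a' b' ->
  finite_energy (c *: v + w : functional R) (fun z => c * a z + a' z) (fun z => c * b z + b' z).
Proof.
move=> [fv i1] [fw i2]; split; first exact: fourier_pair_lc.
case: fv => _ ma mb _; case: fw => _ ma' mb' _.
have i3 := integ_energy ma mb ma' mb' i1 i2.
have := integD (integZ (c ^+ 2) i1) (integD (integZ (2 * c) i3) i2).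
by apply: integ_ext => z; rewrite /energy; ring.
Qed.

Lemma sobolev_lc c v w : sobolev s 0 v -> sobolev s 0 w ->
  sobolev s 0 (c *: v + w : functional R).
Proof.
by move=> /sobolevP hv /sobolevP hw; exact: sobolev_of (finite_energy_lc c hv hw).
Qed.

Lemma sob_ip_lc c v v' w : sobolev s 0 v -> sobolev s 0 v' -> sobolev s 0 w ->
  sob_ip (c *: v + v' : functional R) w = c * sob_ip v w + sob_ip v' w.
Proof.
move=> /sobolevP[fv i1] /sobolevP[fv' i2] /sobolevP[fw i3].
rewrite (sob_ipE (fourier_pair_lc c fv fv') fw).
case: (fv) => _ ma mb _; case: (fv') => _ ma' mb' _; case: (fw) => _ mc md _.
have j1 := integ_energy ma mb mc md i1 i3; have j2 := integ_energy ma' mb' mc md i2 i3.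
rewrite /sob_ip -RIZ// -RID//; last exact: integZ.
by apply: RI_ext => z; rewrite /energy; ring.
Qed.

Lemma fourier_pair0 : fourier_pair (0 : functional R) (fun=> 0) (fun=> 0).
Proof.
split; [|by meas|by meas|].
- split.
  + by apply/funext => psi; rewrite patchE; case: ifP.
  + by move=> c psi1 psi2 _ _; rewrite -[LHS]/(0 : R) -[RHS]/(c * 0 + 0) mulr0 addr0.
  + by exists 0, 0%N => psi M _ _; rewrite -[X in `|X|]/(0 : R) normr0 mul0r.
- move=> psi sp.
  have E : (fun z : plane R => 0 * psi z) = (fun=> 0) by apply/funext => z; rewrite mul0r.
  by rewrite E RI0; split => //; exact: integ0.
Qed.

Lemma sobolev0 : sobolev s 0 (0 : functional R).
Proof.
apply: sobolev_of; split; first exact: fourier_pair0.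
apply: integ_ext (integ0 (mu2 R)) => z; by rewrite /energy; ring.
Qed.

Lemma sob_ip0 w : sob_ip (0 : functional R) w = 0.
Proof.
have F0 : fourier_pair (0 : functional R) (fun=> 0) (fun=> 0) by exact: fourier_pair0.
apply: (@eq_trans _ _ (\int[mu2 R]_z (0 : R))); last exact: RI0.
have [ex|nex] := pselect (exists F, has_fourier w F).
  rewrite (sob_ipE F0 (fourier_pairP ex)); apply: RI_ext => z; rewrite /energy; ring.
apply: RI_ext => z; rewrite /energy /Fr /Fi.
have -> : fourier w = fun=> 0.
  by apply: xgetPN => F hF; apply: nex; exists F.
by rewrite /=; ring.
Qed.

Lemma sobolevZ c v : sobolev s 0 v -> sobolev s 0 (c *: v : functional R).
Proof. by move=> hv; have := sobolev_lc c hv sobolev0; rewrite addr0. Qed.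

Lemma sobolevB v w : sobolev s 0 v -> sobolev s 0 w -> sobolev s 0 (v - w : functional R).
Proof. by move=> hv hw; have := sobolev_lc (-1) hw hv; rewrite scaleN1r addrC. Qed.

Lemma sob_ipZ c v w : sobolev s 0 v -> sobolev s 0 w ->
  sob_ip (c *: v : functional R) w = c * sob_ip v w.
Proof.
by move=> hv hw; have := sob_ip_lc c hv sobolev0 hw; rewrite addr0 sob_ip0 addr0.
Qed.

Lemma sobolev_normZ c v : sobolev s 0 v ->
  sobolev_norm s 0 (c *: v : functional R) = `|c| * sobolev_norm s 0 v.
Proof.
move=> hv; have hc := sobolevZ c hv.
rewrite !sobolev_normE sob_ipZ// sob_ipC sob_ipZ// mulrA -expr2 sqrtrM ?sqr_ge0//.
by rewrite sqrtr_sqr.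
Qed.

(** Cauchy-Schwarz, from the sign of the quadratic polynomial
    [c |-> |c v + w|^2]. *)
Lemma sob_ip_CS v w : sobolev s 0 v -> sobolev s 0 w ->
  `|sob_ip v w| <= sobolev_norm s 0 v * sobolev_norm s 0 w.
Proof.
move=> hv hw.
have Q c : 0 <= c ^+ 2 * sob_ip v v + 2 * c * sob_ip v w + sob_ip w w.
  have hl := sobolev_lc c hv hw; have := sob_ip_ge0 (c *: v + w : functional R).
  rewrite sob_ip_lc// [sob_ip v _]sob_ipC [sob_ip w _]sob_ipC !sob_ip_lc// [sob_ip w v]sob_ipC.
  lra.
have A0 := sob_ip_ge0 v; have C0 := sob_ip_ge0 w.
have key : sob_ip v w ^+ 2 <= sob_ip v v * sob_ip w w.
  move: Q A0 C0; move: (sob_ip v v) (sob_ip v w) (sob_ip w w) => A B C Q A0 C0.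
  have [A00|An0] := eqVneq A 0.
    suff -> : B = 0 by rewrite expr0n/= A00 mul0r.
    apply/eqP; apply/negPn/negP => B0.
    have := Q (- (C + 1) / (2 * B)); rewrite A00 mulr0 add0r.
    rewrite (_ : _ + C = -1); last by field.
    by rewrite ler0N1.
  have Ap : 0 < A by rewrite lt_neqAle eq_sym An0.
  have := Q (- B / A); rewrite (_ : _ + C = C - B ^+ 2 / A); last by field.
  by rewrite subr_ge0 ler_pdivrMr// mulrC.
rewrite -(@ler_pXn2r _ 2)// ?nnegrE// ?mulr_ge0 ?sobolev_norm_ge0//.
by rewrite real_normK ?num_real// exprMn !sobolev_norm_sqr.
Qed.

Lemma sobolev_norm_lc c v w : sobolev s 0 v -> sobolev s 0 w ->
  sobolev_norm s 0 (c *: v + w : functional R) <=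
    `|c| * sobolev_norm s 0 v + sobolev_norm s 0 w.
Proof.
move=> hv hw; have hl := sobolev_lc c hv hw; have CS := sob_ip_CS hv hw.
have n1 := sobolev_norm_ge0 v; have n2 := sobolev_norm_ge0 w.
rewrite -(@ler_pXn2r _ 2)// ?nnegrE ?sobolev_norm_ge0//; last by rewrite addr_ge0// mulr_ge0.
rewrite sobolev_norm_sqr sob_ip_lc// [sob_ip v _]sob_ipC [sob_ip w _]sob_ipC !sob_ip_lc//.
rewrite [sob_ip w v]sob_ipC -!sobolev_norm_sqr.
rewrite [leRHS]sqrrD exprMn real_normK ?num_real//.
have h : c * sob_ip v w <= `|c| * (sobolev_norm s 0 v * sobolev_norm s 0 w).
  by apply: le_trans (ler_norm _) _; rewrite normrM ler_wpM2l.
move: h; move: (sobolev_norm _ _ v) (sobolev_norm _ _ w) (sob_ip v w) => x y t h; lra.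
Qed.

Section Curves.
Variable T : R.
Hypothesis T0 : 0 <= T.
Implicit Type u : R -> functional R.

Lemma curve_sobolev u t : sobolev_curve T s 0 u -> 0 <= t <= T -> sobolev s 0 (u t).
Proof. by move=> [_ h _]; exact: h. Qed.

Lemma sobolev_curve_lc c u (w : R -> functional R) : sobolev_curve T s 0 u -> sobolev_curve T s 0 w ->
  sobolev_curve T s 0 (c *: u + w : R -> functional R).
Proof.
move=> [ru su cu] [rw sw cw]; split.
- apply/funext => t; rewrite patchE; case: ifPn => // nt.
  rewrite -[RHS]/(c *: u t + w t) -ru -rw !patchE (negPf nt).
  by rewrite -[point]/(0 : functional R) scaler0 addr0.
- by move=> t tT; apply: sobolev_lc; [exact: su|exact: sw].
- move=> t tT.
  apply: (@squeeze_cvgr _ _ _ _ (fun=> 0) (fun t' => `|c| * sobolev_norm s 0 (u t' - u t) +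
     sobolev_norm s 0 (w t' - w t))); last 2 first.
  + exact: cvg_cst.
  + rewrite -[X in _ --> X]addr0 -[X in X + _](mulr0 `|c|).
    by apply: cvgD; [apply: cvgM; [exact: cvg_cst|exact: cu]|exact: cw].
  + rewrite near_withinE; near=> t' => t'T; rewrite sobolev_norm_ge0/=.
    have -> : (c *: u + w : R -> functional R) t' - (c *: u + w : R -> functional R) t =
        c *: (u t' - u t : functional R) + (w t' - w t : functional R).
      rewrite -[(c *: u + w) t']/(c *: u t' + w t') -[(c *: u + w) t]/(c *: u t + w t).
      by rewrite scalerBr opprD addrACA.
    have t'T' : 0 <= t' <= T by move: t'T; rewrite /= in_itv.
    by apply: sobolev_norm_lc; apply: sobolevB; (apply: su || apply: sw).
Unshelve. all: by end_near. Qed.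

Lemma sobolev_norm_dist v w : sobolev s 0 v -> sobolev s 0 w ->
  `|sobolev_norm s 0 v - sobolev_norm s 0 w| <= sobolev_norm s 0 (v - w : functional R).
Proof.
move=> hv hw; have h1 := sobolev_norm_lc 1 (sobolevB hv hw) hw.
have h2 := sobolev_norm_lc (-1) (sobolevB hv hw) hv.
rewrite scale1r subrK normr1 mul1r in h1.
rewrite scaleN1r opprB subrK normrN normr1 mul1r in h2.
by rewrite ler_norml; apply/andP; split; lra.
Qed.

Lemma curve_norm_ge u t : sobolev_curve T s 0 u -> 0 <= t <= T ->
  sobolev_norm s 0 (u t) <= curve_norm T s 0 u.
Proof.
move=> hu tT; have [_ su cu] := hu.
have cN : {within `[0, T], continuous (fun t => sobolev_norm s 0 (u t))}.
  apply/subspace_continuousP => x; rewrite /= in_itv/= => xT.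
  apply/cvgrPdist_le => e e0.
  have := cu x xT; move/cvgr0Pnorm_le => /(_ e e0).
  rewrite !near_withinE; apply: filterS => y h yT.
  have yT' : 0 <= y <= T by move: yT; rewrite /= in_itv.
  have := h yT; rewrite ger0_norm ?sobolev_norm_ge0//; apply: le_trans.
  by rewrite distrC; apply: sobolev_norm_dist; exact: su.
have [c cT hc] := EVT_max T0 cN.
apply: ub_le_sup; last by exists t => //=; rewrite in_itv.
by exists (sobolev_norm s 0 (u c)) => _ [x xT <-]; apply: hc; move: xT; rewrite /= inE.
Qed.

End Curves.

End Sobolev.

(** * Sobolev norms on the Hartley side *)

Section HdistSobolev.
Variables (R : realType) (s : R).
Hypothesis s0 : s <= 0.
Implicit Types h k : plane R -> R.

Lemma hart_lc c h k zeta : integ (mu2 R) h -> integ (mu2 R) k ->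
  hart (fun z => c * h z + k z) zeta = c * hart h zeta + hart k zeta.
Proof.
move=> ih ik; have mp : measurable_fun setT (fun z : plane R => pdot z zeta) by meas.
have j1 := integ_casM ih mp; have j2 := integ_casM ik mp.
rewrite /hart -RIZ// -RID//; last exact: integZ.
by apply: RI_ext => z; rewrite mulrDl mulrA.
Qed.

Lemma hdist_lc c h k : integ (mu2 R) h -> integ (mu2 R) k ->
  hdist (fun z => c * h z + k z) = c *: hdist h + hdist k :> functional R.
Proof.
move=> ih ik; apply/funext => psi.
rewrite -[RHS]/(c * hdist h psi + hdist k psi).
have [sp|nsp] := pselect (schwartz psi); last first.
  by rewrite /hdist !patchE; case: ifP => [/set_mem//|_]; rewrite mulr0 addr0.
have ihk : integ (mu2 R) (fun z => c * h z + k z) by apply: integD => //; exact: integZ.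
rewrite !hdistE//; have j1 := integ_hfunM ih sp; have j2 := integ_hfunM ik sp.
rewrite -RIZ// -RID//; last exact: integZ.
by apply: RI_ext => z; rewrite /hfun hart_lc//; ring.
Qed.

Lemma hdist_energy h k z : energy s (hev h) (hod h) (hev k) (hod k) z =
  sobw s z * ((h z * k z + h (popp z) * k (popp z)) / 2).
Proof. by rewrite /energy /hev /hod; field. Qed.

Lemma hdist_energy_le M h z : bounded_by M h ->
  energy s (hev h) (hod h) (hev h) (hod h) z <= M ^+ 2 * wt z.
Proof.
move=> bh; have [mh hM] := bh; rewrite hdist_energy.
have M0 := bounded_by_ge0 bh; have w0 := wt_ge0 z; have w1' := wt_le1 z.
have sq u : h u ^+ 2 <= M ^+ 2 * wt u.
  have := hM u; rewrite -(real_normK (num_real (h u))) => hu.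
  apply: (@le_trans _ _ ((M * wt u) ^+ 2)).
    by rewrite ler_pXn2r// nnegrE ?normr_ge0// mulr_ge0// wt_ge0.
  rewrite exprMn; apply: ler_wpM2l; first exact: sqr_ge0.
  by rewrite expr2 ler_piMr ?wt_ge0// wt_le1.
have h1 := sq z; have h2 := sq (popp z); rewrite wt_popp in h2.
apply: (@le_trans _ _ (1 * ((h z * h z + h (popp z) * h (popp z)) / 2))).
  apply: ler_wpM2r; last exact: sobw_le1.
  by apply: divr_ge0 => //; apply: addr_ge0; rewrite -expr2 sqr_ge0.
rewrite mul1r -!expr2; lra.
Qed.

Lemma finite_energy_hdist M h : bounded_by M h -> finite_energy s (hdist h) (hev h) (hod h).
Proof.
move=> bh; have ih := bounded_by_integ bh; have fh := fourier_hdist ih.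
split => //; case: (fh) => _ ma mb _.
apply: (@integ_le _ _ _ (mu2 R) _ (fun z => M ^+ 2 * wt z)).
- exact: m_energy.
- by move=> z; rewrite ger0_norm ?energy_ge0//; exact: hdist_energy_le.
- by apply: integZ; exact: integ_wt.
Qed.

Lemma sobolev_hdist M h : bounded_by M h -> sobolev s 0 (hdist h).
Proof. by move=> /finite_energy_hdist; exact: sobolev_of. Qed.

Lemma sob_ip_hdist M h : bounded_by M h -> sob_ip s (hdist h) (hdist h) =
  \int[mu2 R]_z energy s (hev h) (hod h) (hev h) (hod h) z.
Proof. by move=> bh; case: (finite_energy_hdist bh) => fh _; exact: sob_ipE. Qed.

Lemma sobolev_norm_hdist_le M h : bounded_by M h ->
  sobolev_norm s 0 (hdist h) <= M * Num.sqrt (wt_mass R).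
Proof.
move=> bh; have M0 := bounded_by_ge0 bh; have [_ ie] := finite_energy_hdist bh.
rewrite sobolev_normE (sob_ip_hdist bh).
have -> : M * Num.sqrt (wt_mass R) = Num.sqrt (M ^+ 2 * wt_mass R).
  by rewrite sqrtrM ?sqr_ge0// sqrtr_sqr ger0_norm.
rewrite ler_wsqrtr// /wt_mass -RIZ; last exact: integ_wt.
apply: RI_le => //; first by apply: integZ; exact: integ_wt.
by move=> z; exact: hdist_energy_le.
Qed.

End HdistSobolev.

(** * The constructed flow solves the Duhamel equation *)

Section Solution.
Variable R : realType.
Notation leb := (@lebesgue_measure R).
Notation time := (measurableTypeR R).
Implicit Types (t : R) (h k : plane R -> R) (z zeta : plane R).

Lemma clip_lip (T t t' : R) : `|clip T t - clip T t'| <= `|t - t'|.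
Proof.
have h := ler_norm (t - t'); have h' := ler_norm (t' - t); rewrite distrC in h'.
rewrite ler_norml /clip; apply/andP.
by case: (leP t T) => ?; case: (leP t' T) => ?; 
  case: (leP 0 t) => ?; case: (leP 0 t') => ?; case: (leP 0 T) => ?; split; lra.
Qed.

Lemma continuous_clip (T : R) : continuous (clip T).
Proof.
move=> t; apply/cvgrPdist_le => e e0; near=> t'.
by apply: le_trans (clip_lip _ _ _) _; near: t'; exact: cvgr_dist_le.
Unshelve. all: by end_near. Qed.

Lemma continuous_propagate h zeta : continuous (fun t => propagate t h zeta).
Proof.
pose K := KP_symbol zeta; pose a := h zeta; pose b := h (popp zeta).
apply: (@is_derive_continuous R _ (fun t =>
  - zeta.1 ^+ 2 * expR (- (zeta.1 ^+ 2 * t)) * (cos (t * K) * a - sin (t * K) * b) +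
  expR (- (zeta.1 ^+ 2 * t)) * (- (sin (t * K) * K) * a - cos (t * K) * K * b))) => t.
rewrite /propagate -/K -/a -/b.
by apply: is_derive_eq; rewrite /GRing.scale/=; ring.
Qed.

Section Continuity.
Variables (T M : R) (U : R -> plane R -> R).
Hypotheses (mU : measurable_fun setT (fun p : time * plane R => U p.1 p.2))
  (bU : forall t, bounded_by M (U t)).

Lemma cut_near (u : nat -> R) l t : u n @[n --> \oo] --> l -> t != l ->
  \forall n \near \oo, cut (u n) t = cut l t.
Proof.
move=> ul tl; rewrite neq_lt in tl; case/orP: tl => tl.
- near=> n; rewrite !cutE tl; have -> // : t < u n.
  by near: n; exact: (cvgr_gt l).
- near=> n; rewrite !cutE (lt_gtF tl).
  have -> // : (t < u n) = false.
  by apply: lt_gtF; near: n; exact: (cvgr_lt l).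
Unshelve. all: by end_near. Qed.

(** Dominated convergence; the integrand is continuous in the upper end [l] except
    at [t = l]. *)
Lemma duh_continuous zeta (u : nat -> R) l : (forall n, u n <= T) ->
  u n @[n --> \oo] --> l -> duh U (u n) zeta @[n --> \oo] --> duh U l zeta.
Proof.
move=> uT ul; apply: cvgN; apply: cvgM; first exact: cvg_cst.
apply: (@RI_dominated _ _ _ leb (fun (n : nat) t => cut (u n) t * propagate_dx (u n - t) (hsq (U t)) zeta)
  _ (fun t => (2 * (conv_const R * M ^+ 2) * wt zeta * `|zeta.1|) * \1_(`[0, T]%classic) t)).
- by move=> n; exact: (m_duh_slice mU).
- exact: (m_duh_slice mU).
- by apply: integZ; exact: integ_indic_itv.
- exists [set l]; split; [exact: measurable_set1|exact: lebesgue_measure_set1|].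
  move=> t /=; apply: contra_notP => /eqP tl.
  have E := cut_near ul tl.
  have c1 : cut (u n) t @[n --> \oo] --> cut l t by exact: cvg_near_cst.
  apply: cvgM => //; apply: (@cvg_comp _ _ _ (fun n => u n - t) (fun r => propagate_dx r (hsq (U t)) zeta) _ (nbhs (l - t))).
    by apply: cvgB => //; exact: cvg_cst.
  exact: continuous_propagate.
- move=> n t; have hb := duh_integrand_bound bU (u n) zeta t.
  apply: le_trans hb _.
  rewrite -[leRHS]mulrA; apply: ler_wpM2l.
    rewrite mulr_ge0 ?wt_ge0// mulr_ge0// mulr_ge0 ?conv_const_ge0//; exact: sqr_ge0.
  have /andP[_ h] := kernel_le (u n) zeta.1 t; apply: le_trans h _.
  rewrite mulrC; apply: ler_wpM2l => //; rewrite !indicE ler_nat.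
  case: (boolP (t \in `[0, u n]%classic)) => // tu.
  move: tu; rewrite inE/= in_itv/= => /andP[t0 tu].
  by rewrite mem_set//= in_itv/= t0 (le_trans tu).
Qed.

End Continuity.

Section Flow.
Variables (T A e s : R) (h0 : plane R -> R) (U : R -> plane R -> R).
Hypotheses (T0 : 0 <= T) (s0 : s <= 0) (bA : bounded_by A h0) (e0 : 0 <= e).
Let M := 4 * A * e.
Hypotheses (mU : measurable_fun setT (fun p : time * plane R => U p.1 p.2))
  (bU : forall t, bounded_by M (U t))
  (UE : forall t z, U t z = e * linear_flow T h0 t z + duh U (clip T t) z).

Lemma flow_continuous z (u : nat -> R) t : u n @[n --> \oo] --> t ->
  U (u n) z @[n --> \oo] --> U t z.
Proof.
move=> ut; have cu : clip T (u n) @[n --> \oo] --> clip T t.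
  by apply: cvg_comp ut _; exact: continuous_clip.
rewrite UE; under eq_fun do rewrite UE.
apply: cvgD.
  apply: cvgM; first exact: cvg_cst.
  exact: (cvg_comp _ _ cu (@continuous_propagate h0 z (clip T t))).
have cT n : clip T (u n) <= T by have /andP[] := clip_itv (u n) T0.
exact: (duh_continuous mU bU cT cu).
Qed.

Definition flow_curve : R -> functional R := (fun t => hdist (U t)) \_ `[0, T].

Lemma flow_curveE t : 0 <= t <= T -> flow_curve t = hdist (U t).
Proof. by move=> tT; rewrite /flow_curve patchE mem_set//= in_itv. Qed.

Lemma flow_curveB t t' : (hdist (U t') - hdist (U t) : functional R) =
  hdist (fun z => (-1) * U t z + U t' z).
Proof.
by rewrite hdist_lc ?scaleN1r 1?addrC//; exact: bounded_by_integ (bU _).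
Qed.

Lemma bounded_by_lc c a b h k : bounded_by a h -> bounded_by b k ->
  bounded_by (`|c| * a + b) (fun z => c * h z + k z).
Proof.
move=> [mh hh] [mk hk]; split; first by meas.
move=> z; apply: le_trans (ler_normD _ _) _; rewrite normrM mulrDl -mulrA.
by apply: lerD => //; apply: ler_wpM2l.
Qed.

(** Pointwise continuity in time on the frequency side, dominated by the weight. *)
Lemma flow_norm_cvg t : sobolev_norm s 0 (hdist (U t') - hdist (U t) : functional R)
  @[t' --> t] --> (0 : R).
Proof.
apply/(@cvg_nbhsP _ R^o) => u ut.
have b1 n : bounded_by (2 * M) (fun z => (-1) * U t z + U (u n) z).
  have := bounded_by_lc (-1) (bU t) (bU (u n)).
  by rewrite normrN normr1 mul1r (_ : M + M = 2 * M)//; ring.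
have -> : (fun n => sobolev_norm s 0 (hdist (U (u n)) - hdist (U t) : functional R)) =
    (fun n => Num.sqrt (\int[mu2 R]_z
      (sobw s z * (((-1 * U t z + U (u n) z) ^+ 2 +
        (-1 * U t (popp z) + U (u n) (popp z)) ^+ 2) / 2)))).
  apply/funext => n; rewrite flow_curveB sobolev_normE (sob_ip_hdist s0 (b1 n)).
  by congr Num.sqrt; apply: RI_ext => z; rewrite hdist_energy !expr2.
have mw := m_sobw s; have mUt t' : measurable_fun setT (U t') by case: (bU t').
pose G n z := sobw s z * (((-1 * U t z + U (u n) z) ^+ 2 +
  (-1 * U t (popp z) + U (u n) (popp z)) ^+ 2) / 2).
suff key : \int[mu2 R]_z G n z @[n --> \oo] --> \int[mu2 R]_z (0 : R).
  rewrite RI0 in key; rewrite -[X in _ --> X]sqrtr0.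
  exact: (cvg_comp _ _ key (@sqrt_continuous R 0)).
rewrite /G; apply: (@RI_dominated _ _ _ (mu2 R) G _ (fun z => (2 * M) ^+ 2 * wt z)); rewrite /G.
- by move=> n; have m1 := mUt t; have m2 := mUt (u n); meas.
- by meas.
- by apply: integZ; exact: integ_wt.
- apply: aeW => z.
  have c0 z' : -1 * U t z' + U (u n) z' @[n --> \oo] --> (0 : R).
    have : -1 * U t z' + U (u n) z' @[n --> \oo] --> -1 * U t z' + U t z'.
      by apply: cvgD; [exact: cvg_cst|exact: (flow_continuous ut)].
    by rewrite mulN1r addNr.
  have c1 z' : (-1 * U t z' + U (u n) z') ^+ 2 @[n --> \oo] --> (0 : R).
    have h := cvgM (c0 z') (c0 z'); rewrite mulr0 in h; exact: h.
  have cst (c : R) : (fun _ : nat => c) @ \oo --> c by exact: cvg_cst.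
  have h := cvgM (cst (sobw s z)) (cvgM (cvgD (c1 z) (c1 (popp z))) (cst 2^-1)).
  rewrite addr0 mul0r mulr0 in h; exact: h.
- move=> n z; have := hdist_energy_le s0 z (b1 n).
  rewrite hdist_energy -!expr2 ger0_norm//.
  apply: mulr_ge0; first exact: ltW (sobw_gt0 _ _).
  by apply: divr_ge0 => //; apply: addr_ge0; exact: sqr_ge0.
Qed.

Lemma flow_sobolev_curve : sobolev_curve T s 0 flow_curve.
Proof.
split.
- by apply/funext => t; rewrite /flow_curve !patchE; case: (t \in _).
- by move=> t tT; rewrite flow_curveE//; exact: (sobolev_hdist s0 (bU t)).
- move=> t tT; rewrite (flow_curveE tT).
  apply: cvg_trans (cvg_within_filter `[0, T]%classic (flow_norm_cvg t)).
  apply: near_eq_cvg; rewrite near_withinE; apply: nearW => t' t'T.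
  by rewrite flow_curveE//; move: t'T; rewrite /= in_itv.
Qed.

Lemma hartM_bound psi : schwartz psi ->
  exists2 C, 0 <= C & forall z, `|z.1| * `|hart psi z| <= C.
Proof.
move=> sp; have [C hC] := schwartz_rapid 0 0 (schwartz_fst (schwartz_hart sp)) 0%N.
exists C; first by apply: le_trans (hC 0); rewrite expr0 mul1r.
by move=> z; have := hC z; rewrite expr0 mul1r normrM.
Qed.

(** Tested against [psi], both sides become integrals against the Schwartz function
    [hart psi], and Fubini moves the time integral inside.  The time [t' = t], at
    which there is no dissipation, is left out. *)
Lemma flow_duhamel t : 0 <= t <= T -> duhamel (e *: hdist h0 : functional R) flow_curve t.
Proof.
move=> tT; have /andP[t0 t_le_T] := tT.
have M0 : 0 <= M := bounded_by_ge0 (bU 0).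
have bsq t' := hsq_bounded_by (bU t').
have [mh0 _] := bA; have ih0 := bounded_by_integ bA.
have beh : bounded_by (e * A) (fun z => e * h0 z).
  split; first by meas.
  by move=> z; rewrite normrM ger0_norm// -mulrA ler_wpM2l//; case: bA.
have ip := integ_propagate t0 beh.
have pE z : propagate t (fun z => e * h0 z) z = e * linear_flow T h0 t z.
  by rewrite /linear_flow clip_id// /propagate; ring.
pose N t' : functional R := if t' < t then hdist (propagate_dx (t - t') (hsq (U t'))) else 0.
exists (hdist (propagate t (fun z => e * h0 z))), N; split.
- apply: evolves_hdist => //.
  have := fourier_hdist (bounded_by_integ beh).
  have -> // : hdist (fun z => e * h0 z) = (e *: hdist h0 : functional R).
  apply/funext => psi; rewrite -[RHS]/(e * hdist h0 psi).
  have [sp|nsp] := pselect (schwartz psi); last first.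
    by rewrite /hdist !patchE; case: ifP => [/set_mem//|_]; rewrite mulr0.
  rewrite !hdist_pairing//; last exact: bounded_by_integ beh.
  rewrite mulrCA -[e * \int[_]_z _]RIZ; last by apply: integ_Mschwartz => //; exact: schwartz_hart.
  by congr (_ * _); apply: RI_ext => z; rewrite mulrA.
- exists [set t]; split; [exact: measurable_set1|exact: lebesgue_measure_set1|].
  move=> t' /=; apply: contra_notP => t't /andP[t'0 t'le].
  have t'lt : t' < t by rewrite lt_neqAle t'le andbT; apply/eqP.
  exists (hdist (hsq (U t'))).
    by rewrite flow_curveE ?t'0 ?(le_trans t'le)//; exact: is_square_hdist (bU t').
  rewrite /N t'lt; apply: evolves_dx_hdist; first exact: bounded_by_integ (bsq t').
  by apply: integ_propagate_dx (bsq t'); rewrite subr_gt0.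
- move=> psi sp; have sh := schwartz_hart sp; have [C C0 hC] := hartM_bound sp.
  have mH := schwartz_measurable sh.
  pose f (t' : time) z := cut t t' * propagate_dx (t - t') (hsq (U t')) z * hart psi z.
  have mf : measurable_fun setT (fun p : time * plane R => f p.1 p.2).
    apply: mM; last by meas.
    by apply: (mcompT (f := fun p : time * plane R => ((t, p.2), p.1)) (m_duh_integrand mU)); meas.
  have fB t' z : `|f t' z| <= \1_(`[0, t]%classic) t' *
      (2 * (conv_const R * M ^+ 2) * C * wt z).
    rewrite /f normrM; apply: le_trans (ler_wpM2r (normr_ge0 _) (duh_integrand_bound bU _ _ _)) _.
    have /andP[_ k1] := kernel_le t z.1 t'.
    have w0 : 0 <= 2 * (conv_const R * M ^+ 2) * wt z.
      by rewrite mulr_ge0 ?wt_ge0// mulr_ge0// mulr_ge0 ?conv_const_ge0// sqr_ge0.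
    apply: (@le_trans _ _ (2 * (conv_const R * M ^+ 2) * wt z *
      (\1_(`[0, t]%classic) t' * `|z.1|) * `|hart psi z|)).
      by apply: ler_wpM2r => //; apply: ler_wpM2l.
    have i0 : (0 : R) <= \1_(`[0, t]%classic) t' by rewrite indicE.
    have := ler_wpM2l (mulr_ge0 w0 i0) (hC z); move: (\1__ _) => i.
    by rewrite [leRHS](_ : _ = i * (2 * (conv_const R * M ^+ 2) * C * wt z)); [lra|ring].
  pose n t' := \int[mu2 R]_z f t' z.
  have ik : integ (mu2 R) (fun z => 2 * (conv_const R * M ^+ 2) * C * wt z).
    by apply: integZ; exact: integ_wt.
  have inn : integ leb n := @integ_paramr_dom _ _ _ _ _ leb (leb2 R) f _ _ mf (integ_indic_itv 0 t) ik fB.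
  have sw := @RI_swap_dom _ _ _ _ _ leb (leb2 R) f _ _ mf (integ_indic_itv 0 t) ik fB.
  have nE t' : 0 <= t' <= t -> N t' psi = hkap R * n t'.
    move=> /andP[t'0 t't]; rewrite /N /n /f cutE t'0/=; case: ifPn => t'lt.
      rewrite hdist_pairing//; last first.
        by apply: integ_propagate_dx (bsq t'); rewrite subr_gt0.
      by congr (_ * _); apply: RI_ext => z; rewrite mul1r.
    rewrite -[LHS]/(0 : R) -[LHS](mulr0 (hkap R)); congr (_ * _).
    by rewrite -[LHS](RI0 (mu2 R)); apply: RI_ext => z; rewrite /= !mul0r.
  have n0 t' : ~~ (0 <= t' <= t) -> n t' = 0.
    move=> nt; rewrite /n -(RI0 (mu2 R)); apply: RI_ext => z.
    rewrite /f cutE ifF ?mul0r//; apply/negP => /andP[a b].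
    by move: nt; rewrite a ltW.
  have nI t' : \1_(`[0, t]%classic) t' * (N t' psi) = hkap R * n t'.
    rewrite indicE; have [tin|tin] := boolP (t' \in _).
      by rewrite mul1r nE//; move: tin; rewrite inE/= in_itv.
    rewrite mul0r n0 ?mulr0//; apply: contra tin => h.
    by rewrite inE/= in_itv.
  have in' : integ leb (fun t' => hkap R * n t') by exact: integZ.
  split.
    have mI : measurable (`[0, t]%classic : set time) by exact: measurable_itv.
    apply: (eq_integrable mI (EFin \o (fun t' => hkap R * n t')) _).
      by move=> t' /set_mem; rewrite /= in_itv/= => h; rewrite nE.
    exact: (integrableS measurableT mI).
  have nII : \int[leb]_t' (\1_(`[0, t]%classic) t' * N t' psi) =
      hkap R * \int[mu2 R]_z \int[leb]_t' f t' z.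
    by rewrite -sw -RIZ//; exact: RI_ext.
  rewrite flow_curveE// RI_itv_indic nII.
  rewrite !hdist_pairing//; last exact: bounded_by_integ (bU t).
  have i1 : integ (mu2 R) (fun z => propagate t (fun z => e * h0 z) z * hart psi z).
    exact: integ_Mschwartz.
  have i2 : integ (mu2 R) (fun z => \int[leb]_t' f t' z).
    have mf' : measurable_fun setT (fun p : plane R * time => f p.2 p.1).
      by apply: (mcompT (f := fun p : plane R * time => (p.2, p.1)) mf); meas.
    apply: (@integ_paramr_dom _ _ _ _ _ (leb2 R) leb (fun z t' => f t' z) _ _ mf' ik (integ_indic_itv 0 t)).
    by move=> z t'; rewrite mulrC.
  have -> : \int[mu2 R]_z (U t z * hart psi z) =
      \int[mu2 R]_z (propagate t (fun z => e * h0 z) z * hart psi z) -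
      2^-1 * \int[mu2 R]_z \int[leb]_t' f t' z.
    rewrite -RIZ// -RIB//; last exact: integZ.
    apply: RI_ext => z; rewrite UE clip_id// pE /duh /f RIZr; last exact: integ_duh mU bU t z.
    by move: (\int[_]_t' _) (e * _) (hart _ _) => a b c; ring.
  by move: (\int[_]_z _) (\int[_]_z _) => a b; ring.
Qed.

Lemma flow_solution : KPBI_solution T s 0 (e *: hdist h0 : functional R) flow_curve.
Proof. by split; [exact: flow_sobolev_curve|exact: flow_duhamel]. Qed.

End Flow.

End Solution.

(** * The second Picard iterate as an interaction integral *)

Section SecondIterate.
Variable R : realType.
Notation leb := (@lebesgue_measure R).
Notation time := (measurableTypeR R).
Implicit Types (t : R) (h k : plane R -> R) (z zeta a b : plane R).

Definition resonance a zeta : R :=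
  KP_symbol a + KP_symbol (psub zeta a) - KP_symbol zeta.

Definition damped (h0 : plane R -> R) (tau : R) a : R :=
  expR (- (a.1 ^+ 2 * tau)) * h0 a.

(** Pairs of frequencies of sum [zeta], weighted by their dissipation and by the real
    part of the oscillation accumulated up to time [tau]. *)
Definition interaction (h0 : plane R -> R) (tau : R) zeta : R :=
  \int[mu2 R]_a (damped h0 tau a * damped h0 tau (psub zeta a) *
    cos (tau * resonance a zeta)).

Section Combination.
Variables (T A : R) (h0 : plane R -> R).
Hypotheses (T0 : 0 <= T) (bA : bounded_by A h0) (even_h0 : forall z, h0 (popp z) = h0 z).

Lemma cas_prod_propagate tau a b : let h := propagate tau h0 in
  cas_prod h a b = 2 * (damped h0 tau a * damped h0 tau b) *
    (cos (tau * (KP_symbol a + KP_symbol b)) - sin (tau * (KP_symbol a + KP_symbol b))).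
Proof.
rewrite /cas_prod /propagate !poppK !KP_symbol_popp !even_h0 !mulrN !cosN !sinN /=.
rewrite !sqrrN (mulrDr tau (KP_symbol a) (KP_symbol b)) cosD sinD /damped.
by move: (cos _) (cos _) (sin _) (sin _) (expR _) (expR _) => c1 c2 s1 s2 e1 e2; ring.
Qed.

Lemma integ_interaction tau zeta : 0 <= tau -> integ (mu2 R) (fun a =>
  damped h0 tau a * damped h0 tau (psub zeta a) * cos (tau * resonance a zeta)).
Proof.
move=> t0.
have mr : measurable_fun setT (fun a => resonance a zeta).
  by apply: mB; [apply: mD; apply: m_KP; meas|meas].
have [mh _] := bA; have ih := bounded_by_integ bA.
have md u : 0 <= u -> bounded_by A (damped h0 u).
  move=> u0; split; first by rewrite /damped; meas.
  move=> z; have [_ hb] := bA; rewrite normrM; apply: le_trans _ (hb z).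
  rewrite ler_piMl// ger0_norm ?expR_ge0// -expR0 ler_expR oppr_le0.
  by rewrite mulr_ge0// sqr_ge0.
have [mdb hdb] := md _ t0.
apply: (@integ_le _ _ _ (mu2 R) _ (fun a => A ^+ 2 * (wt a * wt (psub zeta a)))).
- by meas.
- move=> a; have ha := hdb a; have hb := hdb (psub zeta a).
  have hc := norm_cos_le1 (tau * resonance a zeta).
  have hab := ler_pM (normr_ge0 _) (normr_ge0 _) ha hb; rewrite -normrM in hab.
  have := ler_pM (normr_ge0 _) (normr_ge0 _) hab hc; rewrite -normrM mulr1 => hh.
  by apply: le_trans hh _; rewrite le_eqVlt; apply/orP; left; apply/eqP; ring.
- by apply: integZ; exact: integ_wt_conv.
Qed.

Lemma hsq_propagate tau zeta : 0 <= tau ->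
  let k := hsq (propagate tau h0) in
  k (popp zeta) * (cos (tau * KP_symbol zeta) + sin (tau * KP_symbol zeta)) +
  k zeta * (cos (tau * KP_symbol zeta) - sin (tau * KP_symbol zeta)) =
  2 * hkap R * interaction h0 tau zeta.
Proof.
move=> t0 k; have bl : bounded_by (2 * A) (propagate tau h0).
  split; last by move=> z; exact: propagate_bound.
  have mK : measurable_fun setT (fun z : plane R => KP_symbol z) by apply: m_KP; meas.
  by case: bA => mh _; rewrite /propagate; meas.
pose h := propagate tau h0; pose x := tau * KP_symbol zeta.
have i1 := integ_cas_prod zeta bl; have i2 := integ_popp (integ_cas_prod (popp zeta) bl).
rewrite /k /hsq -(RI_popp (integ_cas_prod (popp zeta) bl)) -/x.
have -> : 2 * hkap R * interaction h0 tau zeta = hkap R / 2 *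
    \int[mu2 R]_a ((cos x + sin x) * cas_prod h (popp a) (psub (popp zeta) (popp a)) +
      (cos x - sin x) * cas_prod h a (psub zeta a)); last first.
  rewrite (RID (integZ _ i2) (integZ _ i1)) (RIZ _ i2) (RIZ _ i1).
  by move: (\int[_]_z _) (\int[_]_z _) => u v; ring.
have -> : \int[mu2 R]_a ((cos x + sin x) * cas_prod h (popp a) (psub (popp zeta) (popp a)) +
      (cos x - sin x) * cas_prod h a (psub zeta a)) = \int[mu2 R]_a
   (4 * (damped h0 tau a * damped h0 tau (psub zeta a) * cos (tau * resonance a zeta))).
  apply: RI_ext => a; rewrite psub_popp !cas_prod_propagate !KP_symbol_popp.
  have db u : damped h0 tau (popp u) = damped h0 tau u.
    by rewrite /damped even_h0 /= sqrrN.
  have -> : tau * resonance a zeta = tau * (KP_symbol a + KP_symbol (psub zeta a)) - x.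
    by rewrite /resonance /x mulrBr.
  rewrite !db -opprD !mulrN cosN sinN cosB.
  by move: (cos _) (sin _) (cos _) (sin _) => c1 s1 c2 s2; ring.
rewrite RIZ; first by rewrite -/(interaction h0 tau zeta); field.
exact: integ_interaction.
Qed.

Definition combined_integrand t zeta tau : R := 2^-1 * zeta.1 * hkap R * (cut t tau *
  (expR (- (zeta.1 ^+ 2 * (t - tau))) * interaction h0 tau zeta)).

(** The combination projects the complex amplitude at [zeta], which is encoded by the
    values at [zeta] and at [- zeta], on the direction of [exp(i t P)].  It removes the
    phase common to all the pairs and leaves the resonance alone. *)
Lemma second_flow_combination t zeta : 0 <= t <= T -> let x := t * KP_symbol zeta in
  integ leb (combined_integrand t zeta) /\
  2^-1 * ((cos x + sin x) * second_flow T h0 t zeta -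
    (cos x - sin x) * second_flow T h0 t (popp zeta)) =
  \int[leb]_tau combined_integrand t zeta tau.
Proof.
move=> tT x; have /andP[t0 tleT] := tT.
have mL := @m_linear_flow R T A h0 bA.
have bL := @linear_flow_bounded R T A h0 T0 bA.
have i1 := integ_duh mL bL t zeta; have i2 := integ_duh mL bL t (popp zeta).
rewrite /second_flow clip_id// /duh.
set F := fun tau => cut t tau * propagate_dx (t - tau) (hsq (linear_flow T h0 tau)) zeta in i1 *.
set F' := fun tau => cut t tau * propagate_dx (t - tau) (hsq (linear_flow T h0 tau)) (popp zeta) in i2 *.
have E tau : (- (4^-1 * (cos x + sin x))) * F tau + (4^-1 * (cos x - sin x)) * F' tau =
    combined_integrand t zeta tau.
  rewrite /F /F' /combined_integrand cutE; case: ifP => [/andP[tau0 taut]|_]; last by ring.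
  rewrite /linear_flow clip_id ?tau0 ?(le_trans (ltW taut))//.
  have K := hsq_propagate zeta tau0.
  rewrite !propagate_dxE poppK KP_symbol_popp (mulrN (t - tau)) cosN sinN /= sqrrN.
  have -> : 2^-1 * zeta.1 * hkap R * (1 * (expR (- (zeta.1 ^+ 2 * (t - tau))) *
      interaction h0 tau zeta)) = 4^-1 * zeta.1 * expR (- (zeta.1 ^+ 2 * (t - tau))) *
      (2 * hkap R * interaction h0 tau zeta) by field.
  rewrite -K; have <- : x - (t - tau) * KP_symbol zeta = tau * KP_symbol zeta by rewrite /x; ring.
  rewrite cosB sinB.
  move: (hsq _ _) (hsq _ _) (expR _) (cos _) (sin _) (cos _) (sin _).
  by move=> k1 k2 e c1 s1 c2 s2; ring.
have iE : integ leb (combined_integrand t zeta).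
  by apply: integ_ext (integD (integZ _ i1) (integZ _ i2)); exact: E.
split => //; apply: (@eq_trans _ _ (\int[leb]_tau
    ((- (4^-1 * (cos x + sin x))) * F tau + (4^-1 * (cos x - sin x)) * F' tau))); last exact: RI_ext.
rewrite (RID (integZ _ i1) (integZ _ i2)) (RIZ _ i1) (RIZ _ i2).
by move: (\int[_]_z _) (\int[_]_z _) => u v; field.
Qed.

End Combination.

End SecondIterate.

(** * Growth of the second Picard iterate on resonant packets *)

Section Packets.
Variable R : realType.
Notation leb := (@lebesgue_measure R).
Notation time := (measurableTypeR R).

Definition slab (c r x : R) : R := ((`| `|x| - c| <= r)%R)%:R.

Lemma slab_eq1 c r x : `| `|x| - c| <= r -> slab c r x = 1.
Proof. by rewrite /slab => ->. Qed.

Lemma slabP c r x : slab c r x = 0 \/ slab c r x = 1 /\ `| `|x| - c| <= r.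
Proof. by rewrite /slab; case: (`| _ - c| <= r); [right|left]. Qed.

Lemma slab_even c r x : slab c r (- x) = slab c r x.
Proof. by rewrite /slab normrN. Qed.

Lemma m_slab c r : measurable_fun setT (slab c r : time -> R).
Proof. by apply: mle; meas. Qed.

Lemma slab_le c r x :
  0 <= slab c r x <= \1_(`[c - r, c + r]%classic) x + \1_(`[- c - r, - c + r]%classic) x.
Proof.
have p (a b : R) : 0 <= (\1_(`[a, b]%classic) x : R) by rewrite indicE.
have [->|[-> h]] := slabP c r x; first by rewrite lexx addr_ge0.
rewrite ler01 /=; move: h; rewrite ler_norml => /andP[h1 h2].
have [x0|x0] := leP 0 x.
  rewrite (ger0_norm x0) in h1 h2.
  rewrite [\1_(`[c - r, c + r]%classic) x]indicE mem_set ?lerDl//= in_itv/=.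
  by apply/andP; split; lra.
rewrite (ltr0_norm x0) in h1 h2.
rewrite [\1_(`[- c - r, - c + r]%classic) x]indicE mem_set ?lerDr//= in_itv/=.
by apply/andP; split; lra.
Qed.

Lemma integ_slab c r : integ leb (slab c r).
Proof.
apply: (@integ_le _ _ _ leb _ (fun x => \1_(`[c - r, c + r]%classic) x +
  \1_(`[- c - r, - c + r]%classic) x)); first exact: m_slab.
- by move=> x; have /andP[h0 h1] := slab_le c r x; rewrite ger0_norm.
- by apply: integD; exact: integ_indic_itv.
Qed.

Lemma RI_slab c r : 0 <= r -> \int[leb]_x slab c r x <= 4 * r.
Proof.
move=> r0; apply: (@le_trans _ _ (\int[leb]_x ((\1_(`[c - r, c + r]%classic) x : R) +
  \1_(`[- c - r, - c + r]%classic) x))).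
  apply: RI_le; [exact: integ_slab|by apply: integD; exact: integ_indic_itv|].
  by move=> x; case/andP: (slab_le c r x).
rewrite RID; [|exact: integ_indic_itv|exact: integ_indic_itv].
rewrite !RI_indic_itv; lra.
Qed.

Let q : R := Num.sqrt 3.

Let q2 : q ^+ 2 = 3. Proof. by rewrite sqr_sqrtr. Qed.

Let q1 : 1 <= q.
Proof. by rewrite -[leLHS]sqrtr1 ler_wsqrtr// ler1n. Qed.

Let q_le2 : q <= 2.
Proof. have := q1; have := q2; rewrite expr2; nra. Qed.

(** [f] vanishes together with the resonance: it measures the deviation from the
    curves [eta = +- sqrt 3 xi^2]. *)
Lemma KP_symbol_interaction (x1 y1 x2 y2 : R) : x1 != 0 -> x2 != 0 -> x1 + x2 != 0 ->
  let f := x2 * (y1 - q * x1 ^+ 2) - x1 * (y2 + q * x2 ^+ 2) in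
  KP_symbol (x1, y1) + KP_symbol (x2, y2) - KP_symbol (x1 + x2, y1 + y2) =
  f ^+ 2 / (x1 * x2 * (x1 + x2)) + 2 * q * f.
Proof.
move=> n1 n2 n3 f; rewrite /KP_symbol /=.
have -> : x1 ^+ 3 + y1 ^+ 2 / x1 + (x2 ^+ 3 + y2 ^+ 2 / x2) -
    ((x1 + x2) ^+ 3 + (y1 + y2) ^+ 2 / (x1 + x2)) =
    ((x2 * y1 - x1 * y2) ^+ 2 - 3 * (x1 * x2 * (x1 + x2)) ^+ 2) / (x1 * x2 * (x1 + x2)).
  by field; rewrite n1 n2 n3.
rewrite -q2.
have -> : (x2 * y1 - x1 * y2) ^+ 2 - q ^+ 2 * (x1 * x2 * (x1 + x2)) ^+ 2 =
    f ^+ 2 + 2 * q * f * (x1 * x2 * (x1 + x2)) by rewrite /f; ring.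
by field; rewrite n1 n2 n3.
Qed.

Section Frequency.
Variable N : R.
Hypothesis N12 : 12 <= N.

Let N0 : 0 < N. Proof. exact: lt_le_trans N12. Qed.

Lemma KP_symbol_interaction_le (x1 y1 x2 y2 : R) : `|x1 - N| <= 1 -> `|x2 - N| <= 1 ->
  `|y1 - q * N ^+ 2| <= N -> `|y2 + q * N ^+ 2| <= N ->
  `|KP_symbol (x1, y1) + KP_symbol (x2, y2) - KP_symbol (x1 + x2, y1 + y2)| <= 100 * N ^+ 2.
Proof.
move=> hx1 hx2 hy1 hy2; have hN := N12; have hN0 := N0.
have hq1 := q1; have hq2 := q_le2.
have [a1 b1] : N - 1 <= x1 /\ x1 <= N + 1.
  by move: hx1; rewrite ler_norml => /andP[? ?]; split; lra.
have [a2 b2] : N - 1 <= x2 /\ x2 <= N + 1.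
  by move: hx2; rewrite ler_norml => /andP[? ?]; split; lra.
have p1 : 0 < x1 by lra.
have p2 : 0 < x2 by lra.
rewrite KP_symbol_interaction ?gt_eqF ?addr_gt0//.
set f := x2 * _ - _; set D := x1 * x2 * (x1 + x2).
have sq x : `|x - N| <= 1 -> 0 < x -> x <= N + 1 -> q * `|x ^+ 2 - N ^+ 2| <= 4 * N + 2.
  move=> hx x0 xN; have -> : x ^+ 2 - N ^+ 2 = (x - N) * (x + N) by ring.
  rewrite normrM (ger0_norm (addr_ge0 (ltW x0) (ltW N0))).
  have h : `|x - N| * (x + N) <= 1 * (2 * N + 1).
    by apply: ler_pM => //; [exact: ltW (addr_gt0 _ _)|lra].
  have := ler_pM (le_trans ler01 q1) (mulr_ge0 (normr_ge0 (x - N)) (ltW (addr_gt0 x0 N0))) q_le2 h.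
  lra.
have g1 : `|y1 - q * x1 ^+ 2| <= 5 * N + 2.
  have -> : y1 - q * x1 ^+ 2 = (y1 - q * N ^+ 2) - q * (x1 ^+ 2 - N ^+ 2) by ring.
  apply: le_trans (ler_normB _ _) _; rewrite normrM (ger0_norm (le_trans ler01 q1)).
  have := sq _ hx1 p1 b1; lra.
have g2 : `|y2 + q * x2 ^+ 2| <= 5 * N + 2.
  have -> : y2 + q * x2 ^+ 2 = (y2 + q * N ^+ 2) + q * (x2 ^+ 2 - N ^+ 2) by ring.
  apply: le_trans (ler_normD _ _) _; rewrite normrM (ger0_norm (le_trans ler01 q1)).
  have := sq _ hx2 p2 b2; lra.
have hf : `|f| <= 12 * N ^+ 2.
  apply: le_trans (ler_normB _ _) _; rewrite !normrM (gtr0_norm p1) (gtr0_norm p2).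
  have h1 := ler_pM (ltW p2) (normr_ge0 _) b2 g1.
  have h2 := ler_pM (ltW p1) (normr_ge0 _) b1 g2.
  have : 12 * N <= N ^+ 2 by rewrite expr2 ler_wpM2r// ltW.
  have E : (N + 1) * (5 * N + 2) = 5 * N ^+ 2 + 7 * N + 2 by ring.
  rewrite E in h1 h2; lra.
have D_ge : 16 * N ^+ 2 <= D.
  have h1 : (N - 1) * (N - 1) <= x1 * x2 by apply: ler_pM => //; lra.
  have h2 : (N - 1) * (N - 1) * (2 * (N - 1)) <= D.
    by apply: ler_pM => //; [apply: mulr_ge0; lra|lra|lra].
  apply: le_trans _ h2.
  have : 12 * N ^+ 2 <= N ^+ 2 * N by rewrite mulrC ler_wpM2l// sqr_ge0.
  have : 12 * N <= N ^+ 2 by rewrite expr2 ler_wpM2r// ltW.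
  have -> : (N - 1) * (N - 1) * (2 * (N - 1)) = 2 * (N ^+ 2 * N) - 6 * N ^+ 2 + 6 * N - 2 by ring.
  lra.
have D0 : 0 < D by apply: lt_le_trans D_ge; rewrite mulr_gt0// exprn_gt0.
have fD : `|f ^+ 2 / D| <= 9 * N ^+ 2.
  rewrite normrM normrX [`|D^-1|]gtr0_norm ?invr_gt0// ler_pdivrMr//.
  apply: (@le_trans _ _ ((12 * N ^+ 2) ^+ 2)).
    by rewrite ler_pXn2r// nnegrE ?normr_ge0// mulr_ge0// sqr_ge0.
  have := ler_wpM2l (mulr_ge0 (ler0n R 9) (sqr_ge0 N)) D_ge.
  by rewrite (_ : 9 * N ^+ 2 * (16 * N ^+ 2) = (12 * N ^+ 2) ^+ 2)//; ring.
apply: le_trans (ler_normD _ _) _.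
have : `|2 * q * f| <= 4 * (12 * N ^+ 2).
  rewrite normrM; apply: ler_pM => //.
  by rewrite ger0_norm; lra.
have := sqr_ge0 N; lra.
Qed.

End Frequency.

End Packets.

Lemma second_flow_bounded (R : realType) (T A : R) (h0 : plane R -> R) (t : R) :
  0 <= T -> bounded_by A h0 ->
  bounded_by ((1 + T) * conv_const R * (2 * A) ^+ 2) (second_flow T h0 t).
Proof.
move=> T0 bA; have mL := @m_linear_flow R T A h0 bA.
have bL := @linear_flow_bounded R T A h0 T0 bA.
apply: (slice_bounded_by (U := second_flow T h0)); first exact: m_clipped_duh.
by move=> t' z; exact: (duh_bound mL bL z (clip_itv t' T0)).
Qed.

Section Growth.
Variable R : realType.
Notation leb := (@lebesgue_measure R).
Notation time := (measurableTypeR R).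
Variables (s T N : R).
Hypotheses (s0 : s <= 0) (T0 : 0 < T) (N12 : 12 <= N) (NT : 1 <= 200 * N ^+ 2 * T).

Let q : R := Num.sqrt 3.

Let q1 : 1 <= q.
Proof. by rewrite -[leLHS]sqrtr1 ler_wsqrtr// ler1n. Qed.

Let N0 : 0 < N. Proof. exact: lt_le_trans N12. Qed.

Let NN : 12 * N <= N ^+ 2.
Proof. by rewrite expr2 ler_wpM2r// ltW. Qed.

Let qN : N ^+ 2 <= q * N ^+ 2.
Proof. by rewrite ler_peMl ?sqr_ge0. Qed.

Definition packets (z : plane R) : R := slab N 1 z.1 * slab (q * N ^+ 2) N z.2.

Definition interaction_time : R := (200 * N ^+ 2)^-1.

Lemma interaction_time_gt0 : 0 < interaction_time.
Proof. by rewrite invr_gt0; apply: mulr_gt0; [rewrite ltr0n|exact: exprn_gt0]. Qed.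

Lemma interaction_time_itv : 0 <= interaction_time <= T.
Proof.
have h : 0 < 200 * N ^+ 2 by apply: mulr_gt0; [rewrite ltr0n|exact: exprn_gt0].
rewrite /interaction_time invr_ge0 (ltW h) /=.
by rewrite -[leLHS]mulr1 ler_pdivrMl.
Qed.

Lemma packetsP z : packets z = 0 \/ [/\ packets z = 1, `| `|z.1| - N| <= 1 &
  `| `|z.2| - q * N ^+ 2| <= N].
Proof.
rewrite /packets; have [->|[-> h1]] := slabP N 1 z.1; first by left; rewrite mul0r.
by have [->|[-> h2]] := slabP (q * N ^+ 2) N z.2; [left; rewrite mulr0|right; rewrite mulr1].
Qed.

Lemma packets_eq1 z : `| `|z.1| - N| <= 1 -> `| `|z.2| - q * N ^+ 2| <= N -> packets z = 1.
Proof. by move=> h1 h2; rewrite /packets !slab_eq1// mulr1. Qed.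

Lemma packets_even z : packets (popp z) = packets z.
Proof. by rewrite /packets /popp /= !slab_even. Qed.

Lemma m_packets : measurable_fun setT packets.
Proof. by have m1 := @m_slab R; apply: mM; apply: mcompT => //; meas. Qed.

Lemma packets_bounded : exists A, bounded_by A packets.
Proof.
exists ((1 + (N + 1) ^+ 2 + (q * N ^+ 2 + N) ^+ 2) ^+ 2); split; first exact: m_packets.
move=> z; have [->|[-> h1 h2]] := packetsP z.
  by rewrite normr0 mulr_ge0 ?wt_ge0// sqr_ge0.
have b1 : z.1 ^+ 2 <= (N + 1) ^+ 2.
  rewrite -(real_normK (num_real z.1)) ler_pXn2r// ?nnegrE ?addr_ge0 ?(ltW N0)//.
  by move: h1; rewrite ler_norml => /andP[_]; lra.
have b2 : z.2 ^+ 2 <= (q * N ^+ 2 + N) ^+ 2.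
  rewrite -(real_normK (num_real z.2)) ler_pXn2r// ?nnegrE.
    by move: h2; rewrite ler_norml => /andP[_]; lra.
  by rewrite addr_ge0 ?(ltW N0)// mulr_ge0 ?sqr_ge0// (le_trans ler01).
rewrite normr1 /wt ler_pdivlMr ?exprn_gt0 ?bracket_gt0// mul1r.
have B := bracket_gt0 z; rewrite ler_pXn2r// ?nnegrE; [|exact: ltW|].
  by apply: lerD => //; apply: lerD.
by apply: addr_ge0; [apply: addr_ge0 => //|]; exact: sqr_ge0.
Qed.

(** Two boxes can only sum up to the neighbourhood of [(2N, 0)] when both lie at
    positive [xi], and on opposite sides in [eta]. *)
Lemma packets_pair a b : packets a = 1 -> packets b = 1 ->
  `|a.1 + b.1 - 2 * N| <= 2^-1 -> `|a.2 + b.2| <= N / 2 ->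
  [/\ 0 < a.1, 0 < b.1 &
  `|KP_symbol a + KP_symbol b - KP_symbol (padd a b)| <= 100 * N ^+ 2].
Proof.
have hN := N12; have hNN := NN; have hqN := qN.
move=> pa pb; have [pa0|[_ ha1 ha2]] := packetsP a.
  by move: pa; rewrite pa0 => /esym/eqP; rewrite oner_eq0.
have [pb0|[_ hb1 hb2]] := packetsP b.
  by move: pb; rewrite pb0 => /esym/eqP; rewrite oner_eq0.
move: a b ha1 ha2 hb1 hb2 {pa pb} => [x1 y1] [x2 y2] /=.
rewrite !ler_norml => /andP[a1 a2] /andP[a3 a4] /andP[b1 b2] /andP[b3 b4] /andP[c1 c2] /andP[d1 d2].
have [p1|p1] := leP x1 0.
  by rewrite (ler0_norm p1) in a1 a2; have := ler_norm x2; lra.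
have [p2|p2] := leP x2 0.
  by rewrite (ler0_norm p2) in b1 b2; have := ler_norm x1; lra.
rewrite (gtr0_norm p1) in a1 a2; rewrite (gtr0_norm p2) in b1 b2.
split => //; rewrite -ler_norml /padd /=.
have h1 : `|x1 - N| <= 1 by rewrite ler_norml; apply/andP; split; lra.
have h2 : `|x2 - N| <= 1 by rewrite ler_norml; apply/andP; split; lra.
have [r1|r1] := leP 0 y1; have [r2|r2] := leP 0 y2.
- by rewrite (ger0_norm r1) in a3 a4; rewrite (ger0_norm r2) in b3 b4; lra.
- rewrite (ger0_norm r1) in a3 a4; rewrite (ltr0_norm r2) in b3 b4.
  apply: KP_symbol_interaction_le => //; rewrite -/q ler_norml; apply/andP; split; lra.
- rewrite (ltr0_norm r1) in a3 a4; rewrite (ger0_norm r2) in b3 b4.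
  rewrite [KP_symbol (x1, y1) + _]addrC [x1 + x2]addrC [y1 + y2]addrC.
  apply: KP_symbol_interaction_le => //; rewrite -/q ler_norml; apply/andP; split; lra.
- by rewrite (ltr0_norm r1) in a3 a4; rewrite (ltr0_norm r2) in b3 b4; lra.
Qed.

Let output (zeta : plane R) := `|zeta.1 - 2 * N| <= 2^-1 /\ `|zeta.2| <= N / 2.

Let decay_ge (x tau : R) : 0 <= tau <= interaction_time -> x ^+ 2 <= (3 * N) ^+ 2 ->
  2^-1 <= expR (- (x ^+ 2 * tau)).
Proof.
move=> /andP[t0 t1] xN; have N2 : 0 < N ^+ 2 by rewrite exprn_gt0.
have h : x ^+ 2 * tau <= (3 * N) ^+ 2 * interaction_time by apply: ler_pM => //; exact: sqr_ge0.
have E : (3 * N) ^+ 2 * interaction_time = 9 / 200.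
  by rewrite /interaction_time; field; rewrite gt_eqF.
have := expR_ge1Dx (- (x ^+ 2 * tau)); rewrite E in h; lra.
Qed.

Let near_box (a : plane R) : R := \1_(`[N - 2^-1, N + 2^-1]%classic) a.1 *
  \1_(`[q * N ^+ 2 - N / 2, q * N ^+ 2 + N / 2]%classic) a.2.

Let near_boxP a : near_box a = 0 \/ [/\ near_box a = 1,
  `|a.1 - N| <= 2^-1 & `|a.2 - q * N ^+ 2| <= N / 2].
Proof.
rewrite /near_box !indicE; have [h1|_] := boolP (a.1 \in _); last by left; rewrite mul0r.
have [h2|_] := boolP (a.2 \in _); last by left; rewrite mulr0.
right; rewrite mulr1; move: h1 h2; rewrite !inE /= !in_itv/= => /andP[? ?] /andP[? ?].
by split => //; rewrite ler_norml; apply/andP; split; lra.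
Qed.

(** The integrand is never negative, because all the pairs that occur are nearly
    resonant; it is at least [1/8] on the box of half the size, which is of
    measure [N]. *)
Lemma interaction_ge tau zeta : 0 <= tau <= interaction_time -> output zeta ->
  N / 8 <= interaction packets tau zeta.
Proof.
have hN := N12; have hNN := NN; have hqN := qN.
move=> ht [z1h z2h]; have /andP[t0 t1] := ht; have [A bA] := packets_bounded.
have i1 : integ (mu2 R) near_box by apply: integ_plane_prod; exact: integ_indic_itv.
have M : \int[mu2 R]_a near_box a = N.
  rewrite RI_plane_prod; [|exact: integ_indic_itv|exact: integ_indic_itv].
  by rewrite !RI_indic_itv; [field|lra|lra].
have -> : N / 8 = \int[mu2 R]_a (8^-1 * near_box a) by rewrite RIZ// M mulrC.
apply: RI_le; [exact: integZ|exact: (integ_interaction bA zeta t0)|].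
move=> a; rewrite /damped; set b := psub zeta a.
have Eab : padd a b = zeta.
  by rewrite /b /padd /psub /= !(addrC _ (_ - _)) !subrK; case: (zeta).
have Q : near_box a <= packets a * packets b.
  have [->|[-> h1 h2]] := near_boxP a.
    by case: (packetsP a) => [->|[-> _ _]]; case: (packetsP b) => [->|[-> _ _]];
      rewrite ?mulr0 ?mul0r ?mulr1.
  move: h1 h2 z1h z2h; rewrite !ler_norml => /andP[? ?] /andP[? ?] /andP[? ?] /andP[? ?].
  have a1 : 0 < a.1 by lra.
  have a2 : 0 < a.2 by lra.
  have b1 : 0 < zeta.1 - a.1 by lra.
  have b2 : zeta.2 - a.2 < 0 by lra.
  rewrite (@packets_eq1 a) ?(@packets_eq1 b) ?mulr1//= ?(gtr0_norm a1) ?(gtr0_norm a2)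
    ?(gtr0_norm b1) ?(ltr0_norm b2) ler_norml; apply/andP; split; lra.
apply: le_trans (ler_wpM2l _ Q) _; first by rewrite invr_ge0.
have [->|[pa ha _]] := packetsP a; first by rewrite !(mulr0, mul0r).
have [->|[pb hb _]] := packetsP b; first by rewrite !(mulr0, mul0r).
have e1 : `|a.1 + b.1 - 2 * N| <= 2^-1 by rewrite -[a.1 + b.1]/((padd a b).1) Eab.
have e2 : `|a.2 + b.2| <= N / 2 by rewrite -[a.2 + b.2]/((padd a b).2) Eab.
have [p1 p2 hR] := packets_pair pa pb e1 e2.
have x3 x : 0 < x -> `| `|x| - N| <= 1 -> x ^+ 2 <= (3 * N) ^+ 2.
  move=> x0; rewrite (gtr0_norm x0) ler_norml => /andP[_ h].
  by rewrite ler_pXn2r// ?nnegrE; lra.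
have d1 := decay_ge ht (x3 _ p1 ha); have d2 := decay_ge ht (x3 _ p2 hb).
have c : 2^-1 <= cos (tau * resonance a zeta).
  have := cos_taylor 0 (tau * resonance a zeta).
  rewrite add0r sin0 mulr0 addr0 cos0 ler_norml => /andP[h _].
  have : (tau * resonance a zeta) ^+ 2 <= (2^-1) ^+ 2.
    rewrite -(real_normK (num_real (tau * _))) ler_pXn2r// ?nnegrE//.
    rewrite normrM (ger0_norm t0).
    rewrite Eab -/(psub zeta a) in hR.
    apply: le_trans (ler_pM t0 (normr_ge0 _) t1 hR) _.
    rewrite /interaction_time le_eqVlt; apply/orP; left; apply/eqP; field.
    by rewrite gt_eqF.
  lra.
rewrite pa pb !mulr1.
have i2 : (0 : R) <= 2^-1 by rewrite invr_ge0.
have d12 := ler_pM i2 i2 d1 d2; have := ler_pM (mulr_ge0 i2 i2) i2 d12 c.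
by apply: le_trans; rewrite -!invfM; lra.
Qed.


Let kap : R := hkap R / 12800.

Lemma combined_integrand_ge zeta tau : output zeta ->
  hkap R * (N ^+ 2 / 32) * \1_(`[0, interaction_time / 2]%classic) tau <=
  combined_integrand packets interaction_time zeta tau.
Proof.
have hN := N12; have hk := hkap_gt0 R; have tp := interaction_time_gt0.
move=> out; have [z1h z2h] := out.
rewrite ler_norml in z1h; case/andP: z1h => z1 z2.
have z0 : N <= zeta.1 by lra.
rewrite /combined_integrand cutE; case: ifP => [/andP[ta tb]|hcut].
  have h1 : N / 8 <= interaction packets tau zeta.
    by apply: interaction_ge => //; rewrite ta ltW.
  have h2 : 2^-1 <= expR (- (zeta.1 ^+ 2 * (interaction_time - tau))).
    apply: decay_ge; first by apply/andP; split; lra.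
    by rewrite ler_pXn2r// ?nnegrE; lra.
  have h3 : (\1_(`[0, interaction_time / 2]%classic) tau : R) <= 1 by rewrite indicE lern1 leq_b1.
  have h4 : 2^-1 * (N / 8) <= expR (- (zeta.1 ^+ 2 * (interaction_time - tau))) *
      interaction packets tau zeta.
    by apply: ler_pM => //; rewrite ?invr_ge0// divr_ge0// ltW.
  have c0 : 0 <= hkap R * (N ^+ 2 / 32).
    by rewrite mulr_ge0 ?(ltW hk)// divr_ge0// sqr_ge0.
  apply: le_trans (ler_wpM2l c0 h3) _; rewrite mulr1 mul1r.
  have h5 : 2^-1 * N * hkap R <= 2^-1 * zeta.1 * hkap R by rewrite ler_wpM2r ?(ltW hk)// ler_wpM2l.
  have c1 : 0 <= 2^-1 * N * hkap R by rewrite !mulr_ge0 ?(ltW hk) ?(ltW N0)// invr_ge0.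
  have c2 : 0 <= 2^-1 * (N / 8) by rewrite mulr_ge0 ?invr_ge0// divr_ge0// ltW.
  apply: le_trans _ (ler_pM c1 c2 h5 h4).
  by rewrite le_eqVlt; apply/orP; left; apply/eqP; field.
rewrite mul0r mulr0 indicE; case: (boolP (tau \in _)) => [|_]; last by rewrite mulr0.
rewrite inE/= in_itv/= => /andP[ta tb]; move: hcut; rewrite ta /=.
by have -> : tau < interaction_time by lra.
Qed.

(** The constant collects [N^2 / 32] from [combined_integrand_ge] and half of the
    interaction time, [1 / (400 N^2)]. *)
Lemma second_flow_ge zeta : output zeta ->
  kap ^+ 2 <= (second_flow T packets interaction_time zeta ^+ 2 +
    second_flow T packets interaction_time (popp zeta) ^+ 2) / 2.
Proof.
have hN := N12; have hk := hkap_gt0 R; have tp := interaction_time_gt0.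
move=> out; have [A bA] := packets_bounded.
have [iF] := second_flow_combination (ltW T0) bA packets_even zeta interaction_time_itv.
set c := cos _; set d := sin _; set u := second_flow _ _ _ zeta; set v := second_flow _ _ _ _.
move=> E; have L : kap <= 2^-1 * ((c + d) * u - (c - d) * v).
  rewrite E; have -> : kap = \int[leb]_tau (hkap R * (N ^+ 2 / 32) *
      \1_(`[0, interaction_time / 2]%classic) tau).
    rewrite RIZ; last exact: integ_indic_itv.
    rewrite RI_indic_itv; last by rewrite divr_ge0// ltW.
    by rewrite subr0 /kap /interaction_time; field; rewrite gt_eqF.
  apply: RI_le => //; first by apply: integZ; exact: integ_indic_itv.
  by move=> tau; exact: combined_integrand_ge.
have kap0 : 0 <= kap by apply: divr_ge0; [exact: ltW|exact: ler0n].
have cd : c ^+ 2 + d ^+ 2 = 1 by rewrite cos2Dsin2.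
have L2 : kap ^+ 2 <= (2^-1 * ((c + d) * u - (c - d) * v)) ^+ 2.
  by rewrite ler_pXn2r// nnegrE//; exact: le_trans kap0 L.
apply: le_trans L2 _; clearbody c d u v; clear E L.
have h := sqr_ge0 (2^-1 * ((c + d) * v + (c - d) * u)).
have E2 : (2^-1 * ((c + d) * u - (c - d) * v)) ^+ 2 + (2^-1 * ((c + d) * v + (c - d) * u)) ^+ 2
    = (c ^+ 2 + d ^+ 2) * ((u ^+ 2 + v ^+ 2) / 2) by field.
rewrite cd mul1r in E2; lra.
Qed.

(** The size of both squared norms, up to constants: the Sobolev weight at
    frequencies of size [N], times the measure of the boxes. *)
Definition rate : R := N `^ (2 * s) * N.

Lemma japanese_le (x y : R) : 0 <= y -> 1 + x ^+ 2 <= y ^+ 2 -> japanese x <= y.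
Proof. by move=> y0 h; rewrite /japanese -(ger0_norm y0) -sqrtr_sqr ler_wsqrtr. Qed.

Lemma powR_anti (x y r : R) : r <= 0 -> 0 < x -> x <= y -> y `^ r <= x `^ r.
Proof.
move=> r0 x0 xy; have y0 := lt_le_trans x0 xy.
have E z : z `^ r = (z `^ (- r))^-1 by rewrite powRN invrK.
rewrite (E x) (E y) lef_pV2 ?posrE ?powR_gt0//.
have r0' : 0 <= - r by rewrite oppr_ge0.
by have := ge0_ler_powR r0'; apply; rewrite ?nnegrE ?(ltW x0) ?(ltW y0).
Qed.

Let s2 : 2 * s <= 0. Proof. by rewrite pmulr_rle0. Qed.

Lemma sobolev_norm_packets :
  sobolev_norm s 0 (hdist packets) ^+ 2 <= 16 * 2^-1 `^ (2 * s) * rate.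
Proof.
have hN := N12; have [A bA] := packets_bounded.
rewrite sobolev_norm_sqr (sob_ip_hdist s0 bA).
have [_ ie] := finite_energy_hdist s0 bA.
have i1 := integ_slab N 1; have i2 := integ_slab (q * N ^+ 2) N.
apply: (@le_trans _ _ (\int[mu2 R]_z ((2^-1 * N) `^ (2 * s) * packets z))).
  apply: RI_le => //; first by apply: integZ; exact: integ_plane_prod.
  move=> z; rewrite hdist_energy packets_even.
  have [->|[-> h1 _]] := packetsP z; first by rewrite !mul0r addr0 mul0r !mulr0.
  rewrite !mulr1 -[X in _ * X]/((1 + 1) / 2) divff// mulr1 sobwE.
  apply: powR_anti => //; first by rewrite mulr_gt0// invr_gt0.
  apply: (@le_trans _ _ `|z.1|); first by move: h1; rewrite ler_norml => /andP[h _]; lra.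
  by rewrite /japanese -sqrtr_sqr ler_wsqrtr// lerDr.
rewrite RIZ; last exact: integ_plane_prod.
rewrite RI_plane_prod// powRM ?invr_ge0 ?(ltW N0)// /rate.
have h1 := RI_slab N ler01; have h2 := RI_slab (q * N ^+ 2) (ltW N0).
have p1 : 0 <= \int[leb]_x slab N 1 x by apply: RI_ge0 => x; case/andP: (slab_le N 1 x).
have p2 : 0 <= \int[leb]_x slab (q * N ^+ 2) N x.
  by apply: RI_ge0 => x; case/andP: (slab_le (q * N ^+ 2) N x).
have P := ler_pM p1 p2 h1 h2.
have c0 : 0 <= 2^-1 `^ (2 * s) * N `^ (2 * s) by rewrite mulr_ge0// powR_ge0.
apply: le_trans (ler_wpM2l c0 P) _.
by rewrite le_eqVlt; apply/orP; left; apply/eqP; ring.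
Qed.

Lemma sobolev_norm_second_flow : kap ^+ 2 * 4 `^ (2 * s) * rate <=
  sobolev_norm s 0 (hdist (second_flow T packets interaction_time)) ^+ 2.
Proof.
have hN := N12; have [A bA] := packets_bounded.
have bM := second_flow_bounded interaction_time (ltW T0) bA.
rewrite sobolev_norm_sqr (sob_ip_hdist s0 bM).
have [_ ie] := finite_energy_hdist s0 bM.
pose E (z : plane R) : R := \1_(`[2 * N - 2^-1, 2 * N + 2^-1]%classic) z.1 *
  \1_(`[- (N / 2), N / 2]%classic) z.2.
have iE : integ (mu2 R) E by apply: integ_plane_prod; exact: integ_indic_itv.
have -> : kap ^+ 2 * 4 `^ (2 * s) * rate =
    \int[mu2 R]_z ((4 * N) `^ (2 * s) * kap ^+ 2 * E z).
  rewrite RIZ// RI_plane_prod; [|exact: integ_indic_itv|exact: integ_indic_itv].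
  rewrite !RI_indic_itv; [|lra|lra].
  by rewrite powRM ?(ltW N0)// /rate; field.
apply: RI_le => //; first exact: integZ.
move=> z; rewrite /E !indicE.
have [h1|_] := boolP (z.1 \in _); last by rewrite mul0r mulr0; exact: energy_ge0.
have [h2|_] := boolP (z.2 \in _); last by rewrite !mulr0; exact: energy_ge0.
move: h1 h2; rewrite !inE /= !in_itv/= => /andP[a1 a2] /andP[a3 a4].
have out : output z by split; rewrite ler_norml; apply/andP; split; lra.
have Ez h : energy s (hev h) (hod h) (hev h) (hod h) z =
    sobw s z * ((h z ^+ 2 + h (popp z) ^+ 2) / 2) by rewrite hdist_energy !expr2.
rewrite Ez mulr1 mulr1; apply: ler_pM.
- exact: powR_ge0.
- exact: sqr_ge0.
- rewrite sobwE; apply: powR_anti => //; first exact: lt_le_trans (japanese_ge1 _).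
  apply: japanese_le; first by rewrite mulr_ge0// ltW.
  have : z.1 ^+ 2 <= (3 * N) ^+ 2 by rewrite ler_pXn2r// ?nnegrE; lra.
  have := NN; rewrite !exprMn; lra.
- exact: second_flow_ge.
Qed.

End Growth.

(** * Failure of twice differentiability *)

(** A function with a Taylor expansion at the origin and a derivative that is
    itself differentiable there: the two quadratic coefficients agree.  The second
    difference of [g] along [x], [2 x], [3 x] removes the linear terms. *)
Lemma second_order_coefficient (R : realType) (g d : R -> R) (e1 K a1 a2 c b : R) :
  0 < e1 -> 0 <= K -> (forall e, 0 < e < e1 -> is_derive e 1 g (d e)) ->
  (forall e, 0 < e < e1 -> `|g e - e * a1 - e ^+ 2 * a2| <= K * e ^+ 3) ->
  (forall eps, 0 < eps -> exists2 del, 0 < del & forall e, 0 < e < e1 -> e < del ->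
    `|d e - c - e * b| <= eps * e) ->
  2 * a2 = b.
Proof.
move=> e10 K0 dg hg hd.
pose G e := g e - e * c - e ^+ 2 * (b / 2).
have dG e : 0 < e < e1 -> is_derive e 1 G (d e - c - e * b).
  move=> he; have := dg e he => dge.
  by apply: is_derive_eq; rewrite /GRing.scale/=; field.
have step eps x y del : 0 < x -> x <= y -> y < e1 -> y < del ->
    (forall e, 0 < e < e1 -> e < del -> `|d e - c - e * b| <= eps * e) -> 0 < eps ->
    `|G y - G x| <= eps * y * (y - x).
  move=> x0 xy ye yd h eps0.
  have [||u uxy E] := @MVT_segment R G (fun e => d e - c - e * b) x y xy.
  - by move=> u; rewrite in_itv/= => /andP[? ?]; apply: dG; apply/andP; split; lra.
  - apply: derivable_within_continuous => u /=; rewrite in_itv/= => /andP[? ?].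
    by have [] : is_derive u 1 G (d u - c - u * b) by apply: dG; apply/andP; split; lra.
  move: uxy; rewrite in_itv/= => /andP[xu uy].
  rewrite E normrM (ger0_norm (_ : 0 <= y - x)) ?subr_ge0// ler_wpM2r ?subr_ge0//.
  have u0 : 0 < u < e1 by apply/andP; split; lra.
  apply: le_trans (h _ u0 (le_lt_trans uy yd)) _.
  by rewrite ler_wpM2l// ltW.
suff key : forall eps, 0 < eps -> `|2 * (a2 - b / 2)| <= eps.
  have h : `|2 * (a2 - b / 2)| <= 0 by apply/ler_addgt0Pl => eps eps0; rewrite addr0; exact: key.
  by move: h; rewrite normr_le0 => /eqP; lra.
move=> eps eps0; have ep : 0 < eps / 10 by rewrite divr_gt0.
have [del del0 h] := hd _ ep.
(* The cubic errors at [x], [2 x], [3 x] enter with [1 + 2 * 8 + 27 = 44]. *)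
pose m := Num.min (Num.min del e1) (eps / (88 * (K + 1))).
have K1 : 0 < K + 1 by rewrite ltr_wpDl.
have m0 : 0 < m.
  rewrite /m !lt_min del0 e10 /=; apply: divr_gt0 => //; apply: mulr_gt0 => //; exact: ltr0n.
have md : m <= del by rewrite /m !ge_min lexx.
have me : m <= e1 by rewrite /m !ge_min lexx orbT.
have mK : m * (88 * (K + 1)) <= eps.
  rewrite -ler_pdivlMr; last by apply: mulr_gt0 => //; exact: ltr0n.
  by rewrite /m ge_min lexx orbT.
pose x := m / 4; have x0 : 0 < x by rewrite divr_gt0.
have s1 : `|G (2 * x) - G x| <= eps / 10 * (2 * x) * (2 * x - x).
  by apply: (step _ _ _ del) => //; rewrite /x; lra.
have s2 : `|G (3 * x) - G (2 * x)| <= eps / 10 * (3 * x) * (3 * x - 2 * x).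
  by apply: (step _ _ _ del) => //; rewrite /x; lra.
have g1 : `|g x - x * a1 - x ^+ 2 * a2| <= K * x ^+ 3.
  by apply: hg; apply/andP; split; rewrite /x; lra.
have g2 : `|g (2 * x) - 2 * x * a1 - (2 * x) ^+ 2 * a2| <= K * (2 * x) ^+ 3.
  by apply: hg; apply/andP; split; rewrite /x; lra.
have g3 : `|g (3 * x) - 3 * x * a1 - (3 * x) ^+ 2 * a2| <= K * (3 * x) ^+ 3.
  by apply: hg; apply/andP; split; rewrite /x; lra.
have x2 : 0 < x ^+ 2 by rewrite exprn_gt0.
rewrite -(ler_pM2r x2) -{1}(ger0_norm (ltW x2)) -normrM.
have Kx : K * x ^+ 3 * 44 <= eps / 2 * x ^+ 2.
  have -> : K * x ^+ 3 * 44 = (K * x * 44) * x ^+ 2 by ring.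
  rewrite ler_pM2r// /x; have : K * m * 88 <= eps.
    apply: le_trans mK; have := m0; lra.
  lra.
pose r e := g e - e * a1 - e ^+ 2 * a2.
have E : 2 * (a2 - b / 2) * x ^+ 2 = (G (3 * x) - G (2 * x)) - (G (2 * x) - G x)
    - (g (3 * x) - 3 * x * a1 - (3 * x) ^+ 2 * a2)
    + 2 * (g (2 * x) - 2 * x * a1 - (2 * x) ^+ 2 * a2)
    - (g x - x * a1 - x ^+ 2 * a2).
  by rewrite /G; field.
have K2 : K * (2 * x) ^+ 3 = 8 * (K * x ^+ 3) by ring.
have K3 : K * (3 * x) ^+ 3 = 27 * (K * x ^+ 3) by ring.
have e1' : eps / 10 * (2 * x) * (2 * x - x) = eps / 5 * x ^+ 2 by field.
have e2' : eps / 10 * (3 * x) * (3 * x - 2 * x) = eps / 10 * 3 * x ^+ 2 by field.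
rewrite K2 in g2; rewrite K3 in g3; rewrite e1' in s1; rewrite e2' in s2.
rewrite E; move: s1 s2 g1 g2 g3 Kx; rewrite !ler_norml.
move=> /andP[? ?] /andP[? ?] /andP[? ?] /andP[? ?] /andP[? ?] ?.
by apply/andP; split; lra.
Qed.

Lemma is_derive_remainder (R : realType) (g : R -> R) (e d : R) :
  (forall eps, 0 < eps -> exists2 del, 0 < del & forall h, `|h| < del ->
     `|g (e + h) - g e - h * d| <= eps * `|h|) -> is_derive e 1 g d.
Proof.
move=> H.
have cv : (fun h => h^-1 *: (g (h *: 1 + e) - g e)) @ 0^' --> (d : R).
  apply/cvgrPdist_le => eps eps0; have [del del0 h] := H _ eps0.
  near=> k; have k0 : k != 0 by near: k; exact: nbhs_dnbhs_neq.
  have kd : `|k| < del by near: k; exact: dnbhs0_lt.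
  have := h k kd; rewrite -[k *: 1]/(k * 1) mulr1 [k + e]addrC.
  set D := g (e + k) - g e => hD.
  have -> : d - k^-1 *: D = - (k^-1 * (D - k * d)).
    by rewrite -[k^-1 *: D]/(k^-1 * D) (mulrBr _ D) mulKf// opprB.
  rewrite normrN normrM normfV mulrC ler_pdivrMr ?normr_gt0//.
by apply: DeriveDef; [exact: cvgP cv|exact: cvg_lim cv].
Unshelve. all: by end_near. Qed.

Section Obstruction.
Variables (R : realType) (s T r : R) (flow : functional R -> R -> functional R).
Hypotheses (s0 : s <= 0) (T0 : 0 < T) (r0 : 0 < r)
  (wp : forall phi, sobolev s 0 phi -> sobolev_norm s 0 phi < r ->
     KPBI_solution T s 0 phi (flow phi) /\
     forall u, KPBI_solution T s 0 phi u -> u = flow phi)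
  (C2 : C2_at_origin (sobolev s 0) (sobolev_norm s 0)
     (sobolev_curve T s 0) (curve_norm T s 0) flow).

Section Pairing.
Variables (t : R) (w : functional R).
Hypotheses (tT : 0 <= t <= T) (hw : sobolev s 0 w).
Implicit Types u v : R -> functional R.

Definition pairing u : R := sob_ip s (u t) w.

Lemma pairing_lc c u v : sobolev_curve T s 0 u -> sobolev_curve T s 0 v ->
  pairing (c *: u + v : R -> functional R) = c * pairing u + pairing v.
Proof. by move=> hu hv; apply: sob_ip_lc => //; exact: curve_sobolev tT. Qed.

Lemma pairingB u v : sobolev_curve T s 0 u -> sobolev_curve T s 0 v ->
  pairing (u - v : R -> functional R) = pairing u - pairing v.
Proof.
by move=> hu hv; have := pairing_lc (-1) hv hu; rewrite scaleN1r addrC mulN1r [RHS]addrC.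
Qed.

Lemma pairingZ c u : sobolev_curve T s 0 u ->
  pairing (c *: u : R -> functional R) = c * pairing u.
Proof. by move=> hu; apply: sob_ipZ => //; exact: curve_sobolev tT. Qed.

Lemma sobolev_curveB u v : sobolev_curve T s 0 u -> sobolev_curve T s 0 v ->
  sobolev_curve T s 0 (u - v : R -> functional R).
Proof. by move=> hu hv; have := sobolev_curve_lc (-1) hv hu; rewrite scaleN1r addrC. Qed.

Lemma pairing_le u : sobolev_curve T s 0 u ->
  `|pairing u| <= curve_norm T s 0 u * sobolev_norm s 0 w.
Proof.
move=> hu; apply: le_trans (sob_ip_CS (curve_sobolev hu tT) hw) _.
by apply: ler_wpM2r; [exact: sobolev_norm_ge0|exact: curve_norm_ge (ltW T0) _ _ hu tT].
Qed.

End Pairing.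

Lemma bounded_linear0 (L : functional R -> R -> functional R) :
  bounded_linear (sobolev s 0) (sobolev_norm s 0) (sobolev_curve T s 0) (curve_norm T s 0) L ->
  L 0 = 0.
Proof.
move=> [lin _]; have h := lin 1 0 0 (@sobolev0 R s) (@sobolev0 R s).
rewrite scale1r add0r in h; rewrite scale1r in h.
by apply: (addrI (L 0)); rewrite addr0 -h.
Qed.

Lemma bounded_linearZ (L : functional R -> R -> functional R) c phi :
  bounded_linear (sobolev s 0) (sobolev_norm s 0) (sobolev_curve T s 0) (curve_norm T s 0) L ->
  sobolev s 0 phi -> L (c *: phi) = c *: L phi.
Proof.
move=> bl hp; have [lin _] := bl; have := lin c phi 0 hp (@sobolev0 R s).
by rewrite (bounded_linear0 bl) !addr0.
Qed.

(** Pairing the flow with [w] gives a function of [e] which inherits the derivatives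
    of the flow, and whose quadratic coefficient is the squared norm of [w]; this
    yields [2 |w|^2 <= |w| C |phi|^2]. *)
Lemma quadratic_term_le : exists C, forall (t : R) (phi w : functional R) a1 e2 K,
  0 <= t <= T -> sobolev s 0 phi -> sobolev s 0 w -> 0 < e2 -> 0 <= K ->
  (forall e, 0 < e < e2 -> sobolev_norm s 0 (e *: phi : functional R) < r ->
    `|pairing t w (flow (e *: phi)) - e * a1 - e ^+ 2 * sob_ip s w w| <= K * e ^+ 3) ->
  2 * sobolev_norm s 0 w <= C * sobolev_norm s 0 phi ^+ 2.
Proof.
have [rho [D1 [D2 [rho0 hD1 hD2 _]]]] := C2.
have n0 : sobolev_norm s 0 (0 : functional R) = 0.
  by rewrite sobolev_normE sob_ip0 sqrtr0.
have n0r : sobolev_norm s 0 (0 : functional R) < rho by rewrite n0.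
have [[lin1 _ [C hC]] D2d] := hD2 0 (@sobolev0 R s) n0r.
exists C => t phi w a1 e2 K tT hphi hw e20 K0 hexp.
pose n := sobolev_norm s 0 phi; have nn : 0 <= n := sobolev_norm_ge0 _ _.
pose m := sobolev_norm s 0 w; have mm : 0 <= m := sobolev_norm_ge0 _ _.
pose e1 := Num.min e2 (Num.min r rho / (n + 1)).
have n1 : 0 < n + 1 := ltr_wpDl nn ltr01.
have m1 : 0 < m + 1 := ltr_wpDl mm ltr01.
have rr0 : 0 < Num.min r rho by rewrite lt_min r0.
have e10 : 0 < e1 by rewrite /e1 lt_min e20; exact: divr_gt0.
have nZ e : sobolev_norm s 0 (e *: phi : functional R) = `|e| * n by exact: (sobolev_normZ e hphi).
have hZ e : sobolev s 0 (e *: phi : functional R) by exact: (sobolevZ e hphi).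
have small e : `|e| < e1 -> `|e| * n < Num.min r rho.
  move=> he; have h1 : `|e| < Num.min r rho / (n + 1).
    by apply: lt_le_trans he _; rewrite /e1 ge_min lexx orbT.
  rewrite ltr_pdivlMr// in h1; apply: le_lt_trans h1.
  by rewrite ler_wpM2l// lerDl.
have solr e : `|e| < e1 -> sobolev_norm s 0 (e *: phi : functional R) < r.
  by move=> /small; rewrite nZ lt_min => /andP[].
have solrho e : `|e| < e1 -> sobolev_norm s 0 (e *: phi : functional R) < rho.
  by move=> /small; rewrite nZ lt_min => /andP[].
have fc e : `|e| < e1 -> sobolev_curve T s 0 (flow (e *: phi)).
  by move=> he; have [[]] := wp (hZ e) (solr e he).
pose l u := pairing t w u.
pose g e := l (flow (e *: phi)); pose d e := l (D1 (e *: phi) phi).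
pose b := l (D2 0 phi phi).
have hK e : 0 < e < e1 -> `|g e - e * a1 - e ^+ 2 * sob_ip s w w| <= K * e ^+ 3.
  move=> /andP[ep ee]; have ae : `|e| < e1 by rewrite gtr0_norm.
  by apply: hexp; [rewrite ep (lt_le_trans ee)// /e1 ge_min lexx|exact: solr].
have bl e : `|e| < e1 -> frechet_derivative (sobolev s 0) (sobolev_norm s 0)
    (sobolev_curve T s 0) (curve_norm T s 0) flow (e *: phi) (D1 (e *: phi)).
  by move=> he; apply: hD1; [exact: hZ|exact: solrho].
have D1c e : `|e| < e1 -> sobolev_curve T s 0 (D1 (e *: phi) phi).
  by move=> /bl[[_ [C' h]] _]; have [] := h _ hphi.
have n2 : 0 < (n + 1) * (m + 1) := mulr_gt0 n1 m1.
have hn1 : n <= n + 1 by rewrite lerDl ler01.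
have hm1 : m <= m + 1 by rewrite lerDl ler01.
have nm : n * m <= (n + 1) * (m + 1) := ler_pM nn mm hn1 hm1.
have dg e : 0 < e < e1 -> is_derive e 1 g (d e).
  move=> /andP[ep ee]; have ae : `|e| < e1 by rewrite gtr0_norm.
  have [L1 L2] := bl e ae; apply: is_derive_remainder => eps eps0.
  have eps'0 : 0 < eps / ((n + 1) * (m + 1)) by rewrite divr_gt0.
  have [del del0 hdel] := L2 _ eps'0.
  exists (Num.min (del / (n + 1)) (e1 - e)) => [|h].
    by rewrite lt_min divr_gt0//= subr_gt0.
  rewrite lt_min => /andP[hs1 hs2].
  have eh : `|e + h| < e1.
    by apply: le_lt_trans (ler_normD _ _) _; rewrite (gtr0_norm ep); lra.
  have hd1 : sobolev_norm s 0 (h *: phi : functional R) < del.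
    rewrite ltr_pdivlMr// in hs1; rewrite nZ; apply: le_lt_trans hs1.
    by rewrite ler_wpM2l// lerDl.
  have := hdel _ (hZ h) hd1; rewrite (bounded_linearZ h L1 hphi) -scalerDl nZ => hrem.
  have cF := fc _ eh; have cF0 := fc _ ae; have cD := D1c e ae.
  have chD : sobolev_curve T s 0 (h *: D1 (e *: phi) phi : R -> functional R).
    have [_ [C' hC']] := L1; have [] := hC' _ (hZ h).
    by rewrite (bounded_linearZ h L1 hphi).
  have cFF := sobolev_curveB cF cF0; have cR := sobolev_curveB cFF chD.
  have lE : l (flow ((e + h) *: phi) - flow (e *: phi) - h *: D1 (e *: phi) phi) =
      g (e + h) - g e - h * d e.
    rewrite /l (pairingB tT hw cFF chD) (pairingB tT hw cF cF0) (pairingZ tT hw h cD).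
    exact: erefl.
  rewrite -lE; apply: le_trans (pairing_le tT hw cR) _; rewrite -/m.
  apply: le_trans (ler_wpM2r mm hrem) _.
  have -> : eps / ((n + 1) * (m + 1)) * (`|h| * n) * m =
      (eps * `|h|) * (n * m / ((n + 1) * (m + 1))) by field; rewrite (gt_eqF n1) (gt_eqF m1).
  by apply: ler_piMr; [rewrite mulr_ge0// ltW|rewrite ler_pdivrMr// mul1r].
have hd : forall eps, 0 < eps -> exists2 del, 0 < del & forall e, 0 < e < e1 -> e < del ->
    `|d e - d 0 - e * b| <= eps * e.
  move=> eps eps0; have n3 : 0 < (n + 1) * (n + 1) * (m + 1) := mulr_gt0 (mulr_gt0 n1 n1) m1.
  have nm3 : n * n * m <= (n + 1) * (n + 1) * (m + 1).
    exact: (ler_pM (mulr_ge0 nn nn) mm (ler_pM nn nn hn1 hn1) hm1).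
  have eps'0 : 0 < eps / ((n + 1) * (n + 1) * (m + 1)) by rewrite divr_gt0.
  have [del del0 hdel] := D2d _ eps'0.
  exists (del / (n + 1)) => [|e /andP[ep ee] hde]; first by rewrite divr_gt0.
  have ae : `|e| < e1 by rewrite gtr0_norm.
  have a0 : `|0 : R| < e1 by rewrite normr0.
  have hd1 : sobolev_norm s 0 (e *: phi : functional R) < del.
    rewrite ltr_pdivlMr// in hde; rewrite nZ gtr0_norm//; apply: le_lt_trans hde.
    by rewrite ler_wpM2l ?lerDl// ltW.
  have := hdel _ (hZ e) hd1 _ hphi; rewrite add0r nZ (gtr0_norm ep) -/n => hrem.
  have c1 := D1c e ae; have c0 : sobolev_curve T s 0 (D1 0 phi).
    by have := D1c 0 a0; rewrite scale0r.
  have BZ : D2 0 (e *: phi) phi = e *: D2 0 phi phi.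
    have B0' : D2 0 0 phi = 0.
      have := lin1 1 0 0 phi (@sobolev0 R s) (@sobolev0 R s) hphi.
      rewrite scale1r add0r scale1r => h.
      by apply: (addrI (D2 0 0 phi)); rewrite addr0 -h.
    by have := lin1 e phi 0 phi hphi (@sobolev0 R s) hphi; rewrite B0' !addr0.
  have [cB _] := hC phi phi hphi hphi.
  have ceB : sobolev_curve T s 0 (e *: D2 0 phi phi : R -> functional R).
    by have [] := hC _ _ (hZ e) hphi; rewrite BZ.
  rewrite BZ in hrem; have c10 := sobolev_curveB c1 c0; have cR := sobolev_curveB c10 ceB.
  have lE : l (D1 (e *: phi) phi - D1 0 phi - e *: D2 0 phi phi) = d e - d 0 - e * b.
    by rewrite /l (pairingB tT hw c10 ceB) (pairingB tT hw c1 c0) (pairingZ tT hw e cB) /d scale0r.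
  rewrite -lE; apply: le_trans (pairing_le tT hw cR) _; rewrite -/m.
  apply: le_trans (ler_wpM2r mm hrem) _.
  have -> : eps / ((n + 1) * (n + 1) * (m + 1)) * (e * n) * n * m =
      (eps * e) * (n * n * m / ((n + 1) * (n + 1) * (m + 1))).
    by field; rewrite (gt_eqF n1) (gt_eqF m1).
  by apply: ler_piMr; [rewrite mulr_ge0// ltW|rewrite ler_pdivrMr// mul1r].
have := second_order_coefficient e10 K0 dg hK hd; rewrite -sobolev_norm_sqr -/m => eq2.
have [cB hB] := hC phi phi hphi hphi.
have h2 : `|b| <= curve_norm T s 0 (D2 0 phi phi) * m := pairing_le tT hw cB.
rewrite -eq2 in h2.
have h3 : 2 * m ^+ 2 <= C * n * n * m.
  by apply: le_trans (ler_norm _) _; apply: le_trans h2 _; exact: ler_wpM2r.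
have [m0|m0] := eqVneq m 0; last first.
  have mp : 0 < m by rewrite lt_neqAle eq_sym m0.
  by rewrite -(ler_pM2r mp) -/n expr2; move: h3; rewrite expr2 !mulrA.
rewrite -/m m0 mulr0 -/n expr2 mulrA; apply: le_trans hB.
exact: le_trans (sobolev_norm_ge0 _ _) (curve_norm_ge (ltW T0) cB tT).
Qed.


(** The second iterate is half of the second derivative at the origin, hence
    bounded by the square of the norm of the datum. *)
Lemma second_flow_quadratic : exists C, forall A h0 t, bounded_by A h0 -> 0 <= t <= T ->
  2 * sobolev_norm s 0 (hdist (second_flow T h0 t)) <= C * sobolev_norm s 0 (hdist h0) ^+ 2.
Proof.
have [C hC] := quadratic_term_le; exists C => A h0 t bA tT.
have hphi := sobolev_hdist s0 bA; have bw := second_flow_bounded t (ltW T0) bA.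
have hw := sobolev_hdist s0 bw; have A0 := bounded_by_ge0 bA.
pose m := sobolev_norm s 0 (hdist (second_flow T h0 t)).
have mm : 0 <= m := sobolev_norm_ge0 _ _.
pose B := 16 * duh_const T * A; have B0 : 0 <= B.
  by apply: mulr_ge0 => //; apply: mulr_ge0; [exact: ler0n|exact: duh_const_ge0 (ltW T0)].
have B1 : 0 < B + 1 := ltr_wpDl B0 ltr01.
pose K0 := 128 * duh_const T ^+ 2 * A ^+ 3.
have K00 : 0 <= K0.
  by apply: mulr_ge0; [apply: mulr_ge0; [exact: ler0n|exact: sqr_ge0]|exact: exprn_ge0].
apply: (hC t _ _ (sob_ip s (hdist (linear_flow T h0 t)) (hdist (second_flow T h0 t)))
  (B + 1)^-1 (K0 * Num.sqrt (wt_mass R) * m)) => //.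
- by rewrite invr_gt0.
- by apply: mulr_ge0 => //; apply: mulr_ge0 => //; exact: sqrtr_ge0.
move=> e /andP[ep ee] small; have e0 := ltW ep.
have Be : 16 * duh_const T * A * e <= 1.
  have := ler_wpM2l (ltW B1) (ltW ee); rewrite divff ?gt_eqF// => h.
  by apply: le_trans h; apply: ler_wpM2r => //; rewrite lerDl.
have [U [mU bU UE]] := picard_fixpoint (ltW T0) bA e0 Be.
have sol := flow_solution (ltW T0) s0 bA e0 mU bU UE.
have [_ uniq] := wp (sobolevZ e hphi) small; have fE := uniq _ sol.
set w := hdist (second_flow T h0 t) in hw m mm *.
have gE : pairing t w (flow (e *: hdist h0)) = sob_ip s (hdist (U t)) w.
  by rewrite /pairing -fE flow_curveE.
pose L := linear_flow T h0 t; pose S := second_flow T h0 t.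
have bL : bounded_by (2 * A) L := linear_flow_bounded (ltW T0) bA t.
pose r1 z := (- e ^+ 2) * S z + ((- e) * L z + U t z).
have br : bounded_by (K0 * e ^+ 3) r1.
  split; first by have [m1 _] := bL; have [m2 _] := bw; have [m3 _] := bU t; rewrite /r1; meas.
  move=> z; have := picard_expansion (ltW T0) bA e0 mU bU UE t z.
  by rewrite /r1 /S /L /K0 (_ : U t z - _ - _ = - e ^+ 2 * second_flow T h0 t z +
    (- e * linear_flow T h0 t z + U t z))//; ring.
have iL := bounded_by_integ bL; have iS := bounded_by_integ bw; have iU := bounded_by_integ (bU t).
have iLU : integ (mu2 R) (fun z => (- e) * L z + U t z) by apply: integD => //; exact: integZ.
have rE : hdist r1 = ((- e ^+ 2) *: w + ((- e) *: hdist L + hdist (U t)) : functional R).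
  exact: (etrans (hdist_lc (- e ^+ 2) iS iLU)
    (congr1 (fun v : functional R => (- e ^+ 2) *: hdist S + v) (hdist_lc (- e) iL iU))).
have alg (x y z : R) : y - e * x - e ^+ 2 * z = - e ^+ 2 * z + (- e * x + y) by ring.
have hL : sobolev s 0 (hdist L) := sobolev_hdist s0 bL.
have hU : sobolev s 0 (hdist (U t)) := sobolev_hdist s0 (bU t).
have hr : sobolev s 0 (hdist r1) := sobolev_hdist s0 br.
have E : pairing t w (flow (e *: hdist h0)) - e * sob_ip s (hdist L) w - e ^+ 2 * sob_ip s w w = sob_ip s (hdist r1) w.
  have hLU := sobolev_lc (- e) hL hU.
  rewrite rE (sob_ip_lc (- e ^+ 2) hw hLU hw) (sob_ip_lc (- e) hL hU hw) gE.
  exact: (alg (sob_ip s (hdist L) w) (sob_ip s (hdist (U t)) w) (sob_ip s w w)).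
rewrite E; apply: le_trans (sob_ip_CS hr hw) _.
apply: le_trans (ler_wpM2r mm (sobolev_norm_hdist_le s0 br)) _.
by rewrite le_eqVlt; apply/orP; left; apply/eqP; ring.
Qed.

End Obstruction.

(** [rate s N] is [N^(2s+1)], of negative exponent. *)
Lemma rate_small (R : realType) (s T del : R) : s < - (1 / 2) -> 0 < T -> 0 < del ->
  exists N, [/\ 12 <= N, 1 <= 200 * N ^+ 2 * T, 0 < rate s N & rate s N < del].
Proof.
move=> hs T0 del0; pose p := - (2 * s + 1).
have p0 : 0 < p by rewrite /p; lra.
pose Y := (del^-1 + 1) `^ p^-1; pose N := Num.max 12 (Num.max T^-1 Y).
have N12 : 12 <= N by rewrite /N le_max lexx.
have NT : T^-1 <= N by rewrite /N !le_max lexx orbT.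
have NY : Y <= N by rewrite /N !le_max lexx !orbT.
have N0 : 0 < N by exact: lt_le_trans N12.
have di0 : 0 < del^-1 by rewrite invr_gt0.
have rE : rate s N = (N `^ p)^-1.
  rewrite /rate -[X in _ * X](powRr1 (ltW N0)) -powRD; last by rewrite (gt_eqF N0) implybT.
  by rewrite -powRN /p opprK.
have NpP : 0 < N `^ p by rewrite powR_gt0.
exists N; split => //.
- have h1 : 1 <= N * T by rewrite -ler_pdivrMr// mul1r.
  have : 12 * 1 <= N * (N * T) by apply: ler_pM.
  have -> : 200 * N ^+ 2 * T = 200 * (N * (N * T)) by ring.
  lra.
- by rewrite rE invr_gt0.
rewrite rE -[ltRHS]invrK ltf_pV2 ?posrE//.
have : Y `^ p <= N `^ p.
  by have := ge0_ler_powR (ltW p0); apply => //; rewrite nnegrE ?powR_ge0 ?(ltW N0).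
rewrite /Y -powRrM mulVf ?gt_eqF// powRr1 ?addr_ge0 ?(ltW di0)//.
by apply: lt_le_trans; rewrite ltrDl.
Qed.

Lemma quadratic_bound_absurd (R : realType) (C a c X m n : R) : 0 < a -> 0 < X ->
  X * (C ^+ 2 * c ^+ 2 + 1) < a -> 0 <= m ->
  a * X <= m ^+ 2 -> n ^+ 2 <= c * X -> 2 * m <= C * n ^+ 2 -> False.
Proof.
move=> a0 X0 hX m0 h1 h2 h3.
have h4 : (2 * m) ^+ 2 <= (C * n ^+ 2) ^+ 2.
  have m20 : 0 <= 2 * m by rewrite mulr_ge0.
  by rewrite ler_pXn2r ?nnegrE//; exact: le_trans m20 h3.
have h5 : (n ^+ 2) ^+ 2 <= (c * X) ^+ 2.
  rewrite ler_pXn2r// ?nnegrE ?sqr_ge0//; exact: le_trans (sqr_ge0 n) h2.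
have h6 : (2 * m) ^+ 2 <= C ^+ 2 * c ^+ 2 * X * X.
  apply: le_trans h4 _; rewrite exprMn.
  apply: le_trans (ler_wpM2l (sqr_ge0 C) h5) _.
  by rewrite le_eqVlt; apply/orP; left; apply/eqP; ring.
have h7 : C ^+ 2 * c ^+ 2 * X * X <= a * X.
  rewrite ler_pM2r//; apply: ltW; apply: le_lt_trans hX.
  by rewrite mulrC; apply: ler_wpM2l; [exact: ltW|rewrite lerDl ler01].
have aX : 0 < a * X by exact: mulr_gt0.
have h8 : (2 * m) ^+ 2 = 4 * m ^+ 2 by ring.
lra.
Qed.

Theorem theorem2p3 (R : realType) (s : R) (hs : s < - (1 / 2)) :
  ~ exists T : R, 0 < T /\
    exists (r : R) (flow : functional R -> R -> functional R),
    [/\ 0 < r,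
        forall phi, sobolev s 0 phi -> sobolev_norm s 0 phi < r ->
          KPBI_solution T s 0 phi (flow phi) /\
          forall u, KPBI_solution T s 0 phi u -> u = flow phi
      & C2_at_origin (sobolev s 0) (sobolev_norm s 0)
          (sobolev_curve T s 0) (curve_norm T s 0) flow].
Proof.


move=> [T [T0 [r [flow [r0 wp C2]]]]].
have s0 : s <= 0 by lra.
have [C hC] := second_flow_quadratic s0 T0 r0 wp C2.
pose a := (hkap R / 12800) ^+ 2 * 4 `^ (2 * s); pose c := 16 * 2^-1 `^ (2 * s).
have a0 : 0 < a.
  apply: mulr_gt0; last by rewrite powR_gt0.
  by apply: exprn_gt0; apply: divr_gt0; [exact: hkap_gt0|rewrite ltr0n].
have q0 : 0 <= C ^+ 2 * c ^+ 2 by rewrite mulr_ge0// sqr_ge0.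
have q1 : 0 < C ^+ 2 * c ^+ 2 + 1 := ltr_wpDl q0 ltr01.
have [N [N12 NT X0 hX]] := rate_small hs T0 (divr_gt0 a0 q1).
have [A bA] := packets_bounded N12.
have := hC _ _ _ bA (interaction_time_itv N12 NT).
have := sobolev_norm_packets s0 N12; have := sobolev_norm_second_flow s0 T0 N12 NT.
rewrite ltr_pdivlMr// in hX => h1 h2 h3.
exact: quadratic_bound_absurd a0 X0 hX (sobolev_norm_ge0 _ _) h1 h2 h3.
Qed.
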